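(* Let $\mathcal G=(\mathbb C^V,\hat T)$ be one of the following three classical graphs: the $9$-Paley graph $9P$, the $16$-Clebsch graph $16Cl$, or the Higman–Sims graph $HS$. Then there exists a quantum graph $\mathcal G_q=(X_q,\hat T_q)$ (denoted $9P_q$, $16Cl_q$, $HS_q$ respectively) whose finite quantum set $X_q$ is non-classical (its underlying C*-algebra is non-commutative) such that: (i) $\mathcal G_q$ is connected; (ii) $\mathcal G_q$ is $3$-point regular with the same parameters $(q_0,q_1,q_2,q_3,\lambda,\mu,k)$ as $\mathcal G$; (iii) $\mathcal G_q$ has the same Laplacian as $\mathcal G$, in the sense that $L(\hat T_q)$ and $L(\hat T)$ have the same spectrum counted with multiplicities; (iv) $\hat T_q$ and $\hat T$ have the same minimal polynomial; (v) there is a quantum graph isomorphism $\mathcal G\cong_q\mathcal G_q$.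
   Context: Finite quantum sets. A finite quantum set $X$ is a finite-dimensional C*-algebra $A$ with a faithful state $\psi$; $\ell^2(X)$ denotes $A$ with inner product $\langle a,b\rangle=\psi(a^*b)$, $m$ the multiplication, $\iota:\mathbb C\to\ell^2(X)$ the unit map, $m^\dagger,\iota^\dagger$ their Hilbert space adjoints, and it is required that $m m^\dagger=\delta^2\,\mathrm{id}$ for some $\delta>0$. Put $\mathrm{ev}_X=\iota^\dagger m$, $\mathrm{coev}_X=m^\dagger\iota$, $J=\delta^2\iota\iota^\dagger$. A classical set $V$ with $N$ points is $\mathbb C^N$ with the normalized trace, and then $\delta^2=N$. Quantum graphs. On $\mathrm{End}(\ell^2(X))$ put $S\star T=\delta^{-2}m(S\otimes T)m^\dagger$ and $T^*=(\mathrm{ev}_X\otimes\mathrm{id})(\mathrm{id}\otimes T^\dagger\otimes\mathrm{id})(\mathrm{id}\otimes\mathrm{coev}_X)$. A quantum graph $(X,\hat T)$ is an operator $\hat T\in\mathrm{End}(\ell^2(X))$ with $\hat T\star\hat T=\hat T$; it is irreflexive if $\hat T\star\mathrm{id}=0=\mathrm{id}\star\hat T$, real if $\hat T^*=\hat T$, undirected if $\hat T^\dagger=\hat T$. A classical simple graph is viewed as the quantum graph over $\mathbb C^V$ given by its adjacency matrix. For an irreflexive graph the complement is $\hat T^c=J-\mathrm{id}-\hat T$. Laplacian, connectivity. $L(\hat T)=(\iota^\dagger\otimes\mathrm{id})(\hat T\otimes\mathrm{id})m^\dagger-\hat T$. The number of connected components is $\#\pi_0=\dim\ker L(\hat T)$;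 the graph is connected if this number is $1$. $3$-point regularity. For operators $R,S,T$ on $\ell^2(X)$ let ${}_R\triangle_S^T=(\mathrm{id}\otimes m)(\mathrm{id}\otimes T\otimes\mathrm{id})(m^\dagger\otimes\mathrm{id})(R\otimes S)m^\dagger$, and $\blacktriangle=(\hat T\otimes\hat T)m^\dagger\hat T$, both maps $\ell^2(X)\to\ell^2(X)\otimes\ell^2(X)$. An undirected irreflexive quantum graph is $3$-point regular with parameters $(q_0,q_1,q_2,q_3,\lambda,\mu,k)$ if, writing $T=\hat T$, $C=\hat T^c$, $I=\mathrm{id}$, $$\delta^2\blacktriangle=q_3\,{}_T\triangle_T^T+q_2\left({}_C\triangle_T^T+{}_T\triangle_C^T+{}_T\triangle_T^C\right)+q_1\left({}_C\triangle_C^T+{}_C\triangle_T^C+{}_T\triangle_C^C\right)+q_0\,{}_C\triangle_C^C+\lambda\left({}_T\triangle_T^I+{}_T\triangle_I^T+{}_I\triangle_T^T\right)+\mu\left({}_C\triangle_C^I+{}_C\triangle_I^C+{}_I\triangle_C^C\right)+k\,{}_I\triangle_I^I .$$ Quantum isomorphisms. A quantum isomorphism from $X$ to $X'$ is a finite-dimensional Hilbert space $H$ with a linear map $P:H\otimes\ell^2(X)\to\ell^2(X')\otimes H$ satisfying $(m_{X'}^\dagger\otimes\mathrm{id})P=(\mathrm{id}\otimes P)(P\otimes\mathrm{id})(\mathrm{id}_H\otimes m_X^\dagger)$, $(\iota_{X'}^\dagger\otimes\mathrm{id}_H)P=\mathrm{id}_H\otimes\iota_X^\dagger$, $P^\dagger=(\mathrm{ev}_{X'}\otimes\mathrm{id}_H\otimes\mathrm{id}_X)(\mathrm{id}_{X'}\otimes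 P\otimes\mathrm{id}_X)(\mathrm{id}_{X'}\otimes\mathrm{id}_H\otimes\mathrm{coev}_X)$, $P(\mathrm{id}_H\otimes m_X)=(m_{X'}\otimes\mathrm{id}_H)(\mathrm{id}\otimes P)(P\otimes\mathrm{id})$ and $P(\mathrm{id}_H\otimes\iota_X)=\iota_{X'}\otimes\mathrm{id}_H$ (here $H\neq0$). It is a quantum graph isomorphism $(X,\hat T)\cong_q(X',\hat T')$ if moreover $P(\mathrm{id}_H\otimes\hat T)=(\hat T'\otimes\mathrm{id}_H)P$. The classical graphs. $9P$ is the Cayley graph of $\mathbb Z_3\times\mathbb Z_3$ with connection set $\{\pm\varepsilon_1,\pm\varepsilon_2\}$ ($\varepsilon_i$ the canonical generators). $16Cl$ is the Cayley graph of $\mathbb Z_2^4$ with connection set $\{\varepsilon_1,\dots,\varepsilon_4,\varepsilon_1+\varepsilon_2+\varepsilon_3+\varepsilon_4\}$. $HS$ is the unique strongly regular graph with parameters $(n,k,\lambda,\mu)=(100,22,0,6)$. *)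

(* Defs.v *)
From HB Require Import structures.
From mathcomp Require Import all_boot all_order all_algebra all_field.
From mathcomp Require Import reals complex mxtens.

Set Implicit Arguments.
Unset Strict Implicit.
Unset Printing Implicit Defensive.

Import Order.TTheory GRing.Theory Num.Theory.
Local Open Scope ring_scope.
Local Open Scope sesquilinear_scope.

Notation "A *t B" := (tensmx A B)
  (at level 40, left associativity, format "A  *t  B") : ring_scope.

Section FiniteQuantumSets.

Variable R : realType.
Local Notation C := R[i].

(* Finite dimension makes the norm complete. *)
Record cstar_algebra := CStarAlgebra {
  calg :> falgType C;
  star : calg -> calg;
  cnorm : calg -> R;
  star_semilinear : forall (c : C) x y, star (c *: x + y) = c^* *: star x + star y;
  starM : forall x y, star (x * y) = star y * star x;
  starK : involutive star;
  cnorm_eq0 : forall x, cnorm x = 0 -> x = 0;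
  cnormD : forall x y, cnorm (x + y) <= cnorm x + cnorm y;
  cnormZ : forall (c : C) x, cnorm (c *: x) = Normc.normc c * cnorm x;
  cnormM : forall x y, cnorm (x * y) <= cnorm x * cnorm y;
  cnorm_star : forall x, cnorm (star x * x) = cnorm x ^+ 2
}.

(* A C*-algebra with a faithful state [qstate], together with coordinates: an
   orthonormal basis for <x, y> = qstate (x^* y).  The space l^2(X) is identified
   with column vectors through this basis, operators with their matrices, the
   Hilbert space adjoint with [^t*] and the tensor product with [*t].  No notion
   below depends on the choice of the basis. *)
Record state_algebra := StateAlgebra {
  qalg :> cstar_algebra;
  qstate : qalg -> C;
  qstate_linear : scalar qstate;
  qstate1 : qstate 1 = 1;
  qstate_ge0 : forall x, 0 <= qstate (star x * x);
  qstate_faithful : forall x, qstate (star x * x) = 0 -> x = 0;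
  qdim : nat;
  qbasis : qdim.-tuple qalg;
  qbasisP : basis_of {:qalg} qbasis;
  qbasis_orthonormal : forall i j,
    qstate (star (tnth qbasis i) * tnth qbasis j) = (i == j)%:R
}.

Definition qinner (X : state_algebra) (x y : X) : C := qstate (star x * y).

Definition mulmat (X : state_algebra) : 'M[C]_(qdim X, qdim X * qdim X) :=
  \matrix_(k, p) qinner (tnth (qbasis X) k)
    (tnth (qbasis X) (mxtens_unindex p).1 * tnth (qbasis X) (mxtens_unindex p).2).

Definition unitmat (X : state_algebra) : 'M[C]_(qdim X, 1) :=
  \matrix_(k, _) qinner (tnth (qbasis X) k) 1.

Record qset := QSet {
  qspace :> state_algebra;
  qdelta : C;
  qdelta_gt0 : 0 < qdelta;
  qset_special : mulmat qspace *m (mulmat qspace)^t* = (qdelta ^+ 2)%:M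
}.

Definition noncommutative (X : qset) : Prop := exists x y : X, x * y <> y * x.

(* Coherence isomorphisms of the tensor product of matrices. *)
Definition tens_assoc (a b c : nat) : 'M[C]_(a * (b * c), a * b * c) :=
  \matrix_(p, q)
    (let: (ij, k) := mxtens_unindex q in
     let: (i, j) := mxtens_unindex ij in
     p == mxtens_index (i, mxtens_index (j, k)))%:R.

Definition tens_assocV (a b c : nat) : 'M[C]_(a * b * c, a * (b * c)) :=
  (tens_assoc a b c)^T.

Definition tens_lunit (a : nat) : 'M[C]_(a, 1 * a) :=
  \matrix_(i, p) (i == (mxtens_unindex p).2)%:R.

Definition tens_runit (a : nat) : 'M[C]_(a, a * 1) :=
  \matrix_(i, p) (i == (mxtens_unindex p).1)%:R.

Section Operators.

Variable X : qset.
Local Notation n := (qdim X).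
Local Notation m := (mulmat X).
Local Notation iota := (unitmat X).
Local Notation delta := (qdelta X).
Local Notation Id := (1%:M : 'M[C]_n).
Implicit Types S T : 'M[C]_n.

Definition qev : 'M[C]_(1, n * n) := iota^t* *m m.
Definition qcoev : 'M[C]_(n * n, 1) := m^t* *m iota.
Definition Jmat : 'M[C]_n := delta ^+ 2 *: (iota *m iota^t*).

Definition star_prod S T : 'M[C]_n := delta^-1 ^+ 2 *: (m *m (S *t T) *m m^t*).

Definition irreflexive_op T : Prop := star_prod T Id = 0 /\ star_prod Id T = 0.
Definition undirected_op T : Prop := T^t* = T.
Definition compl_op T : 'M[C]_n := Jmat - Id - T.

Definition laplacian T : 'M[C]_n :=
  tens_lunit n *m (iota^t* *t Id) *m (T *t Id) *m m^t* - T.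

(* Operators act on columns whereas [kermx] is a row kernel, hence the transpose. *)
Definition num_components T : nat := \rank (kermx (laplacian T)^T).

(* [triangle A B D] has lower left leg A, lower right leg B and upper edge D. *)
Definition triangle (A B D : 'M[C]_n) : 'M[C]_(n * n, n) :=
  (Id *t m) *m tens_assoc n n n *m ((Id *t D) *t Id) *m (m^t* *t Id)
    *m (A *t B) *m m^t*.

Definition black_triangle T : 'M[C]_(n * n, n) := (T *t T) *m m^t* *m T.

End Operators.

Record qgraph := QGraph {
  qvertices :> qset;
  qadj : 'M[C]_(qdim qvertices);
  qadj_idem : star_prod qadj qadj = qadj
}.

Record regularity_params := RegularityParams {
  par_q0 : C; par_q1 : C; par_q2 : C; par_q3 : C;
  par_lambda : C; par_mu : C; par_k : C
}.

Definition three_point_regular (G : qgraph) (p : regularity_params) : Prop :=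
  let T := qadj G in
  let K := compl_op T in
  let I := 1%:M : 'M[C]_(qdim G) in
  [/\ irreflexive_op T, undirected_op T &
    qdelta G ^+ 2 *: black_triangle T =
      par_q3 p *: triangle T T T
      + par_q2 p *: (triangle K T T + triangle T K T + triangle T T K)
      + par_q1 p *: (triangle K K T + triangle K T K + triangle T K K)
      + par_q0 p *: triangle K K K
      + par_lambda p *: (triangle T T I + triangle T I T + triangle I T T)
      + par_mu p *: (triangle K K I + triangle K I K + triangle I K K)
      + par_k p *: triangle I I I].

Definition connected_qgraph (G : qgraph) : Prop := num_components (qadj G) = 1%N.

(* Equality of the spectra as multisets (algebraic multiplicities). *)
Definition same_spectrum (n n' : nat) (A : 'M[C]_n) (B : 'M[C]_n') : Prop :=
  forall a : C, mup a (char_poly A) = mup a (char_poly B).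

Definition mxeval (n : nat) (p : {poly C}) (A : 'M[C]_n) : 'M[C]_n :=
  \sum_(i < size p) p`_i *: A ^+ i.

(* [mxminpoly] is restricted to successor sizes; dimensions are arbitrary here. *)
Definition is_minpoly (n : nat) (A : 'M[C]_n) (p : {poly C}) : Prop :=
  [/\ p \is monic, mxeval p A = 0 &
      forall q : {poly C}, mxeval q A = 0 -> p %| q].

Definition same_minpoly (n n' : nat) (A : 'M[C]_n) (B : 'M[C]_n') : Prop :=
  exists p : {poly C}, is_minpoly A p /\ is_minpoly B p.

Section QuantumIsomorphism.

(* H = C^h, in orthonormal coordinates. *)
Variables (X Y : qset) (h : nat).
Local Notation n := (qdim X).
Local Notation n' := (qdim Y).
Variable P : 'M[C]_(n' * h, h * n).

(* (id (x) P) (P (x) id), from H (x) l^2(X) (x) l^2(X) to l^2(Y) (x) l^2(Y) (x) H *)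
Definition qiso_twice : 'M[C]_(n' * n' * h, h * (n * n)) :=
  tens_assocV n' n' h *m ((1%:M : 'M_n') *t P) *m tens_assoc n' h n
    *m (P *t (1%:M : 'M_n)) *m tens_assocV h n n.

(* (ev (x) id (x) id) (id (x) P (x) id) (id (x) id (x) coev),
   from l^2(Y) (x) H to H (x) l^2(X) *)
Definition qiso_bend : 'M[C]_(h * n, n' * h) :=
  (tens_lunit h *t (1%:M : 'M_n))
    *m ((qev Y *t (1%:M : 'M_h)) *t (1%:M : 'M_n))
    *m (tens_assocV n' n' h *t (1%:M : 'M_n))
    *m (((1%:M : 'M_n') *t P) *t (1%:M : 'M_n))
    *m (tens_assoc n' h n *t (1%:M : 'M_n))
    *m tens_assocV (n' * h) n n
    *m ((1%:M : 'M_(n' * h)) *t qcoev X)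
    *m (tens_runit (n' * h))^T.

Definition is_qiso : Prop :=
  [/\ ((mulmat Y)^t* *t (1%:M : 'M_h)) *m P
        = qiso_twice *m ((1%:M : 'M_h) *t (mulmat X)^t*),
      tens_lunit h *m ((unitmat Y)^t* *t (1%:M : 'M_h)) *m P
        = tens_runit h *m ((1%:M : 'M_h) *t (unitmat X)^t*),
      P^t* = qiso_bend,
      P *m ((1%:M : 'M_h) *t mulmat X)
        = (mulmat Y *t (1%:M : 'M_h)) *m qiso_twice
    & P *m ((1%:M : 'M_h) *t unitmat X) *m (tens_runit h)^T
        = (unitmat Y *t (1%:M : 'M_h)) *m (tens_lunit h)^T].

End QuantumIsomorphism.

Definition qgraph_iso (G G' : qgraph) : Prop :=
  exists (h : nat) (P : 'M[C]_(qdim G' * h, h * qdim G)),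
    [/\ (0 < h)%N, is_qiso P &
        P *m ((1%:M : 'M_h) *t qadj G) = (qadj G' *t (1%:M : 'M_h)) *m P].

End FiniteQuantumSets.

Section ClassicalSets.

Variables (R : realType) (V : finType) (V_gt0 : (0 < #|V|)%N).
Local Notation C := R[i].

Definition cfun (_ : (0 < #|V|)%N) := {ffun V -> C^o}.
Local Notation A := (cfun V_gt0).

HB.instance Definition _ := Vector.on A.

Definition cfun_one : A := [ffun => 1].
Definition cfun_mul (f g : A) : A := [ffun v => (f v * g v : C)].

Fact cfun_mulA : associative cfun_mul.
Proof. by move=> f g k; apply/ffunP => v; rewrite !ffunE mulrA. Qed.
Fact cfun_mul1l : left_id cfun_one cfun_mul.
Proof. by move=> f; apply/ffunP => v; rewrite !ffunE mul1r. Qed.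
Fact cfun_mul1r : right_id cfun_one cfun_mul.
Proof. by move=> f; apply/ffunP => v; rewrite !ffunE mulr1. Qed.
Fact cfun_mulDl : left_distributive cfun_mul +%R.
Proof. by move=> f g k; apply/ffunP => v; rewrite !ffunE mulrDl. Qed.
Fact cfun_mulDr : right_distributive cfun_mul +%R.
Proof. by move=> f g k; apply/ffunP => v; rewrite !ffunE mulrDr. Qed.
Fact cfun_one_neq0 : cfun_one != 0.
Proof.
have /card_gt0P[v _] := V_gt0.
by apply/eqP => /ffunP/(_ v)/eqP; rewrite !ffunE oner_eq0.
Qed.

HB.instance Definition _ := GRing.Zmodule_isNzRing.Build A
  cfun_mulA cfun_mul1l cfun_mul1r cfun_mulDl cfun_mulDr cfun_one_neq0.

Fact cfun_scaleAl (c : C) (f g : A) : c *: (f * g) = (c *: f) * g.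
Proof. by apply/ffunP => v; rewrite !ffunE; apply: mulrA. Qed.
HB.instance Definition _ := GRing.Lmodule_isLalgebra.Build C A cfun_scaleAl.

Fact cfun_scaleAr (c : C) (f g : A) : c *: (f * g) = f * (c *: g).
Proof. by apply/ffunP => v; rewrite !ffunE; apply: mulrCA. Qed.
HB.instance Definition _ := GRing.Lalgebra_isAlgebra.Build C A cfun_scaleAr.

HB.instance Definition _ := Algebra_isFalgebra.Build C A.

Lemma cfunME (f g : A) v : (f * g) v = (f v : C) * g v.
Proof. by rewrite ffunE. Qed.

Lemma cfun1E v : (1 : A) v = 1.
Proof. by rewrite ffunE. Qed.

Definition cfun_star (f : A) : A := [ffun v => ((f v : C)^* : C)].
Definition cfun_norm (f : A) : R := \big[Num.max/0]_v Normc.normc (f v : C).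
Definition cfun_state (f : A) : C := #|V|%:R^-1 * \sum_v (f v : C).
(* The normalised delta functions. *)
Definition cfun_basis : #|V|.-tuple A :=
  [tuple [ffun v => (sqrtC #|V|%:R *+ (v == enum_val i) : C)] | i < #|V|].


Local Notation N := (#|V|%:R : C).

Let N_gt0 : 0 < N. Proof. by rewrite ltr0n. Qed.
Let N_neq0 : N != 0. Proof. by rewrite gt_eqF. Qed.
Let sqrtN_ge0 : 0 <= sqrtC N. Proof. by rewrite sqrtC_ge0 ltW. Qed.
Let sqrtN_neq0 : sqrtC N != 0. Proof. by rewrite sqrtC_eq0. Qed.

Fact cfun_star_semilinear (c : C) (f g : A) :
  cfun_star (c *: f + g) = c^* *: cfun_star f + cfun_star g.
Proof. by apply/ffunP => v; rewrite !ffunE rmorphD rmorphM. Qed.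
Fact cfun_starM (f g : A) : cfun_star (f * g) = cfun_star g * cfun_star f.
Proof. by apply/ffunP => v; rewrite cfunME !ffunE rmorphM mulrC. Qed.
Fact cfun_starK : involutive cfun_star.
Proof. by move=> f; apply/ffunP => v; rewrite !ffunE conjCK. Qed.

Let normc_ge0 (x : C) : 0 <= Normc.normc x.
Proof. by case: x => a b; rewrite sqrtr_ge0. Qed.
Let normc_conj (x : C) : Normc.normc x^* = Normc.normc x.
Proof. by case: x => a b; rewrite /Normc.normc /= sqrrN. Qed.
Let normc_le (f : A) v : Normc.normc (f v : C) <= cfun_norm f.
Proof. by apply: (le_bigmax 0 (fun v => Normc.normc (f v : C)) v). Qed.
Let norm_ge0 (f : A) : 0 <= cfun_norm f.
Proof.
have /card_gt0P[v _] := V_gt0.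
exact: le_trans (normc_ge0 _) (normc_le f v).
Qed.
Let norm_max (f : A) : exists v, cfun_norm f = Normc.normc (f v : C).
Proof.
have /card_gt0P[v0 _] := V_gt0.
have [v _ fv] := @eq_bigmax _ _ _ 0 v0 xpredT
  (fun v => Normc.normc (f v : C)) isT (fun v _ => normc_ge0 _).
by exists v.
Qed.

Fact cfun_norm_eq0 (f : A) : cfun_norm f = 0 -> f = 0.
Proof.
move=> f0; apply/ffunP => v; rewrite ffunE; apply: Normc.eq0_normc.
by apply/eqP; rewrite eq_le normc_ge0 -f0 normc_le.
Qed.
Fact cfun_normD (f g : A) : cfun_norm (f + g) <= cfun_norm f + cfun_norm g.
Proof.
have [v ->] := norm_max (f + g); rewrite ffunE.
exact: le_trans (le_normcD _ _) (lerD (normc_le f v) (normc_le g v)).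
Qed.
Fact cfun_normZ (c : C) (f : A) :
  cfun_norm (c *: f) = Normc.normc c * cfun_norm f.
Proof.
apply/eqP; rewrite eq_le; apply/andP; split.
  have [v ->] := norm_max (c *: f).
  by rewrite ffunE Normc.normcM ler_wpM2l ?normc_le.
have [v ->] := norm_max f.
by rewrite -Normc.normcM; have := normc_le (c *: f) v; rewrite ffunE.
Qed.
Fact cfun_normM (f g : A) : cfun_norm (f * g) <= cfun_norm f * cfun_norm g.
Proof.
have [v ->] := norm_max (f * g).
by rewrite cfunME Normc.normcM ler_pM ?normc_le.
Qed.
Fact cfun_norm_star (f : A) : cfun_norm (cfun_star f * f) = cfun_norm f ^+ 2.
Proof.
apply/eqP; rewrite eq_le; apply/andP; split.
  have [v ->] := norm_max (cfun_star f * f).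
  by rewrite cfunME Normc.normcM ffunE normc_conj expr2 ler_pM ?normc_le.
have [v fv] := norm_max f.
have := normc_le (cfun_star f * f) v.
by rewrite cfunME Normc.normcM ffunE normc_conj -expr2 fv.
Qed.

Definition cfun_cstar : cstar_algebra R :=
  CStarAlgebra cfun_star_semilinear cfun_starM cfun_starK cfun_norm_eq0
    cfun_normD cfun_normZ cfun_normM cfun_norm_star.

Fact cfun_state_linear : scalar cfun_state.
Proof.
move=> c f g; rewrite /cfun_state.
have -> : \sum_v ((c *: f + g) v : C) = c * \sum_v (f v : C) + \sum_v (g v : C).
  by rewrite mulr_sumr -big_split /=; apply: eq_bigr => v _; rewrite !ffunE.
by rewrite mulrDr mulrCA.
Qed.
Fact cfun_state1 : cfun_state 1 = 1.
Proof.
rewrite /cfun_state (eq_bigr (fun=> 1)) => [|v _]; last exact: cfun1E.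
by rewrite sumr_const mulVf.
Qed.
Let sqE (f : A) : cfun_state (cfun_star f * f) = N^-1 * \sum_v `|f v : C| ^+ 2.
Proof.
by congr (_ * _); apply: eq_bigr => v _; rewrite cfunME ffunE mulrC -normCK.
Qed.
Fact cfun_state_ge0 (f : A) : 0 <= cfun_state (cfun_star f * f).
Proof.
rewrite sqE; apply: mulr_ge0; first by rewrite invr_ge0 ltW.
by apply: sumr_ge0 => v _; rewrite exprn_ge0.
Qed.
Fact cfun_state_faithful (f : A) : cfun_state (cfun_star f * f) = 0 -> f = 0.
Proof.
move/eqP; rewrite sqE mulf_eq0 invr_eq0 (negPf N_neq0) /=.
rewrite psumr_eq0 => [/allP f0|v _]; last by rewrite exprn_ge0.
apply/ffunP => v; rewrite ffunE; apply/eqP.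
by have := f0 v (mem_index_enum _); rewrite /= expf_eq0 normr_eq0.
Qed.

Let basisE i v : (tnth cfun_basis i v : C) = sqrtC N *+ (v == enum_val i).
Proof. by rewrite tnth_mktuple ffunE. Qed.

Let innerE (f : A) i :
  cfun_state (cfun_star (tnth cfun_basis i) * f) = (sqrtC N)^-1 * f (enum_val i).
Proof.
rewrite /cfun_state (bigD1 (enum_val i)) //= cfunME big1 => [|v /negPf vi]; last first.
  by rewrite cfunME ffunE basisE vi conjC0 mul0r.
rewrite ffunE basisE eqxx addr0 mulrA (geC0_conj sqrtN_ge0); congr (_ * _).
by rewrite -[in N^-1](sqrtCK N) expr2 invfM -mulrA mulVf ?mulr1.
Qed.

Fact cfun_basis_orthonormal i j :
  cfun_state (cfun_star (tnth cfun_basis i) * tnth cfun_basis j) = (i == j)%:R.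
Proof.
rewrite innerE basisE (inj_eq enum_val_inj).
by case: (i == j); rewrite ?mulr0 ?mulVf.
Qed.

Fact cfun_basisP : basis_of {:A} cfun_basis.
Proof.
rewrite basisEdim size_tuple dimvf /dim /= muln1 leqnn andbT.
apply/subvP => f _.
have -> : f = \sum_i ((sqrtC N)^-1 * f (enum_val i)) *: tnth cfun_basis i.
  apply/ffunP => v; rewrite sum_ffunE (bigD1 (enum_rank v)) //= big1 => [|i iv].
    rewrite ffunE [X in _ *: X]basisE enum_rankK eqxx addr0.
    by rewrite /GRing.scale /= mulrAC mulVf ?mul1r.
  rewrite ffunE [X in _ *: X]basisE; case: eqP => [vi|_]; last exact: mulr0.
  by rewrite vi enum_valK eqxx in iv.
by apply: memv_suml => i _; rewrite memvZ // memv_span ?mem_tnth.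
Qed.

Definition cfun_state_algebra : state_algebra R :=
  @StateAlgebra R cfun_cstar cfun_state cfun_state_linear cfun_state1
    cfun_state_ge0 cfun_state_faithful #|V| cfun_basis cfun_basisP
    cfun_basis_orthonormal.

Lemma cfun_mulmatE k p : mulmat cfun_state_algebra k p =
  sqrtC N *+ ((k == (mxtens_unindex p).1) && (k == (mxtens_unindex p).2)).
Proof.
rewrite mxE /qinner [LHS]innerE cfunME !basisE !(inj_eq enum_val_inj).
case: (k == _) => /=; last by rewrite mul0r mulr0.
by case: (k == _); rewrite ?mulr0 // mulrA mulVf ?mul1r.
Qed.

Let sum_tens (n : nat) (F : 'I_n -> 'I_n -> C) :
  \sum_p F (mxtens_unindex p).1 (mxtens_unindex p).2 = \sum_i \sum_j F i j.
Proof.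
rewrite pair_big /= (reindex (@mxtens_index n n)); last first.
  by exists (@mxtens_unindex n n) => i _; rewrite (mxtens_indexK, mxtens_unindexK).
by apply: eq_bigr => ij _; rewrite -[in RHS](mxtens_indexK ij).
Qed.

Let sum_mulmat (F : 'I_#|V| -> 'I_#|V| -> C) k :
  \sum_p mulmat cfun_state_algebra k p
    * F (mxtens_unindex p).1 (mxtens_unindex p).2 = sqrtC N * F k k.
Proof.
under eq_bigr => p _ do rewrite cfun_mulmatE.
rewrite (sum_tens (fun i j => sqrtC N *+ ((k == i) && (k == j)) * F i j)).
rewrite (bigD1 k) //= (bigD1 k) //= !eqxx /= !big1 ?addr0 // => i /negPf ik.
  by rewrite big1 // => j _; rewrite [k == i]eq_sym ik mul0r.
by rewrite [k == i]eq_sym ik mul0r.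
Qed.

Lemma cfun_mulmat_tens (S T : 'M[C]_#|V|) :
  mulmat cfun_state_algebra *m (S *t T) *m (mulmat cfun_state_algebra)^t*
    = N *: \matrix_(i, j) (S i j * T i j).
Proof.
apply/matrixP => k l; rewrite !mxE -[in RHS](sqrtCK N) expr2.
transitivity (\sum_q mulmat cfun_state_algebra l q
    * (sqrtC N * (S k (mxtens_unindex q).1 * T k (mxtens_unindex q).2))).
  apply: eq_bigr => q _; rewrite [RHS]mulrC; congr (_ * _).
    rewrite mxE -(sum_mulmat (fun i j => S i (mxtens_unindex q).1
                                         * T j (mxtens_unindex q).2)).
    by apply: eq_bigr => p _; congr (_ * _); rewrite mxE.
  rewrite [LHS]mxE [X in _ X = _]mxE.
  by rewrite cfun_mulmatE rmorphMn /= (geC0_conj sqrtN_ge0).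
have := sum_mulmat (fun i j => sqrtC N * (S k i * T k j)) l.
by rewrite mulrA.
Qed.

Fact cfun_special : mulmat cfun_state_algebra *m (mulmat cfun_state_algebra)^t*
  = (sqrtC N ^+ 2)%:M.
Proof.
have tens1 : (1%:M : 'M[C]_#|V|) *t (1%:M : 'M[C]_#|V|) = 1%:M.
  apply/matrixP => i j; rewrite !mxE -natrM mulnb; congr (nat_of_bool _)%:R.
  by rewrite -(inj_eq (can_inj (@mxtens_unindexK _ _))).
rewrite -[X in X *m _ = _]mulmx1 -tens1 cfun_mulmat_tens sqrtCK -[RHS]scalemx1.
congr (_ *: _); apply/matrixP => i j; rewrite !mxE.
by case: (i == j); rewrite ?mulr1 ?mulr0.
Qed.

Fact cfun_delta_gt0 : 0 < sqrtC N. Proof. by rewrite sqrtC_gt0. Qed.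

Definition cfun_qset : qset R := QSet cfun_delta_gt0 cfun_special.

Lemma cfun_star_prod (S T : 'M[C]_#|V|) :
  star_prod (X := cfun_qset) S T = \matrix_(i, j) (S i j * T i j).
Proof.
rewrite /star_prod [X in _ *: X]cfun_mulmat_tens /= exprVn sqrtCK.
by rewrite scalerA mulVf ?scale1r.
Qed.

End ClassicalSets.

Record sgraph := SGraph {
  vertex :> finType;
  adj : rel vertex;
  adj_sym : symmetric adj;
  adj_irrefl : irreflexive adj;
  vertex_gt0 : (0 < #|vertex|)%N
}.

Section ClassicalGraphs.

Variables (R : realType) (G : sgraph).

Definition adjmat : 'M[R[i]]_#|G| :=
  \matrix_(i, j) (adj (enum_val i : G) (enum_val j))%:R.

Fact adjmat_idem :
  star_prod (X := cfun_qset R (vertex_gt0 G)) adjmat adjmat = adjmat.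
Proof.
rewrite cfun_star_prod; apply/matrixP => i j; rewrite !mxE.
by case: adj; rewrite ?mulr1 ?mulr0.
Qed.

(* [cfun_basis] consists of the point masses, all rescaled by the same factor, so
   that an operator has the same matrix in [cfun_basis] and in the point masses. *)
Definition qgraph_of : qgraph R := QGraph adjmat_idem.

End ClassicalGraphs.

Section CayleyGraphs.

Variables (Z : finZmodType) (S : {set Z}).
Hypotheses (S_sym : forall x, (- x \in S) = (x \in S)) (S_0 : 0 \notin S).

Definition cayley_adj : rel Z := [rel x y | y - x \in S].

Fact cayley_sym : symmetric cayley_adj.
Proof. by move=> x y; rewrite /cayley_adj /= -S_sym opprB. Qed.
Fact cayley_irrefl : irreflexive cayley_adj.
Proof. by move=> x; rewrite /cayley_adj /= subrr (negPf S_0). Qed.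
Fact cayley_gt0 : (0 < #|Z|)%N.
Proof. by apply/card_gt0P; exists 0. Qed.

Definition cayley : sgraph := SGraph cayley_sym cayley_irrefl cayley_gt0.

End CayleyGraphs.

Definition paley9_set : {set 'rV['Z_3]_2} :=
  [set delta_mx 0 i | i : 'I_2] :|: [set - delta_mx 0 i | i : 'I_2].

Fact paley9_set_sym x : (- x \in paley9_set) = (x \in paley9_set).
Proof.
suff H y : y \in paley9_set -> - y \in paley9_set.
  by apply/idP/idP => [/H|/H //]; rewrite opprK.
rewrite !inE => /orP[] /imsetP[i _ ->]; apply/orP; [right|left].
  by apply/imsetP; exists i.
by rewrite opprK; apply/imsetP; exists i.
Qed.
Fact paley9_set_0 : 0 \notin paley9_set.
Proof.
rewrite !inE negb_or; apply/andP; split; apply/imsetP => -[i _ /rowP/(_ i)];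
  by rewrite !mxE !eqxx.
Qed.

Definition paley9 : sgraph :=
  @cayley 'rV['Z_3]_2 paley9_set paley9_set_sym paley9_set_0.

Definition clebsch16_set : {set 'rV['Z_2]_4} :=
  [set delta_mx 0 i | i : 'I_4] :|: [set \sum_(i < 4) delta_mx 0 i].

Fact clebsch16_set_sym x : (- x \in clebsch16_set) = (x \in clebsch16_set).
Proof.
suff -> : - x = x by [].
by apply/rowP => i; rewrite !mxE; case: (x 0 i) => [[|[|?]] ?] //; apply/val_inj.
Qed.
Fact clebsch16_set_0 : 0 \notin clebsch16_set.
Proof.
rewrite !inE negb_or; apply/andP; split.
  by apply/imsetP => -[i _ /rowP/(_ i)]; rewrite !mxE !eqxx.
apply/eqP => /rowP/(_ 0); rewrite !mxE summxE (bigD1 0) //= big1 => [|i /negPf i0].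
  by rewrite !mxE !eqxx addr0.
by rewrite !mxE eq_sym i0 andbF.
Qed.

Definition clebsch16 : sgraph :=
  @cayley 'rV['Z_2]_4 clebsch16_set clebsch16_set_sym clebsch16_set_0.

Definition common_neighbours (G : sgraph) (x y : G) : {set G} :=
  [set z | adj x z && adj y z].

Definition strongly_regular (G : sgraph) (n k lambda mu : nat) : Prop :=
  [/\ #|G| = n,
      forall x : G, #|[set y | adj x y]| = k,
      forall x y : G, adj x y -> #|common_neighbours x y| = lambda
    & forall x y : G, x != y -> ~~ adj x y -> #|common_neighbours x y| = mu].

(* The Higman-Sims graph is unique up to isomorphism with these parameters. *)
Definition is_higman_sims (G : sgraph) : Prop := strongly_regular G 100 22 0 6.

(* Main.v *)
(* Commuting involutive automorphisms s and t of a classical graph decompose C^V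
   into the joint eigenspaces p_x, x in (Z/2)^2.  Multiplying the component of
   degrees (x, y) of the product by the Pauli cocycle 'i ^+ e(x, y), where
   pauli x * pauli y = 'i ^+ e(x, y) pauli (x + y), yields another C*-algebra on
   the same Hilbert space, with the same unit.  The adjacency matrix commutes with
   every p_x and the cocycle is unitary, so products of the form m (A (x) B) m^t*
   do not change: the adjacency matrix is again a quantum graph, with the same
   Laplacian, and the twist multiplies both sides of the regularity equation by
   the same unitary.  The matrix sum_x pauli x (x) p_x is a quantum isomorphism.
   The twisted algebra is non-commutative as soon as one orbit of the group
   generated by s and t has four elements.

   It remains to find s and t.  For 9P these are two coordinate reflections, for
   16Cl two translations.  In HS, let a and b be non-adjacent and split their six
   common neighbours into three pairs.  The common neighbours of a, b and of each
   of the three pairs form a set F of 20 vertices, a doubled Petersen graph: every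
   vertex of F has a twin with the same neighbours in F.  Outside F, too, every
   vertex has exactly one partner with the same neighbours in F, and exchanging
   all partners while fixing F is an automorphism.  Two splittings sharing one
   pair give s and t; they commute because an automorphism which fixes a and its
   neighbours is the identity.

   HS and 16Cl are triangle free, and 3-point regular because the number of common
   neighbours of three pairwise non-adjacent vertices has zero variance. *)
Require Import Defs.
From HB Require Import structures.
From mathcomp Require Import all_boot all_order all_algebra all_field.
From mathcomp Require Import reals complex mxtens ring zify.
From mathcomp Require classical_sets.

Set Implicit Arguments.
Unset Strict Implicit.
Unset Printing Implicit Defensive.

Import Order.TTheory GRing.Theory Num.Theory.
Local Open Scope ring_scope.
Local Open Scope sesquilinear_scope.

(** * The operator norm *)

(** The powers of i in the cocycle w(x, y) make the Pauli matrices self-adjoint with square 1, so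
    that w(x, y)^* = w(y, x) and w(x, x) = 1. By the first equation coordinatewise conjugation stays
    an antimultiplicative star; by the second the state of a product of two elements does not
    change. The normalised point masses therefore remain an orthonormal basis of self-adjoint
    elements, and only the product is altered. A real-valued cocycle with the same symmetry would
    satisfy w(x, y) = w(y, x) and leave the algebra commutative; this is why fourth roots of unity
    are used.

    The twist does not come with a C*-norm. The norm is the operator norm of the left regular
    representation, which respects the star because the state is tracial.

    HS is given by its parameters only, so its automorphisms have to be derived from two counts: two
    non-adjacent vertices have six common neighbours, and three pairwise non-adjacent vertices have
    two. Almost every step there exhibits one common neighbour too many, or names the second of the
    two. *)

Section DotProduct.

Variables (C : numClosedFieldType) (n : nat).
Implicit Types (u v : 'rV[C]_n).

Lemma dotmx_triangle u v :
  sqrtC (dotmx (u + v) (u + v)) <= sqrtC (dotmx u u) + sqrtC (dotmx v v).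
Proof. by have [] := triangle_lerif (@dotmx C n) u v. Qed.

Lemma dotmxZ (c : C) u : dotmx (c *: u) (c *: u) = `|c| ^+ 2 * dotmx u u.
Proof. exact: dnormZ. Qed.

Lemma dotmx_ge0 u : 0 <= dotmx u u.
Proof. exact: dnorm_ge0. Qed.

Lemma dotmx_sqrt_ge0 u : 0 <= sqrtC (dotmx u u).
Proof. by rewrite sqrtC_ge0 dotmx_ge0. Qed.

Lemma dotmx_eq0 u : dotmx u u = 0 -> u = 0.
Proof. by move/eqP; rewrite dnorm_eq0 => /eqP. Qed.

Lemma dotmx_CauchySchwarz u v : `|dotmx u v| <= sqrtC (dotmx u u) * sqrtC (dotmx v v).
Proof. by have [] := CauchySchwarz_sqrt (@dotmx C n) u v. Qed.

(** Cauchy-Schwarz for the inner product of [u M M^*] with [u], which is the square of the norm of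
    [u M]. This is the source of the C*-identity. *)
Lemma dotmx_sqrt_mul (M : 'M[C]_n) u :
  dotmx (u *m M) (u *m M) <=
    sqrtC (dotmx (u *m (M *m M^t*)) (u *m (M *m M^t*))) * sqrtC (dotmx u u).
Proof.
apply: le_trans (dotmx_CauchySchwarz _ _).
have -> : dotmx (u *m (M *m M^t*)) u = dotmx (u *m M) (u *m M).
  by rewrite !dotmxE trmx_mul map_mxM /= !mulmxA.
by rewrite ger0_norm ?dotmx_ge0.
Qed.

Lemma dotmx_normZ (c : C) u :
  sqrtC (dotmx (c *: u) (c *: u)) = `|c| * sqrtC (dotmx u u).
Proof.
by rewrite dotmxZ sqrtCM ?nnegrE ?exprn_ge0 ?dotmx_ge0 // sqrCK.
Qed.

Lemma le_norm_dotmx u i : `|u 0 i| <= sqrtC (dotmx u u).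
Proof.
rewrite -(sqrCK (normr_ge0 _)).
rewrite ler_sqrtC ?nnegrE ?exprn_ge0 ?dnorm_ge0 // dotmxE mxE (bigD1 i) //=.
rewrite !mxE -normCK lerDl sumr_ge0 // => j _.
by rewrite !mxE -normCK exprn_ge0.
Qed.

End DotProduct.

Section OperatorNorm.

Import classical_sets.

Variables (R : realType) (n : nat).
Local Notation C := R[i].
Implicit Types (u v : 'rV[C]_n) (M N : 'M[C]_n).

(** The norms are locked so that unification does not unfold them into square roots and suprema. *)
Fact vnorm_key : unit. Proof. by []. Qed.
Definition vnorm u : R := locked_with vnorm_key (complex.Re (sqrtC (dotmx u u))).

Lemma real_complex_le (x y : R) (a b : C) :
  x%:C%C = a -> y%:C%C = b -> a <= b -> x <= y.
Proof. by move=> <- <-; rewrite lecR. Qed.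

Lemma vnormE u : (vnorm u)%:C%C = sqrtC (dotmx u u).
Proof.
by rewrite /vnorm unlock RRe_real // ger0_real // dotmx_sqrt_ge0.
Qed.

Lemma vnorm_ge0 u : 0 <= vnorm u.
Proof. by rewrite -lecR vnormE dotmx_sqrt_ge0. Qed.

Lemma vnorm_eq0 u : vnorm u = 0 -> u = 0.
Proof.
move/(congr1 (fun x => x%:C%C)); rewrite vnormE => /eqP.
by rewrite sqrtC_eq0 => /eqP/dotmx_eq0.
Qed.

Lemma vnorm0 : vnorm 0 = 0.
Proof. by apply: complexI; rewrite vnormE linear0l sqrtC0. Qed.

Lemma vnormD u v : vnorm (u + v) <= vnorm u + vnorm v.
Proof.
apply: (real_complex_le (vnormE _) _ (dotmx_triangle u v)).
exact: etrans (rmorphD _ _ _) (congr2 +%R (vnormE u) (vnormE v)).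
Qed.

Lemma vnormZ c u : vnorm (c *: u) = Normc.normc c * vnorm u.
Proof.
apply: complexI; apply: etrans (vnormE _) (etrans (dotmx_normZ c u) _).
exact: etrans (congr1 ( *%R _) (esym (vnormE u))) (esym (rmorphM _ _ _)).
Qed.

Lemma vnorm_sum (I : finType) (F : I -> 'rV[C]_n) :
  vnorm (\sum_i F i) <= \sum_i vnorm (F i).
Proof.
apply: (big_ind2 (fun u (x : R) => vnorm u <= x)) => // [|u x v y ux vy].
  by rewrite vnorm0.
exact: le_trans (vnormD _ _) (lerD ux vy).
Qed.

Lemma le_normc_vnorm u i : Normc.normc (u 0 i) <= vnorm u.
Proof. by rewrite -lecR vnormE; apply: le_norm_dotmx. Qed.

Fact opnorm_key : unit. Proof. by []. Qed.
Definition opnorm M : R := locked_with opnorm_key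
  (sup [set vnorm (u *m M) | u in [set u | vnorm u <= 1]]%classic).

Lemma vnorm_mul_bounded M :
  exists2 c : R, 0 <= c & forall u, vnorm (u *m M) <= c * vnorm u.
Proof.
exists (\sum_i vnorm (row i M)) => [|u].
  by apply: sumr_ge0 => i _; apply: vnorm_ge0.
rewrite mulmx_sum_row mulr_suml; apply: le_trans (vnorm_sum _) _.
apply: ler_sum => i _; rewrite vnormZ mulrC.
by rewrite ler_wpM2l ?vnorm_ge0 ?le_normc_vnorm.
Qed.

Lemma opnorm_has_ubound M :
  has_ubound [set vnorm (u *m M) | u in [set u | vnorm u <= 1]]%classic.
Proof.
have [c c0 Mc] := vnorm_mul_bounded M.
exists c => _ [u /= u1 <-]; apply: le_trans (Mc u) _.
by rewrite -[leRHS]mulr1 ler_wpM2l.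
Qed.

Lemma opnorm_ge0 M : 0 <= opnorm M.
Proof.
rewrite /opnorm unlock; apply: ub_le_sup; first exact: opnorm_has_ubound.
by exists 0; rewrite /= ?mul0mx vnorm0.
Qed.

Lemma le_opnorm M u : vnorm (u *m M) <= opnorm M * vnorm u.
Proof.
have [/eqP /vnorm_eq0 ->|u0] := boolP (vnorm u == 0).
  by rewrite mul0mx vnorm0 mulr0.
have u_gt0 : 0 < vnorm u by rewrite lt_def u0 vnorm_ge0.
have nE : Normc.normc ((vnorm u)^-1)%:C%C = (vnorm u)^-1.
  by rewrite /Normc.normc /= expr0n /= addr0 sqrtr_sqr ger0_norm // invr_ge0 ltW.
rewrite -ler_pdivrMr // mulrC -nE -vnormZ scalemxAl.
rewrite /opnorm unlock; apply: ub_le_sup; first exact: opnorm_has_ubound.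
by exists (((vnorm u)^-1)%:C%C *: u); rewrite //= vnormZ nE mulVf.
Qed.

Lemma opnorm_le M (c : R) :
  0 <= c -> (forall u, vnorm (u *m M) <= c * vnorm u) -> opnorm M <= c.
Proof.
move=> c0 Mc; rewrite /opnorm unlock; apply: ge_sup; first by exists (vnorm (0 *m M)), 0; rewrite //= vnorm0.
move=> _ [u /= u1 <-]; apply: le_trans (Mc u) _.
by rewrite -[leRHS]mulr1 ler_wpM2l.
Qed.

Lemma opnorm_eq0 M : opnorm M = 0 -> M = 0.
Proof.
move=> M0; apply/row_matrixP => i; rewrite row0 rowE; apply: vnorm_eq0.
apply/eqP; rewrite eq_le vnorm_ge0 andbT.
by apply: le_trans (le_opnorm _ _) _; rewrite M0 mul0r.
Qed.

Lemma opnormD M N : opnorm (M + N) <= opnorm M + opnorm N.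
Proof.
apply: opnorm_le => [|u]; first by rewrite addr_ge0 ?opnorm_ge0.
rewrite mulmxDr mulrDl; apply: le_trans (vnormD _ _) _.
by rewrite lerD ?le_opnorm.
Qed.

Lemma normc_ge0 (c : C) : 0 <= Normc.normc c.
Proof. by case: c => a b; rewrite sqrtr_ge0. Qed.

Lemma opnormZ c M : opnorm (c *: M) = Normc.normc c * opnorm M.
Proof.
have le d N : opnorm (d *: N) <= Normc.normc d * opnorm N.
  apply: opnorm_le => [|u]; first by rewrite mulr_ge0 ?opnorm_ge0 ?normc_ge0.
  by rewrite -scalemxAr vnormZ -mulrA ler_wpM2l ?le_opnorm ?normc_ge0.
have [->|c0] := eqVneq c 0.
  rewrite scale0r Normc.normc0 mul0r; apply/eqP; rewrite eq_le opnorm_ge0 andbT.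
  by apply: opnorm_le => // u; rewrite mulmx0 vnorm0 mul0r.
apply/eqP; rewrite eq_le le /=.
have nc : 0 < Normc.normc c.
  rewrite lt_def normc_ge0 andbT; apply: contra c0 => /eqP c0.
  by rewrite (Normc.eq0_normc c0).
(* The reverse inequality is [le] for the inverse scalar, applied to [c *: M]. *)
have := le c^-1 (c *: M).
by rewrite scalerA (mulVf c0) scale1r Normc.normcV mulrC (ler_pdivlMr _ _ nc) mulrC.
Qed.

Lemma opnormM M N : opnorm (M *m N) <= opnorm M * opnorm N.
Proof.
apply: opnorm_le => [|u]; first by rewrite mulr_ge0 ?opnorm_ge0.
rewrite mulmxA; move: (le_opnorm N (u *m M)) (le_opnorm M u) (opnorm_ge0 N).
move: (opnorm M) (opnorm N) (vnorm u) (vnorm (u *m M)) => a b x y le1 le2 b0.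
apply: le_trans le1 _; apply: le_trans (ler_wpM2l b0 le2) _.
by rewrite mulrCA mulrA lexx.
Qed.

Lemma vnorm_sqr_le M u :
  vnorm (u *m M) ^+ 2 <= vnorm (u *m (M *m M^t*)) * vnorm u.
Proof.
have E1 : (vnorm (u *m M) ^+ 2)%:C%C = dotmx (u *m M) (u *m M).
  apply: etrans (rmorphXn _ _ _) _.
  exact: etrans (congr1 (fun x => x ^+ 2) (vnormE _)) (sqrtCK _).
apply: (real_complex_le E1 _ (dotmx_sqrt_mul M u)).
exact: etrans (rmorphM _ _ _) (congr2 *%R (vnormE _) (vnormE _)).
Qed.

Lemma opnorm_sqr_le M : opnorm M ^+ 2 <= opnorm (M *m M^t*).
Proof.
have sq_le (x y : R) : 0 <= x -> 0 <= y -> x <= Num.sqrt y -> x ^+ 2 <= y.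
  by move=> x0 y0 xy; rewrite -[leRHS](sqr_sqrtr y0) ler_sqr ?nnegrE ?sqrtr_ge0.
apply: sq_le; rewrite ?opnorm_ge0 //; apply: opnorm_le => [|u].
  exact: sqrtr_ge0.
move: (vnorm_sqr_le M u) (le_opnorm (M *m M^t*) u) (vnorm_ge0 u).
move: (vnorm_ge0 (u *m M)) (opnorm_ge0 (M *m M^t*)).
move: (opnorm (M *m M^t*)) (vnorm (u *m M)) (vnorm (u *m _)) (vnorm u) => o x y z.
move=> x0 o0 le1 le2 z0; rewrite -ler_sqr ?nnegrE ?mulr_ge0 ?sqrtr_ge0 //.
rewrite exprMn (sqr_sqrtr o0) [z ^+ 2]expr2 mulrA.
exact: le_trans le1 (ler_wpM2r z0 le2).
Qed.

(** In |M|^2 <= |M M^*| <= |M| |M^*| one factor |M| cancels. Applied to the adjoint as well, this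
    turns [opnorm_sqr_le] into the C*-identity. *)
Lemma opnorm_le_adj M : opnorm M <= opnorm (M^t*).
Proof.
move: (le_trans (opnorm_sqr_le M) (opnormM M (M^t*))) (opnorm_ge0 M).
move: (opnorm_ge0 (M^t*)); move: (opnorm M) (opnorm (M^t*)) => x y y0 + x0.
rewrite expr2; have [->//|x1] := eqVneq x 0.
by rewrite ler_pM2l // lt_def x1 x0.
Qed.

Lemma opnorm_mul_adj M : opnorm (M *m M^t*) = opnorm M ^+ 2.
Proof.
move: (opnorm_le_adj (M^t*)) (opnormM M (M^t*)) (opnorm_ge0 M) (opnorm_sqr_le M).
rewrite (trmxCK M); move: (opnorm (M *m _)) (opnorm (M^t*)) (opnorm M) => x y z.
move=> yz le1 z0 le2; apply/eqP; rewrite eq_le le2 andbT.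
by rewrite expr2; apply: le_trans le1 (ler_wpM2l z0 yz).
Qed.

End OperatorNorm.

(** * Tensor calculus *)

Section TensorIndices.

Variable C : numClosedFieldType.

Lemma sum_mxtens (a b : nat) (f : 'I_(a * b) -> C) :
  \sum_p f p = \sum_i \sum_j f (mxtens_index (i, j)).
Proof.
rewrite pair_big /= (reindex (@mxtens_index a b)); last first.
  by exists (@mxtens_unindex a b) => i _; rewrite (mxtens_indexK, mxtens_unindexK).
by apply: eq_bigr => -[i j].
Qed.

Lemma eq_mxtens (a b : nat) (i i' : 'I_a) (j j' : 'I_b) :
  (mxtens_index (i, j) == mxtens_index (i', j')) = (i == i') && (j == j').
Proof. by rewrite (inj_eq (can_inj (@mxtens_indexK _ _))) xpair_eqE. Qed.

Lemma sum_deltal (I : finType) (i : I) (f : I -> C) :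
  \sum_j (j == i)%:R * f j = f i.
Proof.
rewrite (bigD1 i) //= eqxx mul1r big1 ?addr0 // => j /negPf->.
by rewrite mul0r.
Qed.

Lemma sum_deltar (I : finType) (i : I) (f : I -> C) :
  \sum_j f j * (j == i)%:R = f i.
Proof. by rewrite -[RHS](sum_deltal i); apply: eq_bigr => j _; rewrite mulrC. Qed.

Lemma adjmxM (a b c : nat) (A : 'M[C]_(a, b)) (B : 'M[C]_(b, c)) :
  (A *m B)^t* = B^t* *m A^t*.
Proof. by rewrite trmx_mul map_mxM. Qed.

Lemma adjmx_tens (a b c d : nat) (A : 'M[C]_(a, b)) (B : 'M[C]_(c, d)) :
  (A *t B)^t* = A^t* *t B^t*.
Proof. by rewrite trmx_tens map_mxT. Qed.

Lemma adjmx1 (a : nat) : (1%:M : 'M[C]_a)^t* = 1%:M.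
Proof. by rewrite trmx1 map_mx1. Qed.

Lemma tensmx11 (a b : nat) : (1%:M : 'M[C]_a) *t (1%:M : 'M[C]_b) = 1%:M.
Proof.
apply/matrixP => p q; case: (mxtens_indexP p) => i j; case: (mxtens_indexP q) => k l.
by rewrite tensmxE !mxE eq_mxtens -natrM mulnb.
Qed.

Lemma tensmxDl (a b c d : nat) (I : Type) (r : seq I) (P : pred I)
    (A : I -> 'M[C]_(a, b)) (B : 'M[C]_(c, d)) :
  (\sum_(i <- r | P i) A i) *t B = \sum_(i <- r | P i) (A i *t B).
Proof.
apply: (big_morph (fun A => A *t B)); last exact: tens0mx.
by move=> x y; apply/matrixP => i j; rewrite !mxE mulrDl.
Qed.

Lemma tensmxDr (a b c d : nat) (I : Type) (r : seq I) (P : pred I)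
    (A : I -> 'M[C]_(a, b)) (B : 'M[C]_(c, d)) :
  B *t (\sum_(i <- r | P i) A i) = \sum_(i <- r | P i) (B *t A i).
Proof.
apply: (big_morph (fun A => B *t A)); last exact: tensmx0.
by move=> x y; apply/matrixP => i j; rewrite !mxE mulrDr.
Qed.

Lemma tensmxZl (a b c d : nat) (k : C) (A : 'M[C]_(a, b)) (B : 'M[C]_(c, d)) :
  (k *: A) *t B = k *: (A *t B).
Proof. by apply/matrixP => i j; rewrite !mxE mulrA. Qed.

Lemma tensmxZr (a b c d : nat) (k : C) (A : 'M[C]_(a, b)) (B : 'M[C]_(c, d)) :
  A *t (k *: B) = k *: (A *t B).
Proof. by apply/matrixP => i j; rewrite !mxE mulrCA. Qed.

(* The coherence maps of Defs, over an arbitrary closed field instead of R[i]. *)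
Definition assocmx (a b c : nat) : 'M[C]_(a * (b * c), a * b * c) :=
  \matrix_(p, q)
    (let: (ij, k) := mxtens_unindex q in
     let: (i, j) := mxtens_unindex ij in
     p == mxtens_index (i, mxtens_index (j, k)))%:R.

Definition lunitmx (a : nat) : 'M[C]_(a, 1 * a) :=
  \matrix_(i, p) (i == (mxtens_unindex p).2)%:R.

Definition runitmx (a : nat) : 'M[C]_(a, a * 1) :=
  \matrix_(i, p) (i == (mxtens_unindex p).1)%:R.

Section Associator.
Variables a b c : nat.

Lemma assocmxE p i j k :
  assocmx a b c p (mxtens_index (mxtens_index (i, j), k))
    = (p == mxtens_index (i, mxtens_index (j, k)))%:R.
Proof. by rewrite mxE mxtens_indexK mxtens_indexK. Qed.

Lemma mul_assocmx d (M : 'M[C]_(a * b * c, d)) i j k q :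
  (assocmx a b c *m M) (mxtens_index (i, mxtens_index (j, k))) q
    = M (mxtens_index (mxtens_index (i, j), k)) q.
Proof.
rewrite mxE -[RHS](sum_deltal _ (fun p => M p q)); apply: eq_bigr => p _.
case: (mxtens_indexP p) => ij k'; case: (mxtens_indexP ij) => i' j'.
rewrite assocmxE !eq_mxtens ![i' == i]eq_sym ![j' == j]eq_sym ![k' == k]eq_sym.
by rewrite andbA.
Qed.

Lemma assocmx_mul d (M : 'M[C]_(d, a * (b * c))) i j k q :
  (M *m assocmx a b c) q (mxtens_index (mxtens_index (i, j), k))
    = M q (mxtens_index (i, mxtens_index (j, k))).
Proof.
rewrite mxE -[RHS](sum_deltar _ (fun p => M q p)); apply: eq_bigr => p _.
by rewrite assocmxE.
Qed.

Lemma mul_assocmxV d (M : 'M[C]_(a * (b * c), d)) i j k q :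
  ((assocmx a b c)^T *m M) (mxtens_index (mxtens_index (i, j), k)) q
    = M (mxtens_index (i, mxtens_index (j, k))) q.
Proof.
by rewrite -[_ *m M]trmxK mxE trmx_mul trmxK assocmx_mul mxE.
Qed.

Lemma assocmxV_mul d (M : 'M[C]_(d, a * b * c)) i j k q :
  (M *m (assocmx a b c)^T) q (mxtens_index (i, mxtens_index (j, k)))
    = M q (mxtens_index (mxtens_index (i, j), k)).
Proof. by rewrite -[M *m _]trmxK mxE trmx_mul trmxK mul_assocmx mxE. Qed.

Lemma assocmx_adj : (assocmx a b c)^t* = (assocmx a b c)^T.
Proof. by apply/matrixP => p q; rewrite !mxE; case: (mxtens_unindex p) => -[*]; rewrite /= conjC_nat. Qed.

Lemma assocmxK : assocmx a b c *m (assocmx a b c)^T = 1%:M.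
Proof.
apply/matrixP => p q; case: (mxtens_indexP p) => i jk; case: (mxtens_indexP jk) => j k.
case: (mxtens_indexP q) => i' jk'; case: (mxtens_indexP jk') => j' k'.
by rewrite mul_assocmx mxE assocmxE mxE eq_sym.
Qed.

Lemma assocmxVK : (assocmx a b c)^T *m assocmx a b c = 1%:M.
Proof.
apply/matrixP => p q; case: (mxtens_indexP p) => ij k; case: (mxtens_indexP ij) => i j.
case: (mxtens_indexP q) => ij' k'; case: (mxtens_indexP ij') => i' j'.
by rewrite mul_assocmxV assocmxE mxE !eq_mxtens andbA.
Qed.

Lemma assocmx_nat (A : 'M[C]_a) (B : 'M[C]_b) (D : 'M[C]_c) :
  assocmx a b c *m ((A *t B) *t D) = (A *t (B *t D)) *m assocmx a b c.
Proof.
apply/matrixP => p q; case: (mxtens_indexP p) => i jk; case: (mxtens_indexP jk) => j k.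
case: (mxtens_indexP q) => ij' k'; case: (mxtens_indexP ij') => i' j'.
by rewrite mul_assocmx assocmx_mul !tensmxE mulrA.
Qed.

End Associator.

End TensorIndices.

(** * Functional calculus of a resolution of the identity *)

Section ProjectionFamilies.

Variable C : numClosedFieldType.

Definition resolution (I : finType) (N : nat) (P : I -> 'M[C]_N) : Prop :=
  [/\ forall i j, P i *m P j = (i == j)%:R *: P i, \sum_i P i = 1%:M
    & forall i, (P i)^t* = P i].

(** The operator with eigenvalue [f i] on the range of [P i]. *)
Definition fcalc (I : finType) (N : nat) (P : I -> 'M[C]_N) (f : I -> C) :=
  \sum_i f i *: P i.

Variables (I : finType) (N : nat) (P : I -> 'M[C]_N).
Hypothesis resP : resolution P.

Lemma fcalc_mulP f i : fcalc P f *m P i = f i *: P i.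
Proof.
have [orth _ _] := resP.
rewrite mulmx_suml (bigD1 i) //= big1 => [|j /negPf ji].
  by rewrite addr0 -scalemxAl orth eqxx scale1r.
by rewrite -scalemxAl orth ji scale0r scaler0.
Qed.

Lemma fcalcM f g : fcalc P f *m fcalc P g = fcalc P (fun i => f i * g i).
Proof.
rewrite mulmx_sumr; apply: eq_bigr => i _.
by rewrite -scalemxAr fcalc_mulP scalerA mulrC.
Qed.

Lemma eq_fcalc f g : f =1 g -> fcalc P f = fcalc P g.
Proof. by move=> fg; apply: eq_bigr => i _; rewrite fg. Qed.

Lemma fcalc1 f : (forall i, f i = 1) -> fcalc P f = 1%:M.
Proof.
have [_ <- _] := resP.
by move=> f1; apply: eq_bigr => i _; rewrite f1 scale1r.
Qed.

Lemma fcalc_adj f : (fcalc P f)^t* = fcalc P (fun i => (f i)^*).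
Proof.
have [_ _ herm] := resP.
rewrite /fcalc (big_morph (fun A : 'M[C]_N => A^t*) (id1 := 0) (op1 := +%R)).
- by apply: eq_bigr => i _; rewrite linearZ /= map_mxZ herm.
- by move=> x y; rewrite linearD /= map_mxD.
- by rewrite trmx0 map_mx0.
Qed.

Lemma fcalc_comm f M : (forall i, M *m P i = P i *m M) ->
  M *m fcalc P f = fcalc P f *m M.
Proof.
move=> MP; rewrite mulmx_sumr mulmx_suml; apply: eq_bigr => i _.
by rewrite -scalemxAr -scalemxAl MP.
Qed.

Lemma sum_mulP d (M : 'M[C]_(d, N)) : \sum_i M *m P i = M.
Proof. by have [_ s1 _] := resP; rewrite -mulmx_sumr s1 mulmx1. Qed.

End ProjectionFamilies.

(** The hypothesis says that [M] maps the range of [P i] into that of [Q (h i)], so [f] on the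
    target is read on the source through [h]. Every argument about degrees goes through this
    lemma. *)
Lemma fcalc_intertwine (C : numClosedFieldType) (I J : finType) (N N' : nat)
    (P : I -> 'M[C]_N) (Q : J -> 'M[C]_N') (M : 'M[C]_(N', N)) (h : I -> J) f :
    resolution P -> resolution Q ->
    (forall i, M *m P i = Q (h i) *m M *m P i) ->
  fcalc Q f *m M = M *m fcalc P (f \o h).
Proof.
move=> resP resQ MP; rewrite -[LHS](sum_mulP resP) mulmx_sumr.
apply: eq_bigr => i _.
rewrite -mulmxA MP mulmxA [fcalc Q f *m _]mulmxA fcalc_mulP //.
by rewrite -!scalemxAl -MP -scalemxAr.
Qed.

Section TensorResolutions.

Variable C : numClosedFieldType.

Lemma resolution_tens (I J : finType) (N N' : nat)
    (P : I -> 'M[C]_N) (Q : J -> 'M[C]_N') :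
  resolution P -> resolution Q -> resolution (fun x : I * J => P x.1 *t Q x.2).
Proof.
move=> [oP sP hP] [oQ sQ hQ]; split=> [[i j] [k l]||[i j]] /=.
- by rewrite tensmx_mul oP oQ tensmxZl tensmxZr scalerA -natrM mulnb.
- rewrite -(pair_bigA _ (fun i j => P i *t Q j)) /=.
  under eq_bigr => i _ do rewrite -tensmxDr sQ.
  by rewrite -tensmxDl sP tensmx11.
- by rewrite adjmx_tens hP hQ.
Qed.

End TensorResolutions.

(** * The Pauli cocycle *)

Section Pauli.

Variable C : numClosedFieldType.
Local Notation K := (bool * bool)%type.
Implicit Types x y z : K.

Definition kadd x y : K := (x.1 (+) y.1, x.2 (+) y.2).

(* With pauli (a, b) = i^(ab) X^a Z^b this is the exponent e for which
   pauli x *m pauli y = i^e *: pauli (kadd x y). *)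
Definition pauli_exp x y : nat :=
  x.1 * x.2 + y.1 * y.2 + 2 * (x.2 * y.1) + 3 * ((kadd x y).1 * (kadd x y).2).

Definition pauli_cocycle x y : C := 'i ^+ pauli_exp x y.

Definition pauli x : 'M[C]_2 :=
  \matrix_(i, j) ((odd i (+) odd j == x.1)%:R * 'i ^+ (x.1 * x.2 + 2 * (x.2 * odd j))).

Lemma imaginary_expr4 : 'i ^+ 4 = 1 :> C.
Proof. by rewrite (exprM 'i 2 2) sqrCi sqrrN expr1n. Qed.

Lemma imaginary_expr_mod4 a b : (a = b %[mod 4])%N -> 'i ^+ a = 'i ^+ b :> C.
Proof.
by move=> ab; rewrite -(expr_mod a imaginary_expr4) ab expr_mod ?imaginary_expr4.
Qed.

(** Inverting a power of i multiplies the exponent by 3, since -1 = 3 modulo 4; exponents can thus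
    stay natural numbers. *)
Lemma conj_imaginary_expr a : ('i ^+ a)^* = 'i ^+ (3 * a) :> C.
Proof. by rewrite rmorphXn /= conjCi exprM exprSr sqrCi mulN1r. Qed.

(** The 2-cocycle identity, which reflects associativity of the product of Pauli matrices. It makes
    the twisted product associative. *)
Lemma pauli_cocycleP x y z :
  pauli_cocycle x y * pauli_cocycle (kadd x y) z
    = pauli_cocycle y z * pauli_cocycle x (kadd y z).
Proof.
rewrite /pauli_cocycle -!exprD; apply: imaginary_expr_mod4.
by case: x y z => [[] []] [[] []] [[] []].
Qed.

Lemma pauli_cocycle_conj x y : (pauli_cocycle x y)^* = pauli_cocycle y x.
Proof.
rewrite /pauli_cocycle conj_imaginary_expr; apply: imaginary_expr_mod4.
by case: x y => [[] []] [[] []].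
Qed.

Lemma pauli_cocycle_unit x y : pauli_cocycle x y * pauli_cocycle y x = 1.
Proof.
rewrite /pauli_cocycle -exprD -[RHS](expr0 'i); apply: imaginary_expr_mod4.
by case: x y => [[] []] [[] []].
Qed.

Lemma pauli_cocyclexx x : pauli_cocycle x x = 1.
Proof.
rewrite /pauli_cocycle -[RHS](expr0 'i); apply: imaginary_expr_mod4.
by case: x => [[] []].
Qed.

Lemma pauli_cocycle0l x : pauli_cocycle (false, false) x = 1.
Proof.
rewrite /pauli_cocycle -[RHS](expr0 'i); apply: imaginary_expr_mod4.
by case: x => [[] []].
Qed.

Lemma pauli_cocycle0r x : pauli_cocycle x (false, false) = 1.
Proof. by rewrite -pauli_cocycle_conj pauli_cocycle0l conjC1. Qed.

Lemma ord2P (P : 'I_2 -> Prop) : P ord0 -> P ord_max -> forall i, P i.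
Proof.
move=> P0 P1 [[|[|//]] i2].
- by rewrite (_ : Ordinal i2 = ord0) //; apply: val_inj.
- by rewrite (_ : Ordinal i2 = ord_max) //; apply: val_inj.
Qed.

Lemma pauliM x y : pauli x *m pauli y = pauli_cocycle x y *: pauli (kadd x y).
Proof.
have mod4 a b (e f : bool) (k l : nat) : e = f -> (k = l %[mod 4])%N ->
    a = (e%:R * 'i ^+ k) :> C -> b = (f%:R * 'i ^+ l) :> C -> a = b.
  by move=> -> /imaginary_expr_mod4-> -> ->.
apply/matrixP => i j; rewrite !mxE big_ord_recr big_ord1 /= !mxE /pauli_cocycle.
by move: i j; apply: ord2P; apply: ord2P; case: x y => [[] []] [[] []];
  rewrite /= ?mul0r ?mul1r ?mulr0 ?addr0 ?add0r // -?exprD;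
  apply: imaginary_expr_mod4.
Qed.

Lemma pauli_adj x : (pauli x)^t* = pauli x.
Proof.
apply/matrixP => i j; rewrite !mxE rmorphM /= conj_imaginary_expr conjC_nat.
by move: i j; apply: ord2P; apply: ord2P; case: x => [[] []];
  rewrite /= ?mul0r ?mul1r //; apply: imaginary_expr_mod4.
Qed.

Lemma pauli0 : pauli (false, false) = 1%:M.
Proof.
by apply/matrixP => i j; rewrite !mxE; move: i j; apply: ord2P; apply: ord2P;
  rewrite /= ?mul0r ?mul1r.
Qed.

End Pauli.

(** * Twisting a graded multiplication by the cocycle *)

Section CocycleTwist.

Variables (C : numClosedFieldType) (n : nat).
Local Notation K := (bool * bool)%type.
Variables (p : K -> 'M[C]_n) (m : 'M[C]_(n, n * n)).
Hypothesis p_res : resolution p.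
Hypothesis m_graded : forall a b,
  m *m (p a *t p b) = p (kadd a b) *m m *m (p a *t p b).

Local Notation p2 := (fun x : K * K => p x.1 *t p x.2).
Local Notation p3 := (fun x : K * K * K => (p x.1.1 *t p x.1.2) *t p x.2).
Local Notation p3' := (fun x : K * K * K => p x.1.1 *t (p x.1.2 *t p x.2)).

Let p2_res : resolution p2. Proof. exact: resolution_tens. Qed.
Let p3_res : resolution p3. Proof. exact: (resolution_tens p2_res p_res). Qed.
(** Both bracketings are indexed by left-nested triples, so that the associator intertwines the two
    calculi with the identity on indices. *)
Let p3'_res : resolution p3'.
Proof.
have [o s h] := resolution_tens p_res p2_res.
split=> [[[a b] c] [[a' b'] c']||[[a b] c]] /=.
- have := o (a, (b, c)) (a', (b', c')) => /= ->.
  by rewrite !xpair_eqE andbA.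
- rewrite -s (reindex (fun x : K * (K * K) => (x.1, x.2.1, x.2.2))) //=.
  by exists (fun x => (x.1.1, (x.1.2, x.2))); [move=> [? []]|move=> [[]]].
- exact: (h (a, (b, c))).
Qed.

Definition twist : 'M[C]_(n * n) := fcalc p2 (fun x => pauli_cocycle C x.1 x.2).

Lemma twist_adj : twist^t* = fcalc p2 (fun x => pauli_cocycle C x.2 x.1).
Proof.
rewrite /twist fcalc_adj //; apply: eq_fcalc => x.
exact: pauli_cocycle_conj.
Qed.

Lemma twistK : twist *m twist^t* = 1%:M.
Proof.
by rewrite twist_adj fcalcM // fcalc1 // => x; apply: pauli_cocycle_unit.
Qed.

Lemma twist_comm (A B : 'M[C]_n) :
    (forall a, A *m p a = p a *m A) -> (forall a, B *m p a = p a *m B) ->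
  (A *t B) *m twist^t* = twist^t* *m (A *t B).
Proof.
move=> Ap Bp; rewrite twist_adj; apply: fcalc_comm => -[a b] /=.
by rewrite !tensmx_mul Ap Bp.
Qed.

Lemma twist_mid (A B : 'M[C]_n) :
    (forall a, A *m p a = p a *m A) -> (forall a, B *m p a = p a *m B) ->
  (m *m twist) *m (A *t B) *m (m *m twist)^t* = m *m (A *t B) *m m^t*.
Proof.
move=> Ap Bp; rewrite adjmxM -!mulmxA [(A *t B) *m _]mulmxA twist_comm //.
by rewrite -!mulmxA [twist *m _]mulmxA twistK mul1mx.
Qed.

(** The free leg is resolved as the sum of all [p x], which turns a function of two degrees into one
    of three. *)
Lemma tens1_fcalc f : (1%:M : 'M_n) *t fcalc p2 f = fcalc p3' (fun x => f (x.1.2, x.2)).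
Proof.
have [_ s1 _] := p_res.
rewrite /fcalc tensmxDr -s1.
under eq_bigr => x _ do rewrite tensmxDl.
rewrite exchange_big /= pair_big /=.
rewrite [RHS](reindex (fun x : K * (K * K) => (x.1, x.2.1, x.2.2))) /=; last first.
  by exists (fun x => (x.1.1, (x.1.2, x.2))); [move=> [? []]|move=> [[]]].
by apply: eq_bigr => -[x [y z]] _; rewrite tensmxZr.
Qed.

Lemma fcalc_tens1 f : fcalc p2 f *t (1%:M : 'M_n) = fcalc p3 (fun x => f x.1).
Proof.
have [_ s1 _] := p_res.
rewrite /fcalc tensmxDl -s1.
under eq_bigr => x _ do rewrite tensmxDr.
rewrite pair_big /=; apply: eq_bigr => x _.
by rewrite tensmxZl.
Qed.

(** Degrees add under [m], so a function of two degrees pulled back through the multiplication of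
    the first two legs sees the sum of their degrees. *)
Lemma fcalc_mull f : fcalc p2 f *m (m *t (1%:M : 'M_n))
  = (m *t (1%:M : 'M_n)) *m fcalc p3 (f \o (fun x => (kadd x.1.1 x.1.2, x.2))).
Proof.
apply: fcalc_intertwine => // -[[a b] c] /=.
rewrite -mulmxA (tensmx_mul m) tensmx_mul mul1mx mulmxA -m_graded.
by case: p_res => -> _ _; rewrite eqxx scale1r.
Qed.

Lemma fcalc_mulr f : fcalc p2 f *m ((1%:M : 'M_n) *t m)
  = ((1%:M : 'M_n) *t m) *m fcalc p3' (f \o (fun x => (x.1.1, kadd x.1.2 x.2))).
Proof.
apply: fcalc_intertwine => // -[[a b] c] /=.
rewrite -mulmxA (tensmx_mul _ m) tensmx_mul mul1mx mulmxA -m_graded.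
by case: p_res => -> _ _; rewrite eqxx scale1r.
Qed.

Lemma fcalc_assoc f : fcalc p3' f *m assocmx C n n n = assocmx C n n n *m fcalc p3 f.
Proof.
apply: (@fcalc_intertwine _ _ _ _ _ _ _ _ id) => // -[[a b] c] /=.
by rewrite -assocmx_nat -mulmxA; case: (p3_res) => /(_ (a, b, c) (a, b, c))-> _ _;
  rewrite eqxx scale1r.
Qed.

(** Both twists on either side are moved to the right, where they act on three legs by a scalar
    depending on the degrees. Equality of these scalars is [pauli_cocycleP]. *)
Lemma twist_mulA : m *m (m *t 1%:M) = m *m (1%:M *t m) *m assocmx C n n n ->
  (m *m twist) *m ((m *m twist) *t 1%:M)
    = (m *m twist) *m (1%:M *t (m *m twist)) *m assocmx C n n n.
Proof.
move=> mA.
have -> : (m *m twist) *t (1%:M : 'M_n) = (m *t (1%:M : 'M_n)) *m (twist *t (1%:M : 'M_n)).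
  by rewrite (tensmx_mul m) mul1mx.
have -> : (1%:M : 'M_n) *t (m *m twist) = ((1%:M : 'M_n) *t m) *m ((1%:M : 'M_n) *t twist).
  by rewrite (tensmx_mul _ m) mul1mx.
rewrite !mulmxA -[m *m twist *m _]mulmxA fcalc_mull fcalc_tens1.
rewrite -[m *m twist *m _]mulmxA fcalc_mulr tens1_fcalc !mulmxA.
rewrite -[X in X = _]mulmxA fcalcM // mA -!mulmxA; congr (_ *m (_ *m _)).
rewrite fcalc_assoc mulmxA fcalc_assoc -mulmxA fcalcM //; congr (_ *m _).
apply: eq_fcalc => -[[a b] c] /=.
by rewrite mulrC pauli_cocycleP mulrC.
Qed.

(** This symmetry says that coordinatewise conjugation is antimultiplicative. It survives the twist
    because the projections are real and conjugating the cocycle exchanges its arguments, just as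
    the two legs are exchanged. *)
Lemma twist_conj : (forall k i j, (m k (mxtens_index (i, j)))^* = m k (mxtens_index (j, i))) ->
    (forall x i j, (p x i j)^* = p x i j) ->
  forall k i j, ((m *m twist) k (mxtens_index (i, j)))^* = (m *m twist) k (mxtens_index (j, i)).
Proof.
move=> mC pC k i j; rewrite !mulmx_sumr !summxE rmorph_sum /=.
rewrite (reindex (fun x : K * K => (x.2, x.1))) /=; last first.
  by exists (fun x => (x.2, x.1)) => -[].
apply: eq_bigr => -[x y] _ /=.
rewrite -!scalemxAr [in LHS]mxE [in RHS]mxE rmorphM /= pauli_cocycle_conj; congr (_ * _).
rewrite !mxE rmorph_sum !sum_mxtens exchange_big /=.
apply: eq_bigr => k' _; apply: eq_bigr => l _.
by rewrite !tensmxE !rmorphM /= mC !pC [p y _ _ * _]mulrC.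
Qed.

(** The unit has degree 0, where the cocycle is 1. *)
Lemma twist_unit_l (u : 'M[C]_(n, 1)) :
    (forall x, p x *m u = (x == (false, false))%:R *: u) ->
  twist *m (u *t (1%:M : 'M_n)) = u *t (1%:M : 'M_n).
Proof.
move=> pu; have [_ s1 _] := p_res.
rewrite mulmx_suml -(pair_bigA _ (fun x y => (pauli_cocycle C x y *: (p x *t p y))
   *m (u *t (1%:M : 'M_n)))) /=.
rewrite (bigD1 (false, false)) //= [X in _ + X]big1 => [|x /negPf x0]; last first.
  rewrite big1 // => y _.
  by rewrite -scalemxAl tensmx_mul pu x0 scale0r tens0mx scaler0.
rewrite addr0 -[in RHS]s1 tensmxDr; apply: eq_bigr => y _.
by rewrite -scalemxAl tensmx_mul pu eqxx scale1r mulmx1 pauli_cocycle0l scale1r.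
Qed.

Lemma twist_unit_r (u : 'M[C]_(n, 1)) :
    (forall x, p x *m u = (x == (false, false))%:R *: u) ->
  twist *m ((1%:M : 'M_n) *t u) = (1%:M : 'M_n) *t u.
Proof.
move=> pu; have [_ s1 _] := p_res.
rewrite mulmx_suml -(pair_bigA _ (fun x y => (pauli_cocycle C x y *: (p x *t p y))
   *m ((1%:M : 'M_n) *t u))) /= exchange_big /=.
rewrite (bigD1 (false, false)) //= [X in _ + X]big1 => [|x /negPf x0]; last first.
  rewrite big1 // => y _.
  by rewrite -scalemxAl tensmx_mul pu x0 scale0r tensmx0 scaler0.
rewrite addr0 -[in RHS]s1 tensmxDl; apply: eq_bigr => y _.
by rewrite -scalemxAl tensmx_mul pu eqxx scale1r mulmx1 pauli_cocycle0r scale1r.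
Qed.

Definition trianglemx (M : 'M[C]_(n, n * n)) (A B D : 'M[C]_n) : 'M[C]_(n * n, n) :=
  (1%:M *t M) *m assocmx C n n n *m ((1%:M *t D) *t 1%:M) *m (M^t* *t 1%:M)
    *m (A *t B) *m M^t*.

(** Each of the three multiplications in the diagram brings a twist. On three legs of degrees a, b,
    c they become w(b, c), w(b, a) and w(c, a + b), and their product w(b + c, a) is a single
    adjoint twist of the two outputs, whose degrees are a and b + c. *)
Lemma triangle_twist (A B D : 'M[C]_n) :
    (forall a, A *m p a = p a *m A) -> (forall a, B *m p a = p a *m B) ->
    (forall a, D *m p a = p a *m D) ->
  trianglemx (m *m twist) A B D = twist^t* *m trianglemx m A B D.
Proof.
move=> Ap Bp Dp.
have W2 : twist^t* *t 1%:M = fcalc p3 (fun x => pauli_cocycle C x.1.2 x.1.1).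
  by rewrite twist_adj fcalc_tens1.
have mla f : (m^t* *t 1%:M) *m fcalc p2 f
    = fcalc p3 (f \o (fun x => (kadd x.1.1 x.1.2, x.2))) *m (m^t* *t 1%:M).
  have := congr1 (fun X => X^t*) (fcalc_mull (fun x => (f x)^*)).
  rewrite !adjmxM adjmx_tens adjmx1 !fcalc_adj //.
  under eq_fcalc => x do rewrite conjCK.
  by move=> ->; congr (_ *m _); apply: eq_fcalc => x /=; rewrite conjCK.
have mD f : ((1%:M *t D) *t 1%:M) *m fcalc p3 f = fcalc p3 f *m ((1%:M *t D) *t 1%:M).
  apply: fcalc_comm => -[[a b] c] /=.
  by rewrite !tensmx_mul Dp !mulmx1 !mul1mx.
rewrite /trianglemx adjmxM.
have -> : (1%:M : 'M_n) *t (m *m twist) = ((1%:M : 'M_n) *t m) *m ((1%:M : 'M_n) *t twist).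
  by rewrite (tensmx_mul _ m) mul1mx.
have -> : (twist^t* *m m^t*) *t (1%:M : 'M_n) = (twist^t* *t 1%:M) *m (m^t* *t 1%:M).
  by rewrite (tensmx_mul (twist^t*)) mul1mx.
(* The adjoint twist on the outputs, pulled back through the last multiplication: the form in which
   the collected scalars must appear. *)
have mr' : (1%:M *t m) *m fcalc p3' (fun x => pauli_cocycle C (kadd x.1.2 x.2) x.1.1)
    = twist^t* *m (1%:M *t m).
  by rewrite twist_adj fcalc_mulr.
have cocycle : fcalc p3 (fun x => pauli_cocycle C x.1.2 x.2)
    *m fcalc p3 (fun x => pauli_cocycle C x.1.2 x.1.1)
    *m fcalc p3 (fun x => pauli_cocycle C x.2 (kadd x.1.1 x.1.2))
    = fcalc p3 (fun x => pauli_cocycle C (kadd x.1.2 x.2) x.1.1).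
  rewrite !fcalcM //; apply: eq_fcalc => -[[a b] c] /=.
  rewrite /pauli_cocycle -!exprD; apply: imaginary_expr_mod4.
  by case: a b c => [[] []] [[] []] [[] []].
(* The three scalars are collected on one side of the edge [D], which preserves all degrees. *)
have key : fcalc p3' (fun x => pauli_cocycle C x.1.2 x.2) *m assocmx C n n n
    *m ((1%:M *t D) *t 1%:M) *m fcalc p3 (fun x => pauli_cocycle C x.1.2 x.1.1)
    *m fcalc p3 (fun x => pauli_cocycle C x.2 (kadd x.1.1 x.1.2))
    = fcalc p3' (fun x => pauli_cocycle C (kadd x.1.2 x.2) x.1.1)
      *m assocmx C n n n *m ((1%:M *t D) *t 1%:M).
  rewrite !fcalc_assoc -cocycle -!mulmxA; do 2 congr (_ *m _).
  by rewrite mulmxA mD -mulmxA mD.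
rewrite tens1_fcalc W2 -!mulmxA [(A *t B) *m _]mulmxA twist_comm // -!mulmxA.
rewrite {1}twist_adj [(m^t* *t 1%:M) *m (fcalc _ _ *m _)]mulmxA mla.
rewrite !mulmxA -mr' -!mulmxA; congr (_ *m _); by rewrite !mulmxA -key.
Qed.
End CocycleTwist.

(** * The quantum isomorphism built from Pauli matrices *)

Section PauliIntertwiner.

Variable C : numClosedFieldType.

(** The flip of the two tensor factors. *)
Definition swapmx (n h : nat) : 'M[C]_(n * h, h * n) :=
  \matrix_(p, q) (((mxtens_unindex p).1 == (mxtens_unindex q).2)
                  && ((mxtens_unindex p).2 == (mxtens_unindex q).1))%:R.

Lemma mul_swapmx (n h d : nat) (M : 'M[C]_(d, n * h)) q b j :
  (M *m swapmx n h) q (mxtens_index (b, j)) = M q (mxtens_index (j, b)).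
Proof.
rewrite mxE -[RHS](sum_deltar _ (fun p => M q p)); apply: eq_bigr => p _.
by case: (mxtens_indexP p) => i a; rewrite mxE !mxtens_indexK /= eq_mxtens.
Qed.

Lemma swapmx_adj n h : (swapmx n h)^t* = swapmx h n.
Proof.
apply/matrixP => p q; rewrite !mxE conjC_nat andbC; congr (nat_of_bool _)%:R.
by congr (_ && _); rewrite eq_sym.
Qed.

Lemma swapmx_mul (n h d : nat) (M : 'M[C]_(h * n, d)) i a q :
  (swapmx n h *m M) (mxtens_index (i, a)) q = M (mxtens_index (a, i)) q.
Proof.
rewrite mxE -[RHS](sum_deltal _ (fun p => M p q)); apply: eq_bigr => p _.
case: (mxtens_indexP p) => b j; rewrite mxE !mxtens_indexK /= eq_mxtens.
by rewrite andbC [a == b]eq_sym [i == j]eq_sym.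
Qed.

Lemma swapmxK n h : swapmx n h *m swapmx h n = 1%:M.
Proof.
apply/matrixP => p q; case: (mxtens_indexP q) => i a; case: (mxtens_indexP p) => j b.
by rewrite swapmx_mul !mxE !mxtens_indexK eq_mxtens andbC.
Qed.

Lemma swapmx_nat (n h : nat) (A : 'M[C]_n) (B : 'M[C]_h) :
  swapmx n h *m (B *t A) = (A *t B) *m swapmx n h.
Proof.
apply/matrixP => p q; case: (mxtens_indexP p) => i a; case: (mxtens_indexP q) => b j.
by rewrite swapmx_mul mul_swapmx !tensmxE mulrC.
Qed.

Lemma mul_tens1mx (d a b c : nat) (A : 'M[C]_(d, a * b)) (B : 'M[C]_(b, c)) p i q :
  (A *m ((1%:M : 'M_a) *t B)) p (mxtens_index (i, q))
    = \sum_w A p (mxtens_index (i, w)) * B w q.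
Proof.
rewrite mxE sum_mxtens -[RHS](sum_deltal i (fun j => \sum_w A p (mxtens_index (j, w)) * B w q)).
apply: eq_bigr => j _; rewrite mulr_sumr; apply: eq_bigr => w _.
by rewrite tensmxE mxE mulrCA.
Qed.

Lemma tensmx1_mul (d a b c : nat) (A : 'M[C]_(b * a, d)) (B : 'M[C]_(c, b)) v i q :
  ((B *t (1%:M : 'M_a)) *m A) (mxtens_index (v, i)) q
    = \sum_w B v w * A (mxtens_index (w, i)) q.
Proof.
rewrite mxE sum_mxtens; apply: eq_bigr => w _.
rewrite -[RHS](sum_deltal i (fun j => B v w * A (mxtens_index (w, j)) q)).
by apply: eq_bigr => j _; rewrite tensmxE mxE eq_sym mulrA [B v w * _]mulrC.
Qed.

Section RawDiagrams.
Variables (n h : nat) (P : 'M[C]_(n * h, h * n)).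

Definition twicemx : 'M[C]_(n * n * h, h * (n * n)) :=
  (assocmx C n n h)^T *m ((1%:M : 'M_n) *t P) *m assocmx C n h n
    *m (P *t (1%:M : 'M_n)) *m (assocmx C h n n)^T.

(** Seen as blocks acting on the auxiliary space, the block of the second leg stands to the left of
    that of the first, because the auxiliary space crosses the first leg first. *)
Lemma twicemxE i j a b k l :
  twicemx (mxtens_index (mxtens_index (i, j), a)) (mxtens_index (b, mxtens_index (k, l)))
    = \sum_c P (mxtens_index (j, a)) (mxtens_index (c, l))
             * P (mxtens_index (i, c)) (mxtens_index (b, k)).
Proof.
rewrite assocmxV_mul mxE sum_mxtens sum_mxtens.
transitivity (\sum_i' (i' == i)%:R * \sum_c P (mxtens_index (j, a)) (mxtens_index (c, l))
             * P (mxtens_index (i', c)) (mxtens_index (b, k))).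
  apply: eq_bigr => i' _; rewrite mulr_sumr; apply: eq_bigr => c _.
  under eq_bigr => l' _ do
    rewrite assocmx_mul mul_assocmxV !tensmxE [1%:M l' l]mxE mulrA.
  by rewrite sum_deltar mxE eq_sym mulrA.
by rewrite sum_deltal.
Qed.

Lemma twicemx_unitary : P *m P^t* = 1%:M -> twicemx *m twicemx^t* = 1%:M.
Proof.
move=> PP; rewrite /twicemx !adjmxM !adjmx_tens !adjmx1.
have adjT a b c : ((assocmx C a b c)^T)^t* = assocmx C a b c.
  by rewrite -assocmx_adj trmxCK.
rewrite !adjT assocmx_adj !mulmxA -[X in X *m _ *m _ *m _ *m _]mulmxA.
rewrite assocmxVK mulmx1 -[X in X *m _ *m _ *m _]mulmxA.
rewrite (tensmx_mul P) PP mulmx1 tensmx11 mulmx1.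
rewrite -[X in X *m _ *m _]mulmxA assocmxK mulmx1 -[X in X *m _]mulmxA.
by rewrite (tensmx_mul _ P) PP mulmx1 tensmx11 mulmx1 assocmxVK.
Qed.

Definition bendmx (ev : 'M[C]_(1, n * n)) (coev : 'M[C]_(n * n, 1))
    : 'M[C]_(h * n, n * h) :=
  (lunitmx C h *t (1%:M : 'M_n))
    *m ((ev *t (1%:M : 'M_h)) *t (1%:M : 'M_n))
    *m ((assocmx C n n h)^T *t (1%:M : 'M_n))
    *m (((1%:M : 'M_n) *t P) *t (1%:M : 'M_n))
    *m (assocmx C n h n *t (1%:M : 'M_n))
    *m (assocmx C (n * h) n n)^T
    *m ((1%:M : 'M_(n * h)) *t coev)
    *m (runitmx C (n * h))^T.

Lemma mul_runitmxV (d a : nat) (M : 'M[C]_(d, a * 1)) p i :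
  (M *m (runitmx C a)^T) p i = M p (mxtens_index (i, ord0)).
Proof.
rewrite mxE -[RHS](sum_deltar _ (fun q => M p q)); apply: eq_bigr => q _.
case: (mxtens_indexP q) => j z; rewrite !mxE mxtens_indexK eq_mxtens /= (ord1 z).
by rewrite eq_sym eqxx andbT.
Qed.

Lemma mul_lunitmxV (d a : nat) (M : 'M[C]_(d, 1 * a)) p i :
  (M *m (lunitmx C a)^T) p i = M p (mxtens_index (ord0, i)).
Proof.
rewrite mxE -[RHS](sum_deltar _ (fun q => M p q)); apply: eq_bigr => q _.
case: (mxtens_indexP q) => z j; rewrite !mxE mxtens_indexK eq_mxtens /= (ord1 z).
by rewrite eq_sym eqxx.
Qed.

Lemma lunitmx_mul (d a : nat) (M : 'M[C]_(1 * a, d)) p i :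
  (lunitmx C a *m M) i p = M (mxtens_index (ord0, i)) p.
Proof. by rewrite -[_ *m M]trmxK mxE trmx_mul mul_lunitmxV mxE. Qed.

(** In a basis where evaluation and coevaluation are Kronecker deltas, bending transposes the legs
    in [C^n] and leaves the auxiliary indices in place. *)
Lemma bendmxE (ev : 'M[C]_(1, n * n)) (coev : 'M[C]_(n * n, 1)) b j i a :
    (forall k l, ev ord0 (mxtens_index (k, l)) = (k == l)%:R) ->
    (forall k l, coev (mxtens_index (k, l)) ord0 = (k == l)%:R) ->
  bendmx ev coev (mxtens_index (b, j)) (mxtens_index (i, a))
    = P (mxtens_index (i, b)) (mxtens_index (a, j)).
Proof.
move=> evE coevE.
rewrite /bendmx mul_runitmxV mul_tens1mx sum_mxtens.
rewrite !tensmx_mul !mulmx1.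
transitivity (\sum_j' \sum_j'' (lunitmx C h *m (ev *t (1%:M : 'M_h)) *m (assocmx C n n h)^T
    *m ((1%:M : 'M_n) *t P) *m assocmx C n h n) b
      (mxtens_index (mxtens_index (i, a), j')) * (j'' == j)%:R * (j'' == j')%:R).
  apply: eq_bigr => j' _; apply: eq_bigr => j'' _.
  rewrite assocmxV_mul tensmxE [1%:M _ _]mxE coevE.
  by rewrite [j == _]eq_sym [j' == _]eq_sym.
under eq_bigr => j' _ do rewrite sum_deltar [j' == j]eq_sym.
under eq_bigr => j' _ do rewrite [j == j']eq_sym.
rewrite sum_deltar assocmx_mul mul_tens1mx sum_mxtens.
transitivity (\sum_i' \sum_c (i' == i)%:R * ((c == b)%:R
    * P (mxtens_index (i', c)) (mxtens_index (a, j)))).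
  apply: eq_bigr => i' _; apply: eq_bigr => c _.
  rewrite assocmxV_mul lunitmx_mul tensmxE evE [1%:M _ _]mxE.
  rewrite [i' == _]eq_sym [b == _]eq_sym.
  by rewrite mulrA.
under eq_bigr => i' _ do rewrite -mulr_sumr sum_deltal.
by rewrite sum_deltal.
Qed.

End RawDiagrams.

Local Notation K := (bool * bool)%type.
Variables (n : nat) (p : K -> 'M[C]_n) (m : 'M[C]_(n, n * n)).
Hypothesis p_res : resolution p.
Hypothesis m_graded : forall a b,
  m *m (p a *t p b) = p (kadd a b) *m m *m (p a *t p b).

Let S : 'M[C]_(n * 2) := \sum_x p x *t pauli C x.

Definition pauli_iso : 'M[C]_(n * 2, 2 * n) := S *m swapmx n 2.

Lemma pauli_isoE i a b j :
  pauli_iso (mxtens_index (i, a)) (mxtens_index (b, j))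
    = \sum_x p x i j * pauli C x a b.
Proof.
rewrite mul_swapmx summxE; apply: eq_bigr => x _.
by rewrite tensmxE.
Qed.

Let SS : S *m S = 1%:M.
Proof.
have [o s h] := p_res.
rewrite -tensmx11 -s tensmxDl mulmx_sumr; apply: eq_bigr => x _.
rewrite mulmx_suml (bigD1 x) //= big1 => [|y /negPf yx].
  rewrite tensmx_mul o eqxx scale1r addr0 pauliM pauli_cocyclexx scale1r.
  by rewrite /kadd !addbb pauli0.
by rewrite tensmx_mul o yx scale0r tens0mx.
Qed.

Let S_adj : S^t* = S.
Proof.
have [o s h] := p_res.
rewrite /S (big_morph (fun A : 'M[C]_(n * 2) => A^t*) (id1 := 0) (op1 := +%R)).
- by apply: eq_bigr => x _; rewrite adjmx_tens h pauli_adj.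
- by move=> x y; rewrite linearD /= map_mxD.
- by rewrite trmx0 map_mx0.
Qed.

Lemma pauli_iso_mul_adj : pauli_iso *m pauli_iso^t* = 1%:M.
Proof.
rewrite /pauli_iso adjmxM S_adj swapmx_adj -mulmxA [swapmx _ _ *m _]mulmxA.
by rewrite swapmxK mul1mx SS.
Qed.

Lemma pauli_iso_adj_mul : pauli_iso^t* *m pauli_iso = 1%:M.
Proof.
by rewrite /pauli_iso adjmxM S_adj swapmx_adj -mulmxA [S *m _]mulmxA SS mul1mx swapmxK.
Qed.

Lemma pauli_iso_comm (T : 'M[C]_n) : (forall x, T *m p x = p x *m T) ->
  pauli_iso *m ((1%:M : 'M_2) *t T) = (T *t (1%:M : 'M_2)) *m pauli_iso.
Proof.
move=> Tp; rewrite /pauli_iso -mulmxA swapmx_nat !mulmxA; congr (_ *m _).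
rewrite mulmx_suml mulmx_sumr; apply: eq_bigr => x _.
by rewrite !tensmx_mul Tp mulmx1 mul1mx.
Qed.

(** For fixed auxiliary indices the isomorphism is a function of the degree, so the calculus of
    projections applies to each block. *)
Let slice a b : 'M[C]_n := fcalc p (fun x => pauli C x a b).

Let sliceE i a b j :
  pauli_iso (mxtens_index (i, a)) (mxtens_index (b, j)) = slice a b i j.
Proof.
rewrite pauli_isoE summxE; apply: eq_bigr => x _.
by rewrite [RHS]mxE mulrC.
Qed.

(** On degrees x and y the left side gives the Pauli matrix of x + y. The right side gives w(x, y)
    times the product of the Pauli matrices of y and x, that is w(x, y) w(y, x) = 1 times the same
    matrix. *)
Lemma pauli_iso_mul :
  pauli_iso *m ((1%:M : 'M_2) *t m)
    = ((m *m twist p) *t (1%:M : 'M_2)) *m twicemx pauli_iso.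
Proof.
apply/matrixP => q r; case: (mxtens_indexP q) => v a; case: (mxtens_indexP r) => b kl.
rewrite mul_tens1mx tensmx1_mul.
pose p2 := fun x : K * K => p x.1 *t p x.2.
have p2_res : resolution p2 by apply: resolution_tens.
(* The reversed order is the one found in [twicemxE]. *)
pose T := fcalc p2 (fun x => (pauli C x.2 *m pauli C x.1) a b).
have TE ij : twicemx pauli_iso (mxtens_index (ij, a)) (mxtens_index (b, kl)) = T ij kl.
  case: (mxtens_indexP ij) => i j; case: (mxtens_indexP kl) => k l.
  rewrite twicemxE summxE.
  transitivity (\sum_c \sum_y \sum_x
     (p x i k * p y j l) * (pauli C y a c * pauli C x c b)).
    apply: eq_bigr => c _; rewrite !pauli_isoE mulr_suml; apply: eq_bigr => y _.
    by rewrite mulr_sumr; apply: eq_bigr => x _; rewrite mulrACA [p y j l * _]mulrC.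
  rewrite exchange_big /= [LHS](eq_bigr (fun y => \sum_x \sum_c
     (p x i k * p y j l) * (pauli C y a c * pauli C x c b))); last first.
    by move=> y _; rewrite exchange_big.
  rewrite exchange_big pair_big /=; apply: eq_bigr => -[x y] _ /=.
  by rewrite -mulr_sumr [RHS]mxE tensmxE [RHS]mulrC; congr (_ * _); rewrite [RHS]mxE.
transitivity (((m *m twist p) *m T) v kl); last first.
  by rewrite mxE; apply: eq_bigr => ij _; rewrite TE.
transitivity ((slice a b *m m) v kl).
  by rewrite mxE; apply: eq_bigr => w _; rewrite sliceE.
congr (_ _ _).
have -> : slice a b *m m
    = m *m fcalc p2 ((fun x => pauli C x a b) \o (fun x => kadd x.1 x.2)).
  by apply: fcalc_intertwine => // -[x y]; apply: m_graded.
rewrite -mulmxA fcalcM //; congr (_ *m _); apply: eq_fcalc => -[x y] /=.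
rewrite pauliM [X in _ = _ * X]mxE mulrA pauli_cocycle_unit mul1r; congr (pauli _ _ _ _).
by rewrite /kadd addbC [x.2 (+) _]addbC.
Qed.

(** The adjoint of [pauli_iso_mul], with the unitaries [pauli_iso] and [twicemx pauli_iso]
    cancelled. *)
Lemma pauli_iso_comul :
  ((m *m twist p)^t* *t (1%:M : 'M_2)) *m pauli_iso
    = twicemx pauli_iso *m ((1%:M : 'M_2) *t m^t*).
Proof.
have E : (m *m twist p) *t (1%:M : 'M_2)
    = pauli_iso *m ((1%:M : 'M_2) *t m) *m (twicemx pauli_iso)^t*.
  by rewrite pauli_iso_mul -mulmxA twicemx_unitary ?pauli_iso_mul_adj // mulmx1.
have -> : (m *m twist p)^t* *t (1%:M : 'M_2) = ((m *m twist p) *t (1%:M : 'M_2))^t*.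
  by rewrite adjmx_tens adjmx1.
rewrite E adjmxM trmxCK (adjmxM pauli_iso) adjmx_tens adjmx1 -!mulmxA.
by rewrite pauli_iso_adj_mul mulmx1.
Qed.

Variable u : 'M[C]_(n, 1).
Hypothesis u_graded : forall x, p x *m u = (x == (false, false))%:R *: u.

Lemma pauli_iso_unit :
  pauli_iso *m ((1%:M : 'M_2) *t u) *m (runitmx C 2)^T
    = (u *t (1%:M : 'M_2)) *m (lunitmx C 2)^T.
Proof.
apply/matrixP => q b; case: (mxtens_indexP q) => v a.
rewrite mul_runitmxV mul_lunitmxV mul_tens1mx tensmxE.
transitivity ((slice a b *m u) v ord0).
  by rewrite mxE; apply: eq_bigr => w _; rewrite sliceE.
rewrite mulmx_suml (bigD1 (false, false)) //= big1 => [|x /negPf x0].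
  by rewrite addr0 -scalemxAl u_graded eqxx scale1r pauli0 mxE mulrC.
by rewrite -scalemxAl u_graded x0 scale0r scaler0.
Qed.

Lemma pauli_iso_counit :
  lunitmx C 2 *m (u^t* *t (1%:M : 'M_2)) *m pauli_iso
    = runitmx C 2 *m ((1%:M : 'M_2) *t u^t*).
Proof.
have lu : ((lunitmx C 2)^T)^t* = lunitmx C 2.
  by apply/matrixP => i j; rewrite !mxE conjC_nat.
have ru : ((runitmx C 2)^T)^t* = runitmx C 2.
  by apply/matrixP => i j; rewrite !mxE conjC_nat.
have -> : lunitmx C 2 *m (u^t* *t (1%:M : 'M_2))
    = ((u *t (1%:M : 'M_2)) *m (lunitmx C 2)^T)^t*.
  by rewrite adjmxM lu adjmx_tens adjmx1.
rewrite -pauli_iso_unit adjmxM ru (adjmxM pauli_iso) adjmx_tens adjmx1 -!mulmxA.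
by rewrite pauli_iso_adj_mul mulmx1.
Qed.

(** The counit vanishes on products of non-zero total degree. In (Z/2)^2 the total degree is zero
    only if both degrees agree, and there the cocycle is 1. *)
Lemma counit_twist : u^t* *m m *m twist p = u^t* *m m.
Proof.
have [o s h] := p_res.
pose p2 := fun x : K * K => p x.1 *t p x.2.
have p2_res : resolution p2 by apply: resolution_tens.
have up x : u^t* *m p x = (x == (false, false))%:R *: u^t*.
  rewrite -[p x]h -adjmxM u_graded linearZ /= map_mxZ.
  by congr (_ *: _); apply: conjC_nat.
rewrite -[RHS](sum_mulP p2_res) mulmx_sumr; apply: eq_bigr => -[x y] _ /=.
rewrite -scalemxAr -mulmxA m_graded !mulmxA up -!scalemxAl.
case: eqP => [xy|_]; last by rewrite !scale0r scaler0.
have -> : y = x by case: x y xy => [[] []] [[] []].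
by rewrite pauli_cocyclexx scale1r.
Qed.

End PauliIntertwiner.

(** * C*-algebras from Frobenius structures *)

Section FrobeniusAlgebras.

Variable C : numClosedFieldType.

(* Structure constants in an orthonormal basis of self-adjoint elements:
   [funit] are the coordinates of 1, and the adjoint of [funit] is the state. *)
Record frobenius := Frobenius {
  fdim : nat;
  fmul : 'M[C]_(fdim, fdim * fdim);
  funit : 'cV[C]_fdim;
  fmulA : fmul *m (fmul *t 1%:M) = fmul *m (1%:M *t fmul) *m assocmx C fdim fdim fdim;
  fmul1l : fmul *m (funit *t 1%:M) *m (lunitmx C fdim)^T = 1%:M;
  fmul1r : fmul *m (1%:M *t funit) *m (runitmx C fdim)^T = 1%:M;
  fmul_conj : forall k i j,
    (fmul k (mxtens_index (i, j)))^* = fmul k (mxtens_index (j, i));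
  funit_conj : forall k, (funit k 0)^* = funit k 0;
  fcounit : forall i j, (funit^t* *m fmul) 0 (mxtens_index (i, j)) = (i == j)%:R;
  funit_norm : funit^t* *m funit = 1%:M
}.

Variable A : frobenius.
Local Notation n := (fdim A).
Local Notation M := (fmul A).
Local Notation u := (funit A).

Definition frob_alg (A : frobenius) := 'cV[C]_(fdim A).
HB.instance Definition _ := Vector.on (frob_alg A).

Definition frob_mul (x y : 'cV[C]_n) : 'cV[C]_n := M *m (x *t y : 'M_(n * n, 1)).

Lemma frob_mulE x y k : frob_mul x y k 0
  = \sum_i \sum_j M k (mxtens_index (i, j)) * (x i 0 * y j 0).
Proof.
rewrite mxE sum_mxtens; apply: eq_bigr => i _; apply: eq_bigr => j _.
by rewrite mxE !mxtens_indexK; congr (_ * (x _ _ * y _ _)); apply: ord1.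
Qed.

Lemma fmulA_entry i j k r :
  \sum_l M r (mxtens_index (l, k)) * M l (mxtens_index (i, j))
    = \sum_l M r (mxtens_index (i, l)) * M l (mxtens_index (j, k)).
Proof.
have /matrixP/(_ r (mxtens_index (mxtens_index (i, j), k))) := fmulA A.
rewrite assocmx_mul mul_tens1mx => <-.
rewrite mxE sum_mxtens; apply: eq_bigr => l _.
rewrite -[LHS](sum_deltal k (fun k' => M r (mxtens_index (l, k')) * M l (mxtens_index (i, j)))).
by apply: eq_bigr => k' _; rewrite tensmxE [1%:M _ _]mxE [in RHS]mulrA [RHS]mulrC.
Qed.

Lemma frob_mulA : associative frob_mul.
Proof.
move=> x y z; apply/colP => r; rewrite !frob_mulE.
transitivity (\sum_i \sum_j \sum_k (x i 0 * (y j 0 * z k 0))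
   * \sum_l M r (mxtens_index (i, l)) * M l (mxtens_index (j, k))).
  apply: eq_bigr => i _.
  under eq_bigr => l _ do rewrite frob_mulE !mulr_sumr.
  rewrite exchange_big; apply: eq_bigr => j _ /=.
  under eq_bigr => l _ do rewrite !mulr_sumr.
  rewrite exchange_big; apply: eq_bigr => k _ /=.
  rewrite mulr_sumr; apply: eq_bigr => l _.
  ring.
under [RHS]eq_bigr => l _ do under eq_bigr => k _ do rewrite frob_mulE mulr_suml mulr_sumr.
under [RHS]eq_bigr => l _ do rewrite exchange_big /=.
rewrite [RHS]exchange_big; apply: eq_bigr => i _ /=.
under [RHS]eq_bigr => l _ do under eq_bigr => k _ do rewrite mulr_suml mulr_sumr.
under [RHS]eq_bigr => l _ do rewrite exchange_big /=.
rewrite [RHS]exchange_big; apply: eq_bigr => j _ /=.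
rewrite [RHS]exchange_big; apply: eq_bigr => k _ /=.
rewrite -fmulA_entry mulr_sumr; apply: eq_bigr => l _.
ring.
Qed.

Lemma frob_mul1l : left_id u frob_mul.
Proof.
move=> x; apply/colP => r; rewrite frob_mulE exchange_big /=.
rewrite -[x in RHS]mul1mx -(fmul1l A) [RHS]mxE; apply: eq_bigr => j _.
rewrite mul_lunitmxV mxE sum_mxtens mulr_suml; apply: eq_bigr => i _.
rewrite mulrA; congr (_ * _).
rewrite -[LHS](sum_deltal j (fun j' => M r (mxtens_index (i, j')) * u i 0)).
by apply: eq_bigr => j' _; rewrite tensmxE [1%:M _ _]mxE [in RHS]mulrA [RHS]mulrC.
Qed.

Lemma frob_mul1r : right_id u frob_mul.
Proof.
move=> x; apply/colP => r; rewrite frob_mulE.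
rewrite -[x in RHS]mul1mx -(fmul1r A) [RHS]mxE; apply: eq_bigr => i _.
rewrite mul_runitmxV mul_tens1mx mulr_suml; apply: eq_bigr => j _.
by rewrite -mulrA [u j 0 * _]mulrC.
Qed.

Lemma frob_mulDl : left_distributive frob_mul +%R.
Proof.
move=> x y z; rewrite /frob_mul -mulmxDr; congr (_ *m _).
by apply/matrixP => i j; rewrite !mxE mulrDl.
Qed.

Lemma frob_mulDr : right_distributive frob_mul +%R.
Proof.
move=> x y z; rewrite /frob_mul -mulmxDr; congr (_ *m _).
by apply/matrixP => i j; rewrite !mxE mulrDr.
Qed.

Lemma funit_neq0 : u != 0.
Proof.
apply/eqP => u0; have := funit_norm A; rewrite u0 mulmx0 => /matrixP/(_ 0 0)/eqP.
by rewrite !mxE eqxx eq_sym oner_eq0.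
Qed.

HB.instance Definition _ := GRing.Zmodule_isNzRing.Build (frob_alg A)
  frob_mulA frob_mul1l frob_mul1r frob_mulDl frob_mulDr funit_neq0.

Fact frob_scaleAl (c : C) (x y : frob_alg A) : c *: (x * y) = (c *: x) * y.
Proof.
rewrite /GRing.mul /= /frob_mul scalemxAr; congr (_ *m _).
by apply/matrixP => i j; rewrite !mxE mulrA.
Qed.
HB.instance Definition _ := GRing.Lmodule_isLalgebra.Build C (frob_alg A) frob_scaleAl.

Fact frob_scaleAr (c : C) (x y : frob_alg A) : c *: (x * y) = x * (c *: y).
Proof.
rewrite /GRing.mul /= /frob_mul scalemxAr; congr (_ *m _).
by apply/matrixP => i j; rewrite !mxE mulrCA.
Qed.
HB.instance Definition _ := GRing.Lalgebra_isAlgebra.Build C (frob_alg A) frob_scaleAr.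
HB.instance Definition _ := Algebra_isFalgebra.Build C (frob_alg A).

Lemma frob_mulrE (x y : frob_alg A) : x * y = frob_mul x y.
Proof. by []. Qed.

Definition frob_star (x : frob_alg A) : frob_alg A := map_mx Num.conj x.

Lemma frob_starE (x : frob_alg A) k : (frob_star x : 'cV_n) k 0 = ((x : 'cV_n) k 0)^*.
Proof. by rewrite mxE. Qed.

Lemma frob_star_semilinear (c : C) (x y : frob_alg A) :
  frob_star (c *: x + y) = c^* *: frob_star x + frob_star y.
Proof. by apply/colP => i; rewrite !mxE rmorphD rmorphM. Qed.

Lemma frob_starM (x y : frob_alg A) : frob_star (x * y) = frob_star y * frob_star x.
Proof.
apply/colP => k; rewrite frob_starE !frob_mulrE !frob_mulE rmorph_sum.
under eq_bigr => i _ do rewrite rmorph_sum /=.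
rewrite exchange_big /=; apply: eq_bigr => j _; apply: eq_bigr => i _.
by rewrite !frob_starE !rmorphM /= fmul_conj [_^* * _^*]mulrC.
Qed.

Lemma frob_starK : involutive frob_star.
Proof. by move=> x; apply/colP => k; rewrite !frob_starE conjCK. Qed.

Definition frob_state (x : frob_alg A) : C := (u^t* *m (x : 'cV_n)) 0 0.

Lemma frob_state_linear : scalar frob_state.
Proof.
by move=> c x y; rewrite /frob_state mulmxDr -scalemxAr mxE [X in X + _]mxE.
Qed.

Lemma frob_state1 : frob_state 1 = 1.
Proof. by rewrite /frob_state -[1]/u funit_norm mxE eqxx. Qed.

(** By [fcounit] the state of a product is the bilinear dot product of coordinates; conjugating one
    argument then gives the standard inner product. *)
Lemma frob_stateM (x y : frob_alg A) :
  frob_state (x * y) = \sum_i (x : 'cV_n) i 0 * (y : 'cV_n) i 0.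
Proof.
rewrite /frob_state frob_mulrE /frob_mul mulmxA mxE sum_mxtens.
apply: eq_bigr => i _.
rewrite -(sum_deltal i (fun j => (x : 'cV_n) i 0 * (y : 'cV_n) j 0)).
apply: eq_bigr => j _; rewrite fcounit eq_sym; congr (_ * _).
by rewrite mxE !mxtens_indexK; congr (x _ _ * y _ _); apply: ord1.
Qed.

Lemma frob_inner (x y : frob_alg A) :
  frob_state (frob_star x * y) = \sum_i ((x : 'cV_n) i 0)^* * (y : 'cV_n) i 0.
Proof. by rewrite frob_stateM; apply: eq_bigr => i _; rewrite frob_starE. Qed.

Lemma frob_state_ge0 (x : frob_alg A) : 0 <= frob_state (frob_star x * x).
Proof.
rewrite frob_inner; apply: sumr_ge0 => i _.
by rewrite mulrC -normCK exprn_ge0.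
Qed.

Lemma frob_state_faithful (x : frob_alg A) : frob_state (frob_star x * x) = 0 -> x = 0.
Proof.
rewrite frob_inner => /eqP.
rewrite psumr_eq0 => [/allP x0|i _]; last by rewrite mulrC -normCK exprn_ge0.
apply/colP => k; rewrite [RHS]mxE; apply/eqP.
by have := x0 k (mem_index_enum _); rewrite /= mulf_eq0 conjC_eq0 orbb.
Qed.

Definition frob_basis : n.-tuple (frob_alg A) := [tuple delta_mx i 0 | i < n].

Lemma frob_basisE i k : (tnth frob_basis i : 'cV[C]_n) k 0 = (k == i)%:R.
Proof. by rewrite tnth_mktuple mxE andbT. Qed.

Lemma frob_basis_orthonormal i j :
  frob_state (frob_star (tnth frob_basis i) * tnth frob_basis j) = (i == j)%:R.
Proof.
rewrite frob_inner -[RHS](sum_deltal i (fun k => (k == j)%:R)).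
by apply: eq_bigr => k _; rewrite !frob_basisE conjC_nat.
Qed.

Lemma frob_basisP : basis_of {:frob_alg A} frob_basis.
Proof.
rewrite basisEdim size_tuple dimvf /dim /= muln1 leqnn andbT.
apply/subvP => x _.
have -> : x = \sum_i (x : 'cV_n) i 0 *: tnth frob_basis i.
  apply/colP => k; rewrite summxE -[LHS](sum_deltal k (fun i => (x : 'cV_n) i 0)).
  apply: eq_bigr => i _.
  by rewrite [RHS]mxE frob_basisE mulrC eq_sym.
by apply: memv_suml => i _; rewrite memvZ // memv_span ?mem_tnth.
Qed.

(** Left multiplication by [x], transposed so as to act on rows like the matrices in [opnorm]. This
    reverses products. *)
Definition frob_lmul (x : 'cV[C]_n) : 'M[C]_n :=
  \matrix_(j, k) \sum_i M k (mxtens_index (i, j)) * x i 0.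

(** Both sides are the state of e_k e_j e_i, for the two ways to bracket this product. *)
Lemma fmul_cyclic i j k : M k (mxtens_index (j, i)) = M i (mxtens_index (k, j)).
Proof.
have sl : \sum_l (u^t* *m M) 0 (mxtens_index (k, l)) * M l (mxtens_index (j, i))
   = M k (mxtens_index (j, i)).
  by under eq_bigr => l _ do rewrite fcounit eq_sym; rewrite sum_deltal.
have sr : \sum_l (u^t* *m M) 0 (mxtens_index (l, i)) * M l (mxtens_index (k, j))
   = M i (mxtens_index (k, j)).
  by under eq_bigr => l _ do rewrite fcounit; rewrite sum_deltal.
rewrite -sl -sr.
under eq_bigr => l _ do rewrite mxE mulr_suml.
under [RHS]eq_bigr => l _ do rewrite mxE mulr_suml.
rewrite exchange_big [RHS]exchange_big; apply: eq_bigr => r _ /=.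
under eq_bigr => l _ do rewrite -mulrA.
under [RHS]eq_bigr => l _ do rewrite -mulrA.
by rewrite -!mulr_sumr fmulA_entry.
Qed.

Lemma frob_lmul_mul (x y : 'cV[C]_n) :
  frob_lmul (frob_mul x y) = frob_lmul y *m frob_lmul x.
Proof.
apply/matrixP => k r; rewrite mxE.
transitivity (\sum_i \sum_j x i 0 * y j 0
  * \sum_l M r (mxtens_index (l, k)) * M l (mxtens_index (i, j))).
  under eq_bigr => l _ do rewrite frob_mulE mulr_sumr.
  rewrite exchange_big; apply: eq_bigr => i _ /=.
  under eq_bigr => l _ do rewrite mulr_sumr.
  rewrite exchange_big; apply: eq_bigr => j _ /=.
  by rewrite mulr_sumr; apply: eq_bigr => l _; ring.
rewrite mxE.
under [RHS]eq_bigr => l _ do rewrite !mxE mulr_sumr.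
rewrite [RHS]exchange_big; apply: eq_bigr => i _ /=.
under [RHS]eq_bigr => l _ do rewrite mulr_suml.
rewrite [RHS]exchange_big; apply: eq_bigr => j _ /=.
rewrite fmulA_entry mulr_sumr; apply: eq_bigr => l _.
ring.
Qed.

(** Conjugating a structure constant swaps its two lower indices, and cyclicity then moves the upper
    one to the place required by the adjoint. *)
Lemma frob_lmul_star (x : 'cV[C]_n) : frob_lmul (map_mx Num.conj x) = (frob_lmul x)^t*.
Proof.
apply/matrixP => j k; rewrite !mxE rmorph_sum; apply: eq_bigr => i _ /=.
by rewrite rmorphM /= fmul_conj mxE fmul_cyclic.
Qed.

Lemma frob_lmul_linear (c : C) (x y : 'cV[C]_n) :
  frob_lmul (c *: x + y) = c *: frob_lmul x + frob_lmul y.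
Proof.
apply/matrixP => j k; rewrite !mxE mulr_sumr -big_split; apply: eq_bigr => i _ /=.
by rewrite !mxE mulrDr mulrCA.
Qed.

(** Left multiplication by [x] sends the unit to [x]. Faithfulness makes the operator norm definite
    on the algebra. *)
Lemma frob_lmul_eq0 (x : 'cV[C]_n) : frob_lmul x = 0 -> x = 0.
Proof.
move=> x0; rewrite -(frob_mul1r x); apply/colP => k; rewrite frob_mulE exchange_big.
rewrite [RHS]mxE big1 // => j _.
have /matrixP/(_ j k) := x0; rewrite !mxE => xjk.
have := congr1 (fun c => c * u j 0) xjk; rewrite mul0r mulr_suml; apply: etrans.
by apply: eq_bigr => i _; rewrite mulrA.
Qed.

Lemma frob_inner_basis k (x : frob_alg A) :
  frob_state (frob_star (tnth frob_basis k) * x) = (x : 'cV_n) k 0.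
Proof.
rewrite frob_inner -[RHS](sum_deltal k (fun i => (x : 'cV_n) i 0)).
by apply: eq_bigr => i _; rewrite frob_basisE conjC_nat.
Qed.

Lemma frob_basis_mul i j k :
  (tnth frob_basis i * tnth frob_basis j : 'cV_n) k 0 = M k (mxtens_index (i, j)).
Proof.
rewrite frob_mulrE frob_mulE.
rewrite -[RHS](sum_deltal i (fun i' => M k (mxtens_index (i', j)))).
apply: eq_bigr => i' _.
rewrite -[RHS](sum_deltal j (fun j' => (i' == i)%:R * M k (mxtens_index (i', j')))).
apply: eq_bigr => j' _; rewrite !frob_basisE; ring.
Qed.

End FrobeniusAlgebras.

Section FrobeniusQuantumSet.

Variables (R : realType) (A : frobenius R[i]).
Local Notation C := R[i].
Local Notation n := (fdim A).

Definition frob_cnorm (x : frob_alg A) : R := opnorm (frob_lmul x).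

Lemma frob_cnorm_eq0 (x : frob_alg A) : frob_cnorm x = 0 -> x = 0.
Proof. by move=> /opnorm_eq0/frob_lmul_eq0. Qed.

Lemma frob_lmulD (x y : frob_alg A) :
  frob_lmul (x + y) = frob_lmul x + frob_lmul y.
Proof. by have := frob_lmul_linear 1 (x : 'cV_n) y; rewrite !scale1r. Qed.

Lemma frob_cnormD (x y : frob_alg A) :
  frob_cnorm (x + y) <= frob_cnorm x + frob_cnorm y.
Proof.
rewrite /frob_cnorm frob_lmulD; exact: opnormD.
Qed.

Lemma frob_lmulZ (c : C) (x : frob_alg A) : frob_lmul (c *: x) = c *: frob_lmul x.
Proof.
have := frob_lmul_linear c (x : 'cV_n) 0; rewrite addr0 => ->.
suff -> : frob_lmul (0 : 'cV_n) = 0 by rewrite addr0.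
by have := frob_lmul_linear (-1) (0 : 'cV_n) 0; rewrite scaler0 addr0 scaleN1r addNr.
Qed.

Lemma frob_cnormZ (c : C) (x : frob_alg A) :
  frob_cnorm (c *: x) = Normc.normc c * frob_cnorm x.
Proof. by rewrite /frob_cnorm frob_lmulZ; apply: opnormZ. Qed.

Lemma frob_cnormM (x y : frob_alg A) :
  frob_cnorm (x * y) <= frob_cnorm x * frob_cnorm y.
Proof.
have E : frob_lmul (x * y) = frob_lmul y *m frob_lmul x by apply: frob_lmul_mul.
by rewrite /frob_cnorm E mulrC; apply: opnormM.
Qed.

Lemma frob_cnorm_star (x : frob_alg A) :
  frob_cnorm (frob_star x * x) = frob_cnorm x ^+ 2.
Proof.
(* The reversal of products gives the order of factors required by [opnorm_mul_adj]. *)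
have E : frob_lmul (frob_star x * x) = frob_lmul x *m (frob_lmul x)^t*.
  by rewrite -frob_lmul_star; apply: frob_lmul_mul.
by rewrite /frob_cnorm E; apply: opnorm_mul_adj.
Qed.

Definition frob_cstar : cstar_algebra R :=
  @CStarAlgebra R (frob_alg A) (@frob_star _ A) frob_cnorm
    (@frob_star_semilinear _ A) (@frob_starM _ A) (@frob_starK _ A) frob_cnorm_eq0
    frob_cnormD frob_cnormZ frob_cnormM frob_cnorm_star.

Definition frob_state_algebra : state_algebra R :=
  @StateAlgebra R frob_cstar (@frob_state _ A) (@frob_state_linear _ A)
    (@frob_state1 _ A) (@frob_state_ge0 _ A) (@frob_state_faithful _ A)
    n (frob_basis A) (frob_basisP A) (frob_basis_orthonormal (A := A)).

Lemma frob_mulmatE : mulmat frob_state_algebra = fmul A.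
Proof.
apply/matrixP => k p; case: (mxtens_indexP p) => i j.
rewrite mxE mxtens_indexK /=; apply: etrans (frob_inner_basis _ _) _.
exact: frob_basis_mul.
Qed.

Lemma frob_unitmatE : unitmat frob_state_algebra = funit A.
Proof.
apply/matrixP => k z; rewrite mxE (ord1 z).
exact: frob_inner_basis.
Qed.

Variable d : C.
Hypotheses (d_gt0 : 0 < d) (d_special : fmul A *m (fmul A)^t* = (d ^+ 2)%:M).

Fact frob_special :
  mulmat frob_state_algebra *m (mulmat frob_state_algebra)^t* = (d ^+ 2)%:M.
Proof. by rewrite frob_mulmatE. Qed.

Definition frob_qset : qset R := QSet d_gt0 frob_special.

End FrobeniusQuantumSet.

(** * Gradings of C^n by two commuting involutions *)

Section KleinTwist.

Variable C : numClosedFieldType.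
Local Notation K := (bool * bool)%type.

(* The diagonal structure constants of C^n in a normalised orthonormal basis. *)
Variables (n : nat) (c : C).
Hypotheses (c_real : c^* = c) (c_neq0 : c != 0) (c_sq : c ^+ 2 = n%:R).

Definition diagmul : 'M[C]_(n, n * n) :=
  \matrix_(k, p) (c *+ ((k == (mxtens_unindex p).1) && (k == (mxtens_unindex p).2))).
(** The basis vectors are e_i = c d_i with d_i the point masses, whence e_i e_i = c e_i and 1 = c^-1
    (e_1 + ... + e_n). *)
Definition diagunit : 'cV[C]_n := const_mx c^-1.

Local Notation m := diagmul.
Local Notation u := diagunit.

Lemma diagmulE k i j : m k (mxtens_index (i, j)) = (i == k)%:R * ((j == k)%:R * c).
Proof.
rewrite mxE mxtens_indexK /= [k == i]eq_sym [k == j]eq_sym.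
by case: (i == k); case: (j == k); rewrite ?mul0r ?mul1r.
Qed.

Lemma sum_diagmul k (F : 'I_n -> 'I_n -> C) :
  \sum_i \sum_j m k (mxtens_index (i, j)) * F i j = c * F k k.
Proof.
under eq_bigr => i _ do under eq_bigr => j _ do rewrite diagmulE -!mulrA.
under eq_bigr => i _ do rewrite -mulr_sumr sum_deltal.
by rewrite sum_deltal.
Qed.

Lemma diagmul_mul d (A : 'M[C]_(n * n, d)) k q :
  (m *m A) k q = c * A (mxtens_index (k, k)) q.
Proof.
rewrite mxE sum_mxtens.
exact: (sum_diagmul k (fun i j => A (mxtens_index (i, j)) q)).
Qed.

Lemma diagmul_adjE i j k : (m^t*) (mxtens_index (i, j)) k = (i == k)%:R * ((j == k)%:R * c).
Proof. by rewrite mxE mxE diagmulE !rmorphM /= !conjC_nat c_real. Qed.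

Lemma mul_diagmul_adj d (A : 'M[C]_(d, n * n)) k q :
  (A *m m^t*) q k = c * A q (mxtens_index (k, k)).
Proof.
rewrite mxE sum_mxtens -(sum_diagmul k (fun i j => A q (mxtens_index (i, j)))).
apply: eq_bigr => i _; apply: eq_bigr => j _.
by rewrite diagmul_adjE diagmulE mulrC.
Qed.

Lemma diagmulA : m *m (m *t 1%:M) = m *m (1%:M *t m) *m assocmx C n n n.
Proof.
apply/matrixP => r q; case: (mxtens_indexP q) => ij k; case: (mxtens_indexP ij) => i j.
rewrite assocmx_mul !diagmul_mul !tensmxE !diagmulE !mxE [r == i]eq_sym [r == k]eq_sym.
by congr (_ * _); rewrite -!mulrA; congr (_ * (_ * _)); rewrite mulrC.
Qed.

Lemma diagmul1l : m *m (u *t 1%:M) *m (lunitmx C n)^T = 1%:M.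
Proof.
apply/matrixP => i j; rewrite mul_lunitmxV diagmul_mul tensmxE !mxE.
by rewrite mulrA divff // mul1r.
Qed.

Lemma diagmul1r : m *m (1%:M *t u) *m (runitmx C n)^T = 1%:M.
Proof.
apply/matrixP => i j; rewrite mul_runitmxV diagmul_mul tensmxE !mxE.
by rewrite mulrCA divff // mulr1.
Qed.

Lemma diagcounit i j : (u^t* *m m) 0 (mxtens_index (i, j)) = (i == j)%:R.
Proof.
rewrite mxE -[RHS](sum_deltal i (fun k => (k == j)%:R)); apply: eq_bigr => k _.
rewrite diagmulE !mxE fmorphV /= c_real mulrCA [i == k]eq_sym; congr (_ * _).
by rewrite mulrCA mulVf // mulr1 eq_sym.
Qed.

Lemma diagunit_norm : u^t* *m u = 1%:M.
Proof.
apply/matrixP => i j; rewrite !ord1 mxE [RHS]mxE eqxx.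
under eq_bigr => k _ do rewrite !mxE fmorphV /= c_real -expr2 exprVn c_sq.
by rewrite sumr_const card_ord -[LHS]mulr_natr mulVf // -c_sq expf_neq0.
Qed.

Lemma diagmul_special : m *m m^t* = (c ^+ 2)%:M.
Proof.
apply/matrixP => i j; rewrite mul_diagmul_adj diagmulE mxE [i == j]eq_sym.
by case: (j == i); rewrite ?mul1r ?mul0r ?mulr0 ?mulr1n ?mulr0n ?expr2.
Qed.

Section Involution.

Variable (S : 'M[C]_n).
Hypotheses (S_conj : forall i j, (S i j)^* = S i j) (S_sym : S^T = S) (S_inv : S *m S = 1%:M)
  (S_mul : m *m (S *t S) = S *m m) (S_unit : S *m u = u).

Definition invproj (b : bool) : 'M[C]_n := 2^-1 *: (1%:M + (-1) ^+ b *: S).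

Lemma invproj_mulS b : S *m invproj b = (-1) ^+ b *: invproj b.
Proof.
rewrite /invproj -scalemxAr mulmxDr mulmx1 -scalemxAr S_inv scalerA mulrC -scalerA.
congr (_ *: _); rewrite scalerDr scalerA -expr2 sqrr_sign scale1r addrC.
by rewrite -scalemx1.
Qed.

Lemma invprojM a b : invproj a *m invproj b = (a == b)%:R *: invproj a.
Proof.
have two : (2 : C) != 0 by rewrite pnatr_eq0.
rewrite {1}/invproj -scalemxAl mulmxDl mul1mx -scalemxAl invproj_mulS scalerA.
rewrite -signr_addb -{1}[invproj b]scale1r -scalerDl scalerA.
case: (eqVneq a b) => [->|ab].
  by rewrite addbb expr0 -[1 + 1]/(2 : C) mulVf.
by have -> : a (+) b by [case: a b ab => [] []]; rewrite expr1 addrN mulr0 !scale0r.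
Qed.

Lemma invproj_sum : invproj false + invproj true = 1%:M.
Proof.
have two : (2 : C) != 0 by rewrite pnatr_eq0.
rewrite /invproj -scalerDr expr0 expr1 addrACA -scalerDl addrN scale0r addr0.
by rewrite -[1%:M + 1%:M]/(1%:M *+ 2) -scaler_nat scalerA mulVf ?scale1r.
Qed.

Lemma invproj_adj b : (invproj b)^t* = invproj b.
Proof.
have Sa : S^t* = S by rewrite S_sym; apply/matrixP => i j; rewrite mxE S_conj.
rewrite /invproj linearZ /= map_mxZ linearD /= map_mxD adjmx1 linearZ /= map_mxZ Sa.
rewrite rmorph_sign fmorphV /= conjC_nat.
by [].
Qed.

Lemma invproj_conj b i j : (invproj b i j)^* = invproj b i j.
Proof.
by rewrite !mxE !(rmorphM, rmorphD, rmorph_sign, fmorphV) /= !conjC_nat S_conj !conjC1.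
Qed.

(** Since [S] is multiplicative, the product of eigenvectors with signs (-1)^a and (-1)^b has sign
    (-1)^(a + b). *)
Lemma invproj_graded a b :
  m *m (invproj a *t invproj b) = invproj (a (+) b) *m m *m (invproj a *t invproj b).
Proof.
have two : (2 : C) != 0 by rewrite pnatr_eq0.
have Sm : S *m m *m (invproj a *t invproj b)
    = (-1) ^+ (a (+) b) *: (m *m (invproj a *t invproj b)).
  rewrite -S_mul -mulmxA tensmx_mul !invproj_mulS tensmxZl tensmxZr scalerA.
  by rewrite -scalemxAr signr_addb.
rewrite {3}/invproj -!scalemxAl !mulmxDl mul1mx -!scalemxAl Sm scalerA -signr_addb.
by rewrite addbb expr0 scale1r -mulr2n -scaler_nat scalerA mulVf // scale1r.
Qed.

Lemma invproj_unit b : invproj b *m u = (~~ b)%:R *: u.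
Proof.
have two : (2 : C) != 0 by rewrite pnatr_eq0.
rewrite /invproj -scalemxAl mulmxDl mul1mx -scalemxAl S_unit.
rewrite -{1}[u]scale1r -scalerDl scalerA; congr (_ *: _).
case: b; first by rewrite expr1 addrN mulr0.
by rewrite expr0 -[1 + 1]/(2 : C) mulVf.
Qed.

Lemma invproj_comm (T : 'M[C]_n) b :
  T *m S = S *m T -> T *m invproj b = invproj b *m T.
Proof.
move=> TS; rewrite /invproj -scalemxAr -scalemxAl mulmxDr mulmxDl mulmx1 mul1mx.
by rewrite -scalemxAr -scalemxAl TS.
Qed.

End Involution.

Variables (S T : 'M[C]_n).
Hypotheses (S_conj : forall i j, (S i j)^* = S i j) (S_sym : S^T = S) (S_inv : S *m S = 1%:M)
  (S_mul : m *m (S *t S) = S *m m) (S_unit : S *m u = u).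
Hypotheses (T_conj : forall i j, (T i j)^* = T i j) (T_sym : T^T = T) (T_inv : T *m T = 1%:M)
  (T_mul : m *m (T *t T) = T *m m) (T_unit : T *m u = u).
Hypothesis ST_comm : S *m T = T *m S.

Definition kproj (x : K) : 'M[C]_n := invproj S x.1 *m invproj T x.2.

Let comm a b : invproj S a *m invproj T b = invproj T b *m invproj S a.
Proof. by apply: invproj_comm; apply/esym/invproj_comm. Qed.

Lemma kproj_res : resolution kproj.
Proof.
split=> [[a b] [a' b']||[a b]]; rewrite /kproj /=.
- rewrite -mulmxA [invproj T b *m _]mulmxA -comm -mulmxA invprojM // mulmxA.
  rewrite invprojM // -scalemxAl -scalemxAr scalerA -natrM mulnb.
  by [].
- rewrite -(pair_bigA _ (fun a b => invproj S a *m invproj T b)) /=.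
  under eq_bigr => a _ do rewrite -mulmx_sumr big_bool /= addrC invproj_sum // mulmx1.
  by rewrite big_bool /= addrC invproj_sum.
- by rewrite adjmxM !invproj_adj // comm.
Qed.

Lemma kproj_conj x i j : (kproj x i j)^* = kproj x i j.
Proof.
rewrite !mxE rmorph_sum; apply: eq_bigr => k _ /=.
by rewrite rmorphM /= !invproj_conj.
Qed.

Lemma kproj_graded x y :
  m *m (kproj x *t kproj y) = kproj (kadd x y) *m m *m (kproj x *t kproj y).
Proof.
have E : kproj x *t kproj y = (invproj S x.1 *t invproj S y.1)
     *m (invproj T x.2 *t invproj T y.2) by rewrite tensmx_mul.
have E' : kproj x *t kproj y = (invproj T x.2 *t invproj T y.2)
     *m (invproj S x.1 *t invproj S y.1) by rewrite tensmx_mul -!comm.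
rewrite {1}E mulmxA (invproj_graded S_inv S_mul) -mulmxA -E E' !mulmxA.
by rewrite -[_ *m m *m _]mulmxA (invproj_graded T_inv T_mul) !mulmxA.
Qed.

Lemma kproj_unit x : kproj x *m u = (x == (false, false))%:R *: u.
Proof.
rewrite /kproj -mulmxA invproj_unit // -scalemxAr invproj_unit // scalerA -natrM mulnb.
by case: x => [[] []].
Qed.

Lemma kproj_comm (B : 'M[C]_n) x :
  B *m S = S *m B -> B *m T = T *m B -> B *m kproj x = kproj x *m B.
Proof.
move=> BS BT; rewrite /kproj mulmxA (invproj_comm _ BS) -mulmxA (invproj_comm _ BT).
by rewrite mulmxA.
Qed.

End KleinTwist.

(** * Twisting by a Klein group *)

Section KleinFrobenius.

Variable C : numClosedFieldType.
Local Notation K := (bool * bool)%type.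
Variables (n : nat) (c : C).
Hypotheses (c_real : c^* = c) (c_neq0 : c != 0) (c_sq : c ^+ 2 = n%:R).
Local Notation m := (diagmul n c).
Local Notation u := (diagunit n c).
Variables (S T : 'M[C]_n).
Hypotheses (S_conj : forall i j, (S i j)^* = S i j) (S_sym : S^T = S) (S_inv : S *m S = 1%:M)
  (S_mul : m *m (S *t S) = S *m m) (S_unit : S *m u = u).
Hypotheses (T_conj : forall i j, (T i j)^* = T i j) (T_sym : T^T = T) (T_inv : T *m T = 1%:M)
  (T_mul : m *m (T *t T) = T *m m) (T_unit : T *m u = u).
Hypothesis ST_comm : S *m T = T *m S.

Local Notation p := (kproj S T).
Let p_res : resolution p. Proof. exact: kproj_res. Qed.
Let p_graded a b : m *m (p a *t p b) = p (kadd a b) *m m *m (p a *t p b).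
Proof. exact: kproj_graded. Qed.
Let p_unit x : p x *m u = (x == (false, false))%:R *: u.
Proof. exact: kproj_unit. Qed.

Local Notation M := (m *m twist p).

Fact klein_mulA : M *m (M *t 1%:M) = M *m (1%:M *t M) *m assocmx C n n n.
Proof. by apply: twist_mulA => //; apply: diagmulA. Qed.

Fact klein_mul1l : M *m (u *t 1%:M) *m (lunitmx C n)^T = 1%:M.
Proof. by rewrite -[M *m _]mulmxA twist_unit_l // diagmul1l. Qed.

Fact klein_mul1r : M *m (1%:M *t u) *m (runitmx C n)^T = 1%:M.
Proof. by rewrite -[M *m _]mulmxA twist_unit_r // diagmul1r. Qed.

Fact klein_conj k i j :
  (M k (mxtens_index (i, j)))^* = M k (mxtens_index (j, i)).
Proof.
apply: twist_conj => [k' i' j'|x i' j']; last exact: kproj_conj.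
by rewrite !diagmulE !rmorphM /= !conjC_nat c_real mulrCA.
Qed.

Fact klein_unit_conj k : (u k 0)^* = u k 0.
Proof. by rewrite !mxE fmorphV /= c_real. Qed.

Fact klein_counit i j : (u^t* *m M) 0 (mxtens_index (i, j)) = (i == j)%:R.
Proof. by rewrite mulmxA counit_twist // diagcounit. Qed.

Definition klein_frob : frobenius C :=
  Frobenius klein_mulA klein_mul1l klein_mul1r klein_conj klein_unit_conj
    klein_counit (diagunit_norm c_real c_neq0 c_sq).

Lemma klein_special : M *m M^t* = (c ^+ 2)%:M.
Proof.
have := @twist_mid _ _ p m p_res 1%:M 1%:M.
rewrite tensmx11 !mulmx1 => ->; try by move=> a; rewrite mul1mx mulmx1.
exact: diagmul_special.
Qed.

Variable i0 : 'I_n.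
Hypotheses (S_i0 : S i0 i0 = 0) (T_i0 : T i0 i0 = 0) (ST_i0 : (S *m T) i0 i0 = 0).

(** The witnesses are the components of degrees (1, 0) and (0, 1) of the basis vector at [i0]. In
    the coordinate [i0] their untwisted product is c / 16, and the cocycle multiplies it by -i in
    one order and by i in the other. *)
Lemma klein_noncomm : exists x y : frob_alg klein_frob, x * y <> y * x.
Proof.
pose e : 'cV[C]_n := delta_mx i0 0.
pose a : K := (true, false); pose b : K := (false, true).
exists (p a *m e : 'cV_n), (p b *m e : 'cV_n); rewrite !frob_mulrE /frob_mul /= => xy.
have two : (2 : C) != 0 by rewrite pnatr_eq0.
(* In (1 +- S +- T +- S T) / 4 only the identity contributes to this diagonal entry, because [S],
   [T] and [S T] all move [i0]. *)
have pE x : p x i0 i0 = 4^-1.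
  have -> : p x = 2^-1 *: (2^-1 *: ((1%:M + (-1) ^+ x.2 *: T)
      + (-1) ^+ x.1 *: (S + (-1) ^+ x.2 *: (S *m T)))).
    rewrite /kproj /invproj -scalemxAl -scalemxAr mulmxDl mul1mx -scalemxAl.
    by rewrite mulmxDr mulmx1 -scalemxAr.
  move: (S *m T) ST_i0 => U U0; rewrite !mxE S_i0 T_i0 U0 eqxx !mulr0 !addr0 mulr0.
  by rewrite addr0 mulr1 -invfM -natrM.
have E x y : (M *m ((p x *m e) *t (p y *m e) : 'M_(n * n, 1))) i0 0
    = pauli_cocycle C x y * (c * (4^-1 * 4^-1)).
  have -> : M *m ((p x *m e) *t (p y *m e) : 'M_(n * n, 1))
      = pauli_cocycle C x y *: (m *m ((p x *m e) *t (p y *m e) : 'M_(n * n, 1))).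
    rewrite -mulmxA -(tensmx_mul (p x)) [twist p *m _]mulmxA.
    have -> : twist p *m (p x *t p y) = pauli_cocycle C x y *: (p x *t p y).
      exact: (fcalc_mulP (resolution_tens p_res p_res) _ (x, y)).
    by rewrite -scalemxAl -scalemxAr.
  rewrite mxE; congr (_ * _); rewrite diagmul_mul mxE mxtens_indexK /=.
  rewrite !(ord1 (Ordinal _)).
  have colE z : (p z *m e) i0 0 = 4^-1.
    rewrite mxE -[RHS](pE z) -[RHS](sum_deltar i0 (fun k => p z i0 k)).
    by apply: eq_bigr => k _; rewrite [e _ _]mxE eqxx andbT.
  by rewrite !colE.
have := congr1 (fun z : 'cV_n => z i0 0) xy; rewrite /= !E => /mulIf ab.
have : pauli_cocycle C a b = pauli_cocycle C b a.
  by apply: ab; rewrite !mulf_neq0 ?invr_eq0 ?pnatr_eq0.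
have -> : pauli_cocycle C b a = 'i ^+ 1 by apply: imaginary_expr_mod4.
rewrite -[pauli_cocycle C a b]/('i ^+ 3) exprSr sqrCi mulN1r expr1.
move/eqP; rewrite eq_sym -addr_eq0 -mulr2n -mulr_natr mulf_eq0 (negPf two) orbF.
by rewrite (negPf (neq0Ci C)).
Qed.

End KleinFrobenius.

(** * Permutation matrices of involutions *)

Section InvolutionMatrices.

Variables (C : numClosedFieldType) (V : finType).
Local Notation n := #|V|.
Implicit Types s t : V -> V.

Definition invmat s : 'M[C]_n := \matrix_(i, j) (enum_val i == s (enum_val j))%:R.

Lemma invmat_mul d s (A : 'M[C]_(n, d)) i q : involutive s ->
  (invmat s *m A) i q = A (enum_rank (s (enum_val i))) q.
Proof.
move=> sK; rewrite mxE -[RHS](sum_deltal _ (fun k => A k q)); apply: eq_bigr => k _.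
rewrite mxE -(inj_eq enum_val_inj k) enum_rankK; congr ((nat_of_bool _)%:R * _).
by rewrite eq_sym (canF_eq sK).
Qed.

Lemma mul_invmat d s (A : 'M[C]_(d, n)) i q :
  (A *m invmat s) q i = A q (enum_rank (s (enum_val i))).
Proof.
rewrite mxE -[RHS](sum_deltar _ (fun k => A q k)); apply: eq_bigr => k _.
by rewrite mxE -(inj_eq enum_val_inj k) enum_rankK.
Qed.

Lemma invmat_conj s i j : (invmat s i j)^* = invmat s i j.
Proof. by rewrite mxE conjC_nat. Qed.

Lemma invmat_sym s : involutive s -> (invmat s)^T = invmat s.
Proof.
by move=> sK; apply/matrixP => i j; rewrite !mxE eq_sym (canF_eq sK).
Qed.

Lemma invmat_inv s : involutive s -> invmat s *m invmat s = 1%:M.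
Proof.
move=> sK; apply/matrixP => i j; rewrite mul_invmat !mxE enum_rankK sK.
by rewrite (inj_eq enum_val_inj).
Qed.

Lemma invmat_graded c s : involutive s ->
  diagmul n c *m (invmat s *t invmat s) = invmat s *m diagmul n c.
Proof.
move=> sK; apply/matrixP => k p; case: (mxtens_indexP p) => i j.
rewrite diagmul_mul tensmxE invmat_mul // diagmulE !mxE mulrC -mulrA.
by rewrite -!(inj_eq enum_val_inj _ (enum_rank _)) !enum_rankK
  ![enum_val k == _]eq_sym !(canF_eq sK).
Qed.

Lemma invmat_unit c s : involutive s -> invmat s *m diagunit n c = diagunit n c.
Proof. by move=> sK; apply/matrixP => k z; rewrite invmat_mul // !mxE. Qed.

Lemma invmat_comm s t : involutive s -> (forall v, s (t v) = t (s v)) ->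
  invmat s *m invmat t = invmat t *m invmat s.
Proof.
move=> sK st; apply/matrixP => i j; rewrite !mul_invmat !mxE !enum_rankK.
by rewrite st.
Qed.

End InvolutionMatrices.

Lemma horner_mx_sum (F : fieldType) (n : nat) (A : 'M[F]_n.+1) (q : {poly F}) :
  horner_mx A q = \sum_(i < size q) q`_i *: A ^+ i.
Proof.
rewrite -[in LHS](coefK q) poly_def rmorph_sum; apply: eq_bigr => i _ /=.
by rewrite horner_mxZ rmorphXn /= horner_mx_X.
Qed.

Lemma minpoly_exists (R : realType) (n : nat) (A : 'M[R[i]]_n) :
  (0 < n)%N -> exists p, is_minpoly A p.
Proof.
case: n A => // n A _; exists (mxminpoly A).
have mxevalE q : mxeval q A = horner_mx A q by rewrite horner_mx_sum.
split; [exact: mxminpoly_monic| |move=> q].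
- by rewrite mxevalE mx_root_minpoly.
- by rewrite mxevalE => /mxminpoly_min.
Qed.

(** Stated for arbitrary matrices, so that the regularity equation can be multiplied by [W] without
    looking inside the fifteen triangles. *)
Lemma mulmx_regularity (C : numClosedFieldType) (a b : nat) (W : 'M[C]_a)
    (d q0 q1 q2 q3 l mu k : C) (B B' : 'M[C]_(a, b))
    (x1 x2 x3 x4 x5 x6 x7 x8 x9 x10 x11 x12 x13 x14 x15 : 'M[C]_(a, b))
    (y1 y2 y3 y4 y5 y6 y7 y8 y9 y10 y11 y12 y13 y14 y15 : 'M[C]_(a, b)) :
  B' = W *m B -> y1 = W *m x1 -> y2 = W *m x2 -> y3 = W *m x3 -> y4 = W *m x4 ->
  y5 = W *m x5 -> y6 = W *m x6 -> y7 = W *m x7 -> y8 = W *m x8 -> y9 = W *m x9 ->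
  y10 = W *m x10 -> y11 = W *m x11 -> y12 = W *m x12 -> y13 = W *m x13 ->
  y14 = W *m x14 -> y15 = W *m x15 ->
  d *: B = q3 *: x1 + q2 *: (x2 + x3 + x4) + q1 *: (x5 + x6 + x7) + q0 *: x8
    + l *: (x9 + x10 + x11) + mu *: (x12 + x13 + x14) + k *: x15 ->
  d *: B' = q3 *: y1 + q2 *: (y2 + y3 + y4) + q1 *: (y5 + y6 + y7) + q0 *: y8
    + l *: (y9 + y10 + y11) + mu *: (y12 + y13 + y14) + k *: y15.
Proof.
move=> -> -> -> -> -> -> -> -> -> -> -> -> -> -> -> -> /(congr1 (mulmx W)).
by rewrite !(mulmxDr, =^~ scalemxAr).
Qed.

Lemma sum_delta_sqrt (C : numClosedFieldType) (V : finType) (w : V) :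
  (0 < #|V|)%N ->
  #|V|%:R^-1 * (\sum_v (v == w)%:R * sqrtC #|V|%:R) = (sqrtC #|V|%:R)^-1 :> C.
Proof.
move=> V0; have c0 : sqrtC #|V|%:R != 0 :> C by rewrite sqrtC_eq0 pnatr_eq0 -lt0n.
by rewrite sum_deltal -{1}[#|V|%:R]sqrtCK expr2 invfM -mulrA mulVf // mulr1.
Qed.

(** * Effect of the twist on the graph operators *)

Section TwistedDiagrams.

Variables (C : numClosedFieldType) (n : nat) (p : bool * bool -> 'M[C]_n).
Variables (m : 'M[C]_(n, n * n)) (u : 'M[C]_(n, 1)).
Hypothesis p_res : resolution p.
Hypothesis m_graded : forall a b,
  m *m (p a *t p b) = p (kadd a b) *m m *m (p a *t p b).
Hypothesis u_graded : forall x, p x *m u = (x == (false, false))%:R *: u.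

(** The unit is homogeneous, so [u u^*], and with it the complement, preserves all degrees. *)
Lemma compl_comm (d : C) (A : 'M[C]_n) x : A *m p x = p x *m A ->
  (d *: (u *m u^t*) - 1%:M - A) *m p x = p x *m (d *: (u *m u^t*) - 1%:M - A).
Proof.
have [_ _ h] := p_res.
have up : u^t* *m p x = (x == (false, false))%:R *: u^t*.
  rewrite -[p x]h -adjmxM u_graded linearZ /= map_mxZ.
  by congr (_ *: _); apply: conjC_nat.
move=> Ap; rewrite !mulmxBl !mulmxBr mul1mx mulmx1 Ap -scalemxAl -scalemxAr.
by rewrite -mulmxA up mulmxA u_graded -scalemxAr scalemxAl.
Qed.

Lemma black_twist (A : 'M[C]_n) : (forall x, A *m p x = p x *m A) ->
  (A *t A) *m (m *m twist p)^t* *m A = (twist p)^t* *m ((A *t A) *m m^t* *m A).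
Proof.
by move=> Ap; rewrite adjmxM !mulmxA twist_comm.
Qed.

(** The twist passes [A] and reaches the counit on the first leg, where only degree 0 survives and
    the cocycle is 1. *)
Lemma laplacian_twist (A : 'M[C]_n) : (forall x, A *m p x = p x *m A) ->
  lunitmx C n *m (u^t* *t 1%:M) *m (A *t 1%:M) *m (m *m twist p)^t*
    = lunitmx C n *m (u^t* *t 1%:M) *m (A *t 1%:M) *m m^t*.
Proof.
move=> Ap; rewrite adjmxM !mulmxA -[_ *m (A *t 1%:M) *m _]mulmxA.
rewrite twist_comm // => [|x]; last by rewrite mul1mx mulmx1.
rewrite mulmxA; congr (_ *m _ *m _); rewrite -mulmxA; congr (_ *m _).
have := congr1 (fun M => M^t*) (twist_unit_l p_res u_graded).
by rewrite adjmxM adjmx_tens adjmx1.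
Qed.

End TwistedDiagrams.

(** Taking the adjoint conjugates the real projections, which has no effect, and the Pauli matrices,
    which transposes them because they are self-adjoint. The result is the partial transpose of
    [bendmxE]. *)
Lemma pauli_iso_bend (C : numClosedFieldType) (n : nat) (p : bool * bool -> 'M[C]_n)
    (ev : 'M[C]_(1, n * n)) (coev : 'M[C]_(n * n, 1)) :
    (forall x i j, (p x i j)^* = p x i j) ->
    (forall k l, ev ord0 (mxtens_index (k, l)) = (k == l)%:R) ->
    (forall k l, coev (mxtens_index (k, l)) ord0 = (k == l)%:R) ->
  (pauli_iso p)^t* = bendmx (pauli_iso p) ev coev.
Proof.
move=> p_conj evE coevE; apply/matrixP => q r.
case: (mxtens_indexP q) => b j; case: (mxtens_indexP r) => i a.
rewrite bendmxE // [LHS]mxE [X in X^*]mxE !pauli_isoE rmorph_sum; apply: eq_bigr => x _ /=.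
rewrite rmorphM /= p_conj; congr (_ * _).
by have /matrixP/(_ b a) := pauli_adj C x; rewrite [LHS]mxE [X in X^*]mxE.
Qed.

Lemma diagmul_coev (C : numClosedFieldType) (n : nat) (c : C) k l :
    c^* = c -> c != 0 ->
  ((diagmul n c)^t* *m diagunit n c) (mxtens_index (k, l)) 0 = (k == l)%:R.
Proof.
move=> cc c0; have := congr1 Num.conj (diagcounit cc c0 k l).
rewrite conjC_nat => <-.
by rewrite -[diagunit n c in LHS]trmxCK -adjmxM mxE [X in X^*]mxE.
Qed.

(** * The twist of a classical graph *)

Section KleinQuantumGraph.

Variables (R : realType) (G : sgraph).
Local Notation C := R[i].
Local Notation n := #|G|.
Variables s t : G -> G.
Hypotheses (sK : involutive s) (tK : involutive t) (st : forall v, s (t v) = t (s v)).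
Hypotheses (s_adj : forall v w, adj (s v) (s w) = adj v w)
  (t_adj : forall v w, adj (t v) (t w) = adj v w).

Local Notation X := (cfun_qset R (vertex_gt0 G)).
Local Notation c := (sqrtC (n%:R : C)).
Local Notation S := (invmat C s).
Local Notation T := (invmat C t).
Local Notation p := (kproj S T).

Fact sqrt_card_gt0 : 0 < c.
Proof. by rewrite sqrtC_gt0 ltr0n (vertex_gt0 G). Qed.

Fact sqrt_card_conj : c^* = c.
Proof. by apply: geC0_conj; apply: ltW; apply: sqrt_card_gt0. Qed.

Fact sqrt_card_neq0 : c != 0.
Proof. by rewrite gt_eqF // sqrt_card_gt0. Qed.

Definition klein_alg : frobenius C :=
  klein_frob sqrt_card_conj sqrt_card_neq0 (sqrtCK _)
    (invmat_conj C s) (invmat_sym C sK) (invmat_inv C sK) (invmat_graded c sK)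
    (invmat_unit c sK) (invmat_conj C t) (invmat_sym C tK) (invmat_inv C tK)
    (invmat_graded c tK) (invmat_unit c tK) (invmat_comm C sK st).

Fact klein_alg_special : fmul klein_alg *m (fmul klein_alg)^t* = (c ^+ 2)%:M.
Proof.
exact: (klein_special sqrt_card_conj (invmat_conj C s) (invmat_sym C sK)
  (invmat_inv C sK) (invmat_conj C t) (invmat_sym C tK) (invmat_inv C tK) (invmat_comm C sK st)).
Qed.

Definition klein_qset : qset R := frob_qset sqrt_card_gt0 klein_alg_special.

Lemma mulmat_cfun : mulmat X = diagmul n c.
Proof. by apply/matrixP => k q; rewrite [RHS]mxE; apply: cfun_mulmatE. Qed.

Lemma unitmat_cfun : unitmat X = diagunit n c.
Proof.
apply/matrixP => k z; rewrite mxE [RHS]mxE /qinner mulr1.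
have bE v : (cfun_star (tnth (cfun_basis R (vertex_gt0 G)) k) v : C)
    = (v == enum_val k)%:R * c.
  rewrite ffunE tnth_mktuple ffunE rmorphMn /= sqrt_card_conj.
  by rewrite mulr_natl.
rewrite /= /cfun_state.
under eq_bigr => v _ do rewrite bE.
exact: (sum_delta_sqrt _ _ (vertex_gt0 G)).
Qed.

Local Notation Xq := klein_qset.
Local Notation A := (adjmat R G).

Lemma mulmat_klein : mulmat Xq = diagmul n c *m twist p.
Proof. exact: frob_mulmatE. Qed.

Lemma unitmat_klein : unitmat Xq = diagunit n c.
Proof. exact: frob_unitmatE. Qed.

Lemma adjmat_inv (r : G -> G) : involutive r -> (forall v w, adj (r v) (r w) = adj v w) ->
  A *m invmat C r = invmat C r *m A.
Proof.
move=> rK r_adj; apply/matrixP => i j; rewrite mul_invmat invmat_mul //.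
by rewrite [LHS]mxE [RHS]mxE !enum_rankK -{2}[enum_val j]rK r_adj.
Qed.

Let A_comm x : A *m p x = p x *m A.
Proof. by apply: kproj_comm; apply: adjmat_inv. Qed.

Let I_comm x : 1%:M *m p x = p x *m 1%:M.
Proof. by rewrite mul1mx mulmx1. Qed.

Let p_res : resolution p.
Proof.
apply: kproj_res; [exact: invmat_conj|exact: invmat_sym|exact: invmat_inv|
  exact: invmat_conj|exact: invmat_sym|exact: invmat_inv|exact: invmat_comm].
Qed.

Let p_graded a b : diagmul n c *m (p a *t p b)
  = p (kadd a b) *m diagmul n c *m (p a *t p b).
Proof.
apply: kproj_graded; [exact: invmat_inv|exact: invmat_graded|
  exact: invmat_inv|exact: invmat_graded|exact: invmat_comm].
Qed.

Let p_unit x : p x *m diagunit n c = (x == (false, false))%:R *: diagunit n c.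
Proof. by apply: kproj_unit; apply: invmat_unit. Qed.

Lemma compl_klein : compl_op (X := Xq) A = compl_op (X := X) A.
Proof. by rewrite /compl_op /Jmat unitmat_klein unitmat_cfun. Qed.

Let K_comm x : compl_op (X := X) A *m p x = p x *m compl_op (X := X) A.
Proof.
rewrite /compl_op /Jmat unitmat_cfun; apply: compl_comm => //.
Qed.

Lemma star_prod_klein (B D : 'M[C]_n) :
    (forall x, B *m p x = p x *m B) -> (forall x, D *m p x = p x *m D) ->
  star_prod (X := Xq) B D = star_prod (X := X) B D.
Proof.
move=> Bp Dp; rewrite /star_prod mulmat_klein mulmat_cfun.
by congr (_ *: _); apply: twist_mid.
Qed.

Fact klein_adj_idem : star_prod (X := Xq) A A = A.
Proof. exact: etrans (star_prod_klein A_comm A_comm) (adjmat_idem R G). Qed.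

Definition klein_qgraph : qgraph R := QGraph klein_adj_idem.

Lemma triangle_klein (B D E : 'M[C]_n) :
    (forall x, B *m p x = p x *m B) -> (forall x, D *m p x = p x *m D) ->
    (forall x, E *m p x = p x *m E) ->
  triangle (X := Xq) B D E = (twist p)^t* *m triangle (X := X) B D E.
Proof.
move=> Bp Dp Ep; rewrite /triangle mulmat_klein mulmat_cfun.
exact: triangle_twist.
Qed.

Lemma black_triangle_klein :
  black_triangle (X := Xq) A = (twist p)^t* *m black_triangle (X := X) A.
Proof.
rewrite /black_triangle mulmat_klein mulmat_cfun.
exact: black_twist.
Qed.

Lemma laplacian_klein : laplacian (X := Xq) A = laplacian (X := X) A.
Proof.
rewrite /laplacian mulmat_klein mulmat_cfun unitmat_klein unitmat_cfun.
congr (_ - _); exact: laplacian_twist.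
Qed.

Lemma three_point_klein P : three_point_regular (qgraph_of R G) P ->
  three_point_regular klein_qgraph P.
Proof.
move=> [[irr1 irr2] und reg]; split; [split|exact: und|].
- exact: etrans (star_prod_klein A_comm I_comm) irr1.
- exact: etrans (star_prod_klein I_comm A_comm) irr2.
rewrite [compl_op _]compl_klein.
exact: (mulmx_regularity black_triangle_klein
  (triangle_klein A_comm A_comm A_comm) (triangle_klein K_comm A_comm A_comm)
  (triangle_klein A_comm K_comm A_comm) (triangle_klein A_comm A_comm K_comm)
  (triangle_klein K_comm K_comm A_comm) (triangle_klein K_comm A_comm K_comm)
  (triangle_klein A_comm K_comm K_comm) (triangle_klein K_comm K_comm K_comm)
  (triangle_klein A_comm A_comm I_comm) (triangle_klein A_comm I_comm A_comm)
  (triangle_klein I_comm A_comm A_comm) (triangle_klein K_comm K_comm I_comm)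
  (triangle_klein K_comm I_comm K_comm) (triangle_klein I_comm K_comm K_comm)
  (triangle_klein I_comm I_comm I_comm) reg).
Qed.

Let bend : (pauli_iso p)^t* = qiso_bend (X := X) (Y := Xq) (pauli_iso p).
Proof.
apply: (@pauli_iso_bend C n p (qev Xq) (qcoev X)) => [x i j|k l|k l].
- by apply: kproj_conj => i' j'; apply: invmat_conj.
- by have := fcounit (f := klein_alg) k l; rewrite /qev unitmat_klein mulmat_klein.
- rewrite /qcoev mulmat_cfun unitmat_cfun.
  exact: diagmul_coev sqrt_card_conj sqrt_card_neq0.
Qed.

Lemma qgraph_iso_klein : qgraph_iso (qgraph_of R G) klein_qgraph.
Proof.
exists 2%N, (pauli_iso p); split=> //; last exact: pauli_iso_comm.
rewrite /is_qiso mulmat_klein unitmat_klein mulmat_cfun unitmat_cfun; split.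
- exact: pauli_iso_comul.
- exact: pauli_iso_counit.
- exact: bend.
- exact: pauli_iso_mul.
- exact: pauli_iso_unit.
Qed.

Variable v0 : G.
Hypotheses (s_v0 : s v0 != v0) (t_v0 : t v0 != v0) (st_v0 : s v0 != t v0).

(** For involutions, [s v0 != t v0] means that the composite moves [v0] too, so its orbit has four
    elements. *)
Lemma noncommutative_klein : noncommutative klein_qgraph.
Proof.
apply: (@klein_noncomm C n c sqrt_card_conj sqrt_card_neq0 (sqrtCK _) S T
  (invmat_conj C s) (invmat_sym C sK) (invmat_inv C sK) (invmat_graded c sK)
  (invmat_unit c sK) (invmat_conj C t) (invmat_sym C tK) (invmat_inv C tK)
  (invmat_graded c tK) (invmat_unit c tK) (invmat_comm C sK st) (enum_rank v0)).
- by rewrite mxE enum_rankK eq_sym (negPf s_v0).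
- by rewrite mxE enum_rankK eq_sym (negPf t_v0).
- by rewrite invmat_mul // mxE !enum_rankK (negPf st_v0).
Qed.

Theorem klein_quantum_graph :
    connected_qgraph (qgraph_of R G) ->
    (exists P, three_point_regular (qgraph_of R G) P) ->
  exists Gq : qgraph R,
    noncommutative Gq
    /\ connected_qgraph Gq
    /\ ((exists p, three_point_regular (qgraph_of R G) p) /\
        forall p, three_point_regular (qgraph_of R G) p -> three_point_regular Gq p)
    /\ same_spectrum (laplacian (qadj Gq)) (laplacian (qadj (qgraph_of R G)))
    /\ same_minpoly (qadj Gq) (qadj (qgraph_of R G))
    /\ qgraph_iso (qgraph_of R G) Gq.
Proof.
move=> conn reg; exists klein_qgraph; split; first exact: noncommutative_klein.
have lap : laplacian (X := Xq) A = laplacian (X := X) A := laplacian_klein.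
split; first by rewrite /connected_qgraph /num_components [laplacian _]lap.
split; first by split; [exact: reg | exact: three_point_klein].
split; first by move=> a; rewrite [laplacian (qadj klein_qgraph)]lap.
split; last exact: qgraph_iso_klein.
have [P minP] := minpoly_exists A (vertex_gt0 G).
by exists P.
Qed.

End KleinQuantumGraph.

(** * Three-point regularity of classical graphs *)

Section StronglyRegular.

Variable G : sgraph.
Implicit Types x y z c : G.

Definition triple_count x y z : nat := #|[set w | [&& adj x w, adj y w & adj z w]]|.

Lemma triple_countC x y z : triple_count x y z = triple_count y x z.
Proof. by apply: eq_card => w; rewrite !inE andbCA. Qed.

Lemma triple_countAC x y z : triple_count x y z = triple_count x z y.
Proof. by apply: eq_card => w; rewrite !inE andbA [RHS]andbA andbAC. Qed.

Lemma triple_countE x y z :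
  triple_count x y z = (\sum_(c in common_neighbours x y) adj z c)%N.
Proof.
rewrite /triple_count -sum1_card big_mkcond [RHS]big_mkcond; apply: eq_bigr => w _.
by rewrite !inE; do 3 case: (adj _ _).
Qed.

Variables n k mu q : nat.
Hypothesis srg : strongly_regular G n k 0 mu.

Lemma triangle_free x y z : adj x y -> adj x z -> ~~ adj y z.
Proof.
move=> xy xz; apply/negP => yz; have [_ _ /(_ _ _ xy) /eqP + _] := srg.
by rewrite cards_eq0 => /eqP/setP/(_ z); rewrite !inE xz yz.
Qed.

(** Counts the pairs of a common neighbour of [x], [y] and a neighbour [z] of it. *)
Lemma sum_triple_count x y : x != y -> ~~ adj x y ->
  (\sum_z triple_count x y z = mu * k)%N.
Proof.
move=> xy nxy; have [_ deg _ /(_ _ _ xy nxy) <-] := srg.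
under eq_bigr => z _ do rewrite triple_countE.
rewrite exchange_big -sum_nat_const; apply: eq_bigr => c _ /=.
rewrite -(deg c) -sum1_card [RHS]big_mkcond; apply: eq_bigr => z _.
by rewrite !inE adj_sym; case: adj.
Qed.

(** Counts triples of [z] and two of its neighbours c, c' that are common neighbours of [x] and [y].
    Equal c, c' give the degree [k]; distinct ones are non-adjacent for want of triangles and give
    [mu]. *)
Lemma sum_sqr_triple_count x y : x != y -> ~~ adj x y ->
  (\sum_z triple_count x y z ^ 2 = mu * (k + (mu.-1) * mu))%N.
Proof.
move=> xy nxy; have [_ deg _ nadj] := srg.
have cnt c c' : (\sum_z adj z c * adj z c' = #|common_neighbours c c'|)%N.
  rewrite -sum1_card [RHS]big_mkcond; apply: eq_bigr => z _.
  by rewrite !inE adj_sym [adj z c']adj_sym; do 2 case: adj.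
transitivity (\sum_(c in common_neighbours x y) \sum_(c' in common_neighbours x y)
    #|common_neighbours c c'|)%N.
  under eq_bigr => z _ do rewrite triple_countE -mulnn big_distrlr /=.
  rewrite exchange_big; apply: eq_bigr => c _ /=.
  by rewrite exchange_big; apply: eq_bigr => c' _; rewrite cnt.
have cxy : #|common_neighbours x y| = mu by exact: nadj.
rewrite -[in RHS]cxy -sum_nat_const; apply: eq_bigr => c cC.
rewrite (bigD1 c) //=; congr (_ + _)%N.
  by rewrite -[RHS](deg c); apply: eq_card => z; rewrite !inE andbb.
rewrite cxy (eq_bigr (fun=> mu)) => [|c' /andP[c'C cc']].
  rewrite sum_nat_const; congr (_ * _)%N.
  rewrite -cxy [in RHS](cardD1 c) cC add1n /=; apply: eq_card => z.
  by rewrite [LHS]unfold_in !inE andbC.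
apply: nadj; first by rewrite eq_sym.
by move: cC c'C; rewrite !inE => /andP[xc _] /andP[xc' _]; apply: triangle_free xc xc'.
Qed.

(* n + mu - 2 - 2k counts the vertices neither equal nor adjacent to x or y; n_eq
   says that it is not truncated. *)
Hypothesis n_eq : (n + mu = 2 + 2 * k + (n + mu - 2 - 2 * k))%N.
(* The sum of (triple_count x y z - q)^2 over these vertices z is 0, with the
   negative terms moved to the right. *)
Hypothesis var0 : (mu * (k + mu.-1 * mu) + q ^ 2 * (n + mu - 2 - 2 * k)
  = 2 * mu ^ 2 + 2 * q * (mu * k - 2 * mu))%N.
Hypothesis k2 : (2 <= k)%N.

Lemma triple_count_const x y z : x != y -> ~~ adj x y ->
  z != x -> z != y -> ~~ adj x z -> ~~ adj y z -> triple_count x y z = q.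
Proof.
move=> xy nxy zx zy nxz nyz.
have [cardG deg _ nadj] := srg.
pose a := triple_count x y.
pose Z := [set z | [&& z != x, z != y, ~~ adj x z & ~~ adj y z]].
have ax : a x = mu.
  rewrite -(nadj _ _ xy nxy); apply: eq_card => w; rewrite !inE.
  by do 2 case: adj.
have ay : a y = mu.
  rewrite -(nadj _ _ xy nxy); apply: eq_card => w; rewrite !inE.
  by do 2 case: adj.
have a0 w : w != x -> w != y -> w \notin Z -> a w = 0%N.
  rewrite !inE => -> -> /=; rewrite negb_and !negbK => /orP[] h; apply/eqP;
    rewrite cards_eq0; apply/eqP/setP => c; rewrite !inE; apply/negP => /and3P[xc yc wc].
    by have := triangle_free h xc; rewrite wc.
  by have := triangle_free h yc; rewrite wc.
(* The vertices [x] and [y] contribute [f mu] each, and their neighbours [f 0 = 0] because there are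
   no triangles; what remains is the sum over [Z]. *)
have split_sum (f : nat -> nat) : f 0%N = 0%N ->
    (\sum_w f (a w) = f mu + f mu + \sum_(w in Z) f (a w))%N.
  move=> f0; rewrite (bigD1 x) // (bigD1 y) /=; last by rewrite eq_sym.
  rewrite ax ay addnA.
  congr (_ + _)%N; rewrite big_mkcond [RHS]big_mkcond; apply: eq_bigr => w _.
  case: ifP => [/andP[wx wy]|].
    by case: ifP => // /negbT wZ; rewrite a0.
  by rewrite !inE; case: eqP; case: eqP.
have s1 := split_sum id erefl; rewrite sum_triple_count // in s1.
have s2 := split_sum (fun i => i ^ 2)%N erefl; rewrite sum_sqr_triple_count // in s2.
have cZ : #|Z| = (n + mu - 2 - 2 * k)%N.
  have cU : #|[set w | adj x w] :|: [set w | adj y w]| = (2 * k - mu)%N.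
    rewrite cardsU !deg -(nadj _ _ xy nxy) mul2n -addnn; congr (_ - _)%N.
    by apply: eq_card => w; rewrite !inE.
  have muk : (mu <= k)%N.
    have sub : common_neighbours x y \subset [set w | adj x w].
      by apply/subsetP => w; rewrite !inE => /andP[].
    by have := subset_leq_card sub; rewrite nadj // deg.
  have cxy : #|[set x; y] :|: ([set w | adj x w] :|: [set w | adj y w])| = (2 + (2 * k - mu))%N.
    rewrite cardsU cards2 xy cU (_ : _ :&: _ = set0) ?cards0 ?subn0 //.
    apply/setP => w; rewrite !inE; apply/negP => /andP[/orP[]/eqP->];
      by rewrite !adj_irrefl ?(negPf nxy) 1?adj_sym ?(negPf nxy).
  have := cardsC ([set x; y] :|: ([set w | adj x w] :|: [set w | adj y w])).
  rewrite cxy cardG (_ : ~: _ = Z); last first.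
    by apply/setP => w; rewrite !inE !negb_or -!andbA.
  by move: muk n_eq; lia.
(* By [var0] the two sides have the same sum over [Z], so equality holds in every term. *)
have le w : w \in Z -> (2 * (a w * q) <= a w ^ 2 + q ^ 2 ?= iff (a w == q))%N.
  by move=> _; apply: nat_Cauchy.
have [_] := leqif_sum le.
have -> : (\sum_(w in Z) 2 * (a w * q) = \sum_(w in Z) (a w ^ 2 + q ^ 2))%N.
  rewrite -big_distrr -big_distrl big_split sum_nat_const cZ /=.
  by move: s1 s2 var0; nia.
rewrite eqxx => /esym/forallP/(_ z); rewrite !inE zx zy nxz nyz /=.
by move/eqP.
Qed.

End StronglyRegular.

(** * Classical diagrams in coordinates *)

Section DiagonalDiagrams.

Variables (C : numClosedFieldType) (n : nat) (c : C).
Hypotheses (c_real : c^* = c) (c_neq0 : c != 0).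
Local Notation m := (diagmul n c).
Local Notation u := (diagunit n c).

(** A diagonal multiplication identifies its three indices and contributes a factor [c]. Three of
    them leave one entry for each side of the triangle on i, j, k. *)
Lemma diag_triangleE (A B D : 'M[C]_n) i j k :
  trianglemx m A B D (mxtens_index (i, j)) k = c ^+ 3 * (A i k * B j k * D j i).
Proof.
have sum_m f : \sum_p m j p * f p = c * f (mxtens_index (j, j)).
  by rewrite sum_mxtens; apply: (sum_diagmul c j (fun i j => f (mxtens_index (i, j)))).
have tens1_mul (Z : 'M[C]_(n * (n * n), n * n)) q :
    (((1%:M : 'M_n) *t m) *m Z) (mxtens_index (i, j)) q
      = c * Z (mxtens_index (i, mxtens_index (j, j))) q.
  rewrite -(sum_m (fun p => Z (mxtens_index (i, p)) q)) mxE sum_mxtens.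
  rewrite -[RHS](sum_deltal i (fun i' => \sum_p m j p * Z (mxtens_index (i', p)) q)).
  apply: eq_bigr => i' _; rewrite mulr_sumr; apply: eq_bigr => p _.
  by rewrite tensmxE mxE eq_sym mulrA.
rewrite /trianglemx mul_diagmul_adj // exprS -mulrA; congr (_ * _).
rewrite -!mulmxA tens1_mul expr2 -mulrA; congr (_ * _).
rewrite mul_assocmx tensmx1_mul sum_mxtens.
rewrite -[RHS](sum_deltal i (fun i' => c * (A i' k * B j k * D j i'))).
apply: eq_bigr => i' _; rewrite -[RHS](sum_deltal i'
  (fun j' => (i' == i)%:R * (c * (A i' k * B j k * D j j')))).
apply: eq_bigr => j' _; rewrite tensmxE [1%:M _ _]mxE tensmx1_mul.
have -> : \sum_w (m^t*) (mxtens_index (i', j')) w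
    * (A *t B) (mxtens_index (w, j)) (mxtens_index (k, k))
    = (j' == i')%:R * (c * (A i' k * B j k)).
  rewrite -[RHS](sum_deltal i' (fun w => (j' == w)%:R * (c * (A w k * B j k)))).
  by apply: eq_bigr => w _; rewrite diagmul_adjE // tensmxE [w == _]eq_sym -!mulrA.
rewrite [i == i']eq_sym; ring.
Qed.

Lemma diag_blackE (A : 'M[C]_n) i j k :
  ((A *t A) *m m^t* *m A) (mxtens_index (i, j)) k = c * \sum_l A i l * A j l * A l k.
Proof.
rewrite mxE mulr_sumr; apply: eq_bigr => l _.
by rewrite mul_diagmul_adj // tensmxE -!mulrA.
Qed.

Lemma diag_JE i j : (c ^+ 2 *: (u *m u^t*)) i j = 1.
Proof.
rewrite mxE mxE big_ord1 !mxE fmorphV /= c_real -invfM -expr2 divff //.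
by rewrite expf_neq0.
Qed.

Lemma diag_laplacianE (A : 'M[C]_n) i j :
  (lunitmx C n *m (u^t* *t 1%:M) *m (A *t 1%:M) *m m^t*) i j
    = (i == j)%:R * \sum_k A k j.
Proof.
rewrite mul_diagmul_adj // -mulmxA tensmx_mul mulmx1 lunitmx_mul tensmxE [1%:M _ _]mxE.
rewrite mulrA mulrC; congr (_ * _); rewrite mxE mulr_sumr; apply: eq_bigr => k _.
by rewrite !mxE fmorphV /= c_real mulrA divff // mul1r.
Qed.

(** The factor c^2 on the left and the single [c] of [diag_blackE] match the c^3 of every triangle,
    which leaves an equation between entries. *)
Lemma diag_regular (T : 'M[C]_n) (q0 q1 q2 q3 l mu d : C) :
  let I := 1%:M : 'M[C]_n in
  let K : 'M[C]_n := c ^+ 2 *: (u *m u^t*) - I - T in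
  (forall i j k, \sum_h T i h * T j h * T h k
    = q3 * (T i k * T j k * T j i)
    + q2 * ((K i k * T j k * T j i) + (T i k * K j k * T j i) + (T i k * T j k * K j i))
    + q1 * ((K i k * K j k * T j i) + (K i k * T j k * K j i) + (T i k * K j k * K j i))
    + q0 * (K i k * K j k * K j i)
    + l * ((T i k * T j k * I j i) + (T i k * I j k * T j i) + (I i k * T j k * T j i))
    + mu * ((K i k * K j k * I j i) + (K i k * I j k * K j i) + (I i k * K j k * K j i))
    + d * (I i k * I j k * I j i)) ->
  c ^+ 2 *: ((T *t T) *m m^t* *m T)
    = q3 *: trianglemx m T T T
    + q2 *: (trianglemx m K T T + trianglemx m T K T + trianglemx m T T K)
    + q1 *: (trianglemx m K K T + trianglemx m K T K + trianglemx m T K K)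
    + q0 *: trianglemx m K K K
    + l *: (trianglemx m T T I + trianglemx m T I T + trianglemx m I T T)
    + mu *: (trianglemx m K K I + trianglemx m K I K + trianglemx m I K K)
    + d *: trianglemx m I I I.
Proof.
move=> I K reg; apply/matrixP => p k; case: (mxtens_indexP p) => i j.
have Zr (x : C) (Y : 'M[C]_(n * n, n)) p' k' : (x *: Y) p' k' = x * Y p' k' by rewrite mxE.
have Dr (Y Y' : 'M[C]_(n * n, n)) p' k' : (Y + Y') p' k' = Y p' k' + Y' p' k' by rewrite mxE.
rewrite !(Zr, Dr) diag_blackE reg !diag_triangleE; ring.
Qed.

End DiagonalDiagrams.

Section AdjacencyCounts.

Variables (C : numClosedFieldType) (G : sgraph) (c : C).
Hypotheses (c_real : c^* = c) (c_neq0 : c != 0).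
Variables q0 q1 q2 q3 l mu d : nat.
Hypotheses (count_eq : forall x : G, triple_count x x x = d)
  (count_adj : forall x y : G, adj x y -> triple_count x x y = l)
  (count_nadj : forall x y : G, x != y -> ~~ adj x y -> triple_count x x y = mu)
  (count_neq : forall x y z : G, x != y -> y != z -> x != z ->
     triple_count x y z = nth 0%N [:: q0; q1; q2; q3] (adj x y + adj y z + adj x z)%N).

Let A : 'M[C]_#|G| := \matrix_(i, j) (adj (enum_val i : G) (enum_val j))%:R.
Let I : 'M[C]_#|G| := 1%:M.
Let K : 'M[C]_#|G| := c ^+ 2 *: (diagunit #|G| c *m (diagunit #|G| c)^t*) - I - A.

Let KE i j : K i j = 1 - (i == j)%:R - (adj (enum_val i : G) (enum_val j))%:R.
Proof.
have subE (Y Z : 'M[C]_#|G|) : (Y - Z) i j = Y i j - Z i j by rewrite !mxE.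
by rewrite !subE diag_JE // [I _ _]mxE [A _ _]mxE.
Qed.

Lemma card_sum_enum_val (W : {set G}) :
  #|W|%:R = \sum_(h < #|G|) (enum_val h \in W)%:R :> C.
Proof.
rewrite -sum1_card natr_sum big_mkcond /=.
transitivity (\sum_(x in G) (x \in W)%:R : C).
  by apply: eq_big => // x _; case: (x \in W).
exact: big_enum_val.
Qed.

Lemma sum_adj_count i j k :
  \sum_h A i h * A j h * A h k
    = (triple_count (enum_val i : G) (enum_val j) (enum_val k))%:R.
Proof.
rewrite card_sum_enum_val; apply: eq_bigr => h _.
rewrite !mxE inE [adj (enum_val h) _]adj_sym.
by do 3 case: (adj _ _); rewrite ?mulr1 ?mulr0 ?mul0r.
Qed.

(** [A], [K] and [I] are the indicators of being adjacent, being distinct and non-adjacent, and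
    being equal. For each triple of vertices exactly one of the fifteen products is 1, the one
    describing the triple. *)
Lemma adj_count_regular i j k : \sum_h A i h * A j h * A h k
    = q3%:R * (A i k * A j k * A j i)
    + q2%:R * ((K i k * A j k * A j i) + (A i k * K j k * A j i) + (A i k * A j k * K j i))
    + q1%:R * ((K i k * K j k * A j i) + (K i k * A j k * K j i) + (A i k * K j k * K j i))
    + q0%:R * (K i k * K j k * K j i)
    + l%:R * ((A i k * A j k * I j i) + (A i k * I j k * A j i) + (I i k * A j k * A j i))
    + mu%:R * ((K i k * K j k * I j i) + (K i k * I j k * K j i) + (I i k * K j k * K j i))
    + d%:R * (I i k * I j k * I j i).
Proof.
rewrite sum_adj_count !KE /I /A !mxE.
rewrite -!(inj_eq enum_val_inj _ k) -(inj_eq enum_val_inj j i).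
move: (enum_val i) (enum_val j) (enum_val k) => x y z.
have [->|xy] := eqVneq y x.
  rewrite !adj_irrefl; have [->|xz] := eqVneq x z.
    by rewrite count_eq !adj_irrefl /=; ring.
  have [axz|nxz] := boolP (adj x z); first by rewrite (count_adj axz) /=; ring.
  by rewrite (count_nadj xz nxz) /=; ring.
have [xz|xz] := eqVneq x z.
  rewrite xz in xy *; rewrite triple_countAC [adj y z]adj_sym !adj_irrefl (negPf xy).
  have zy : z != y by rewrite eq_sym.
  have [azy|nzy] := boolP (adj z y); first by rewrite (count_adj azy) /=; ring.
  by rewrite (count_nadj zy nzy) /=; ring.
have [->|yz] := eqVneq y z.
  have zx : z != x by rewrite eq_sym.
  rewrite triple_countC triple_countAC [adj x z]adj_sym !adj_irrefl.
  have [azx|nzx] := boolP (adj z x); first by rewrite (count_adj azx) /=; ring.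
  by rewrite (count_nadj zx nzx) /=; ring.
rewrite (count_neq _ yz xz) ?[x == y]eq_sym // [adj y x]adj_sym.
by do 3 case: (adj _ _) => /=; ring.
Qed.

End AdjacencyCounts.

Section ClassicalRegularity.

Variables (R : realType) (G : sgraph).
Local Notation C := R[i].
Local Notation X := (cfun_qset R (vertex_gt0 G)).
Local Notation A := (adjmat R G).
Local Notation c := (sqrtC (#|G|%:R : C)).

Lemma adjmat_sym : A^T = A.
Proof. by apply/matrixP => i j; rewrite !mxE adj_sym. Qed.

Lemma adjmat_irreflexive : irreflexive_op (X := X) A.
Proof.
split; apply: etrans (cfun_star_prod _ _ _) _; apply/matrixP => i j; rewrite !mxE.
  by case: eqP => [->|_]; rewrite ?mulr0 // adj_irrefl mul0r.
by case: eqP => [->|_]; rewrite ?mul0r // adj_irrefl mulr0.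
Qed.

Lemma adjmat_undirected : undirected_op (X := X) A.
Proof.
rewrite /undirected_op adjmat_sym; apply/matrixP => i j.
by rewrite !mxE conjC_nat.
Qed.

Lemma three_point_regular_count (q0 q1 q2 q3 l mu d : nat) :
    (forall x : G, triple_count x x x = d) ->
    (forall x y : G, adj x y -> triple_count x x y = l) ->
    (forall x y : G, x != y -> ~~ adj x y -> triple_count x x y = mu) ->
    (forall x y z : G, x != y -> y != z -> x != z ->
      triple_count x y z = nth 0%N [:: q0; q1; q2; q3] (adj x y + adj y z + adj x z)%N) ->
  exists P, three_point_regular (qgraph_of R G) P.
Proof.
move=> Hd Hl Hmu Hq.
exists (RegularityParams q0%:R q1%:R q2%:R q3%:R l%:R mu%:R d%:R).
split; [exact: adjmat_irreflexive|exact: adjmat_undirected|].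
rewrite /black_triangle /triangle /compl_op /Jmat mulmat_cfun unitmat_cfun.
exact (diag_regular (sqrt_card_conj R G)
  (adj_count_regular (sqrt_card_conj R G) (sqrt_card_neq0 R G) Hd Hl Hmu Hq)).
Qed.

Lemma laplacian_cfunE :
  laplacian (X := X) A
    = lunitmx C #|G| *m ((diagunit #|G| c)^t* *t 1%:M) *m (A *t 1%:M) *m (diagmul #|G| c)^t* - A.
Proof. by rewrite /laplacian unitmat_cfun mulmat_cfun. Qed.

End ClassicalRegularity.

(** * Connectivity of strongly regular graphs *)

Section Connectivity.

Variables (C : numClosedFieldType) (G : sgraph) (n k l mu : nat).
Hypothesis srg : strongly_regular G n k l mu.
(** The difference of the two sides is the coefficient [ka] in [srg_kernel]. By the identity k (k -
    l - 1) = (n - k - 1) mu it equals n mu. *)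
Hypothesis kappa : (k + l * k < k * k + mu + mu * k)%N.

Let A : 'M[C]_#|G| := \matrix_(i, j) (adj (enum_val i : G) (enum_val j))%:R.
Local Notation J := (const_mx 1 : 'M[C]_#|G|).

Lemma srg_deg j : \sum_i A i j = k%:R.
Proof.
have [_ deg _ _] := srg.
rewrite -(deg (enum_val j)) card_sum_enum_val.
by apply: eq_bigr => h _; rewrite mxE inE adj_sym.
Qed.

Lemma srg_sqr : A *m A = k%:R%:M + l%:R *: A + mu%:R *: (J - 1%:M - A).
Proof.
have [_ deg cadj nadj] := srg.
apply/matrixP => i j.
have -> : (A *m A) i j = #|common_neighbours (enum_val i : G) (enum_val j)|%:R.
  rewrite mxE card_sum_enum_val; apply: eq_bigr => h _; rewrite !mxE inE [adj (enum_val j) _]adj_sym.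
  by do 2 case: adj; rewrite ?mulr1 ?mulr0 ?mul0r.
rewrite !mxE; have [->|ij] := eqVneq i j.
  rewrite adj_irrefl (_ : #|_| = k) /=; first by ring.
  by rewrite -(deg (enum_val j)); apply: eq_card => h; rewrite !inE andbb.
have [aij|nij] := boolP (adj _ _); first by rewrite cadj //=; ring.
by rewrite nadj ?(inj_eq enum_val_inj) //=; ring.
Qed.

Lemma srg_laplacian (c : C) : c^* = c -> c != 0 ->
  lunitmx C #|G| *m ((diagunit #|G| c)^t* *t 1%:M) *m (A *t 1%:M) *m (diagmul #|G| c)^t*
    = k%:R%:M.
Proof.
move=> cc c0; apply/matrixP => i j; rewrite diag_laplacianE // srg_deg mxE.
by rewrite mulr_natl.
Qed.

Let L : 'M[C]_#|G| := k%:R%:M - A.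

(** If v A = k v, then applying [v] to the quadratic equation of [A] expresses [ka] times [v] as a
    multiple of v J, which is constant. *)
Lemma srg_kernel (v : 'rV[C]_#|G|) : v *m L = 0 -> exists a, v = a *: const_mx 1.
Proof.
rewrite /L mulmxBr mul_mx_scalar => /eqP; rewrite subr_eq0 eq_sym => /eqP vA.
pose s := \sum_i v 0 i.
have vJ : v *m J = s *: const_mx 1.
  by apply/rowP => i; rewrite !mxE mulr1; apply: eq_bigr => h _; rewrite !mxE mulr1.
have := congr1 (mulmx v) srg_sqr.
rewrite mulmxA vA -scalemxAl vA !mulmxDr mul_mx_scalar -!scalemxAr !mulmxBr vA vJ mulmx1.
clear vJ; clearbody s; move=> E.
pose ka : C := k%:R * k%:R + mu%:R + mu%:R * k%:R - k%:R - l%:R * k%:R.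
have ka0 : ka != 0.
  have -> : ka = (k * k + mu + mu * k - (k + l * k))%N%:R.
    by rewrite natrB ?(ltnW kappa) // !natrD !natrM /ka; ring.
  by rewrite pnatr_eq0 subn_eq0 -ltnNge.
exists (mu%:R * s / ka); apply/rowP => i; move/rowP/(_ i): E; rewrite !mxE => E.
apply: (mulfI ka0); rewrite mulr1 mulrCA divff // mulr1 /ka.
apply/eqP; rewrite -subr_eq0; apply/eqP.
transitivity (k%:R * (k%:R * v 0 i) - (k%:R * v 0 i + l%:R * (k%:R * v 0 i)
   + mu%:R * (s * 1 - v 0 i - k%:R * v 0 i))); first by ring.
by rewrite E subrr.
Qed.

Lemma srg_rank : (0 < #|G|)%N -> \rank (kermx L) = 1%N.
Proof.
move=> G0; have one0 : (const_mx 1 : 'rV[C]_#|G|) != 0.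
  case/card_gt0P: G0 => x _; apply/eqP => /rowP/(_ (enum_rank x)); rewrite !mxE.
  by apply/eqP; rewrite oner_eq0.
have oneL : (const_mx 1 : 'rV[C]_#|G|) *m L = 0.
  rewrite /L mulmxBr mul_mx_scalar; apply/rowP => j; rewrite !mxE.
  under eq_bigr => i _ do rewrite [const_mx 1 _ _]mxE mul1r.
  by rewrite srg_deg mulr1 subrr.
apply/eqP; rewrite eqn_leq; apply/andP; split.
  suff sub : (kermx L <= (const_mx 1 : 'rV[C]_#|G|))%MS.
    by apply: leq_trans (mxrankS sub) _; apply: rank_leq_row.
  apply/row_subP => i.
  have [a ->] : exists a, row i (kermx L) = a *: const_mx 1.
    by apply: srg_kernel; rewrite -row_mul mulmx_ker row0.
  exact: scalemx_sub.
have sub : ((const_mx 1 : 'rV[C]_#|G|) <= kermx L)%MS by apply/sub_kermxP.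
by apply: leq_trans (mxrankS sub); rewrite lt0n mxrank_eq0.
Qed.

End Connectivity.

Lemma srg_connected (R : realType) (G : sgraph) (n k l mu : nat) :
    strongly_regular G n k l mu -> (k + l * k < k * k + mu + mu * k)%N ->
  connected_qgraph (qgraph_of R G).
Proof.
move=> srg kappa; rewrite /connected_qgraph /num_components.
have -> : laplacian (qadj (qgraph_of R G)) = k%:R%:M - adjmat R G.
  apply: etrans (laplacian_cfunE R G) _; congr (_ - _).
  exact: (srg_laplacian srg (sqrt_card_conj R G) (sqrt_card_neq0 R G)).
have -> : (k%:R%:M - adjmat R G)^T = k%:R%:M - adjmat R G.
  by rewrite linearB /= tr_scalar_mx adjmat_sym.
exact: (srg_rank R[i] srg kappa (vertex_gt0 G)).
Qed.

Lemma triple_count_diag (G : sgraph) (n k l mu : nat) (x y : G) :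
  strongly_regular G n k l mu ->
  [/\ triple_count x x x = k, adj x y -> triple_count x x y = l
    & x != y -> ~~ adj x y -> triple_count x x y = mu].
Proof.
move=> [_ deg cadj nadj]; split=> [|axy|xy nxy].
- by rewrite -(deg x); apply: eq_card => w; rewrite !inE !andbb.
- by rewrite -(cadj _ _ axy); apply: eq_card => w; rewrite !inE andbA andbb.
- by rewrite -(nadj _ _ xy nxy); apply: eq_card => w; rewrite !inE andbA andbb.
Qed.

Lemma triangle_free_regular (R : realType) (G : sgraph) (n k mu q : nat) :
    strongly_regular G n k 0 mu ->
    (n + mu = 2 + 2 * k + (n + mu - 2 - 2 * k))%N ->
    (mu * (k + mu.-1 * mu) + q ^ 2 * (n + mu - 2 - 2 * k)
      = 2 * mu ^ 2 + 2 * q * (mu * k - 2 * mu))%N ->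
    (2 <= k)%N ->
  exists P, three_point_regular (qgraph_of R G) P.
Proof.
move=> srg n_eq var0 k2.
have c0 (x y z : G) : adj x y -> triple_count x y z = 0%N.
  move=> xy; apply/eqP; rewrite cards_eq0; apply/eqP/setP => w; rewrite !inE.
  apply/negP => /and3P[xw yw _].
  by have := triangle_free srg xy xw; rewrite yw.
apply: (@three_point_regular_count R G q 0 0 0 0 mu k).
- by move=> x; have [] := triple_count_diag x x srg.
- by move=> x y; have [] := triple_count_diag x y srg.
- by move=> x y; have [] := triple_count_diag x y srg.
move=> x y z xy yz xz.
have [axy|nxy] := boolP (adj x y).
  by rewrite c0 //; do 2 case: adj.
have [ayz|nyz] := boolP (adj y z).
  by rewrite triple_countC triple_countAC c0 //; case: adj.
have [axz|nxz] := boolP (adj x z); first by rewrite triple_countAC c0.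
by apply: (triple_count_const srg n_eq var0 k2 xy nxy _ _ nxz nyz); rewrite eq_sym.
Qed.

(** Moves a cardinality from a type of row vectors to an explicit list of codes, where it can be
    computed. *)
Lemma card_count (V : finType) (T : eqType) (enc : V -> T) (r : seq T) (Q : pred T) :
    injective enc -> uniq r -> (forall v, enc v \in r) -> size r = #|V| ->
  #|[set v | Q (enc v)]| = count Q r.
Proof.
move=> enc_inj r_uniq enc_r sz.
have perm : perm_eq [seq enc v | v <- enum V] r.
  have u : uniq [seq enc v | v <- enum V] by rewrite map_inj_uniq ?enum_uniq.
  have sub : {subset [seq enc v | v <- enum V] <= r} by move=> _ /mapP[v _ ->].
  have le : (size r <= size [seq enc v | v <- enum V])%N by rewrite size_map -cardE sz.
  by have [_ eqm] := uniq_min_size u sub le; apply: uniq_perm.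
rewrite -(permP perm Q) count_map cardE [in LHS]/enum_mem size_filter enumT.
by apply: eq_count => v; rewrite !inE.
Qed.

(** * The 9-Paley graph *)

Section Paley.

Local Notation V := 'rV['Z_3]_2.

Definition paley_code (x : V) : nat * nat := (val (x 0 0), val (x 0 1)).
Definition paley_codes : seq (nat * nat) := [seq (a, b) | a <- iota 0 3, b <- iota 0 3].
(** Over Z_3 every non-zero element is 1 or -1, so adjacent means equal in exactly one coordinate:
    9P is the 3 by 3 rook graph. *)
Definition paley_code_adj (x y : nat * nat) : bool := (x.1 == y.1) (+) (x.2 == y.2).

Lemma Z3P (a : 'Z_3) : [\/ a = 0, a = 1 | a = -1].
Proof.
case: a => [[|[|[|//]]] a3]; [apply: Or31|apply: Or32|apply: Or33]; exact: val_inj.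
Qed.

Lemma rV2P (T : Type) (x y : 'rV[T]_2) : x 0 0 = y 0 0 -> x 0 1 = y 0 1 -> x = y.
Proof.
move=> xy0 xy1; apply/rowP; apply: ord2P; first by [].
by rewrite (_ : ord_max = 1) //; apply: val_inj.
Qed.

Lemma paley_code_inj : injective paley_code.
Proof. by move=> x y [/val_inj e0 /val_inj e1]; apply: rV2P. Qed.

Lemma paley_code_in x : paley_code x \in paley_codes.
Proof.
apply: allpairs_f; rewrite mem_iota /=; exact: ltn_ord.
Qed.

Lemma paley_set_code (d : V) :
  (d \in paley9_set) = ((d 0 0 == 0) (+) (d 0 1 == 0)).
Proof.
rewrite !inE; apply/orP/idP => [[]/imsetP[i _ ->]|].
- by move: i; apply: ord2P; rewrite !mxE.
- by move: i; apply: ord2P; rewrite !mxE.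
have [e0|e0|e0] := Z3P (d 0 0); have [e1|e1|e1] := Z3P (d 0 1); rewrite e0 e1 //= => _.
- by left; apply/imsetP; exists 1 => //; apply: rV2P; rewrite !mxE ?e0 ?e1; apply: val_inj.
- by right; apply/imsetP; exists 1 => //; apply: rV2P; rewrite !mxE ?e0 ?e1; apply: val_inj.
- by left; apply/imsetP; exists 0 => //; apply: rV2P; rewrite !mxE ?e0 ?e1; apply: val_inj.
- by right; apply/imsetP; exists 0 => //; apply: rV2P; rewrite !mxE ?e0 ?e1; apply: val_inj.
Qed.

Lemma paley_adjE (x y : paley9) :
  adj x y = paley_code_adj (paley_code x) (paley_code y).
Proof.
rewrite [LHS]paley_set_code !mxE /paley_code_adj /=.
by rewrite !subr_eq0 ![y _ _ == _]eq_sym.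
Qed.

Lemma card_paley : #|paley9| = 9.
Proof. by rewrite card_mx card_ord. Qed.

(** 9P contains triangles, so [triple_count_const] does not apply to it; all 729 triples are
    inspected instead. *)
Definition paley_triple_check : bool :=
  all (fun x => all (fun y => all (fun z =>
    count (fun w => [&& paley_code_adj x w, paley_code_adj y w & paley_code_adj z w]) paley_codes
      == if x == y then
           if y == z then 4%N else if paley_code_adj y z then 1%N else 2%N
         else if y == z then if paley_code_adj x y then 1%N else 2%N
         else if x == z then if paley_code_adj x y then 1%N else 2%N
         else nth 0%N [:: 0; 1; 0; 0]%N
           (paley_code_adj x y + paley_code_adj y z + paley_code_adj x z)%N)
    paley_codes) paley_codes) paley_codes.

Lemma paley_triple_count (x y z : paley9) :
  triple_count x y z = if x == y then
           if y == z then 4%N else if adj y z then 1%N else 2%N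
         else if y == z then if adj x y then 1%N else 2%N
         else if x == z then if adj x y then 1%N else 2%N
         else nth 0%N [:: 0; 1; 0; 0]%N (adj x y + adj y z + adj x z)%N.
Proof.
have check : paley_triple_check by vm_compute.
have /allP/(_ _ (paley_code_in y))/allP/(_ _ (paley_code_in z))/eqP :=
  allP check _ (paley_code_in x).
rewrite !(inj_eq paley_code_inj) -!paley_adjE => <-.
rewrite -(card_count (enc := paley_code)) ?card_paley //.
- by apply: eq_card => w; rewrite !inE -!paley_adjE.
- exact: paley_code_inj.
- exact: paley_code_in.
Qed.

Lemma paley_srg : strongly_regular paley9 9 4 1 2.
Proof.
have cn x y : #|common_neighbours (G := paley9) x y| = triple_count x x y.
  by apply: eq_card => w; rewrite !inE andbA andbb.
split=> [|x|x y axy|x y xy nxy].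
- exact: card_paley.
- have := paley_triple_count x x x; rewrite eqxx => <-.
  by apply: eq_card => w; rewrite !inE !andbb.
- rewrite cn paley_triple_count eqxx axy; case: eqP => // xy.
  by rewrite xy adj_irrefl in axy.
- by rewrite cn paley_triple_count eqxx (negPf xy) (negPf nxy).
Qed.

Lemma paley_regular (R : realType) : exists P, three_point_regular (qgraph_of R paley9) P.
Proof.
apply: (@three_point_regular_count R paley9 0 1 0 0 1 2 4).
- by move=> x; rewrite paley_triple_count eqxx.
- move=> x y axy; rewrite paley_triple_count eqxx axy; case: eqP => // xy.
  by rewrite xy adj_irrefl in axy.
- by move=> x y xy nxy; rewrite paley_triple_count eqxx (negPf xy) (negPf nxy).
- by move=> x y z xy yz xz; rewrite paley_triple_count (negPf xy) (negPf yz) (negPf xz).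
Qed.

Definition flip (i : 'I_2) (x : V) : V := \row_j (if j == i then - x 0 j else x 0 j).

Lemma flipK i : involutive (flip i).
Proof. by move=> x; apply/rowP => j; rewrite !mxE; case: eqP; rewrite ?opprK. Qed.

Lemma flipC x : flip 0 (flip 1 x) = flip 1 (flip 0 x).
Proof. by apply: rV2P; rewrite !mxE. Qed.

Lemma flip_adj i (x y : paley9) : adj (flip i x : paley9) (flip i y) = adj x y.
Proof.
rewrite [LHS]paley_set_code [RHS]paley_set_code !mxE.
have E (a b : 'Z_3) : (- b - - a == 0) = (b - a == 0) by rewrite -opprD oppr_eq0.
by case: ifP => _; case: ifP => _; rewrite ?E.
Qed.

End Paley.

(** * The 16-Clebsch graph *)

Section Clebsch.

Local Notation V := 'rV['Z_2]_4.
Local Notation code := (bool * bool * bool * bool)%type.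

Definition i0 : 'I_4 := Ordinal (isT : (0 < 4)%N).
Definition i1 : 'I_4 := Ordinal (isT : (1 < 4)%N).
Definition i2 : 'I_4 := Ordinal (isT : (2 < 4)%N).
Definition i3 : 'I_4 := Ordinal (isT : (3 < 4)%N).

Lemma ord4P (P : 'I_4 -> Prop) : P i0 -> P i1 -> P i2 -> P i3 -> forall i, P i.
Proof.
move=> P0 P1 P2 P3 [[|[|[|[|//]]]] i4].
- by rewrite (_ : Ordinal i4 = i0) //; apply: val_inj.
- by rewrite (_ : Ordinal i4 = i1) //; apply: val_inj.
- by rewrite (_ : Ordinal i4 = i2) //; apply: val_inj.
- by rewrite (_ : Ordinal i4 = i3) //; apply: val_inj.
Qed.

Lemma Z2P (a : 'Z_2) : a = (a != 0)%:R.
Proof. by case: a => [[|[|//]] a2]; apply: val_inj. Qed.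

Lemma Z2B (a b : 'Z_2) : (a - b != 0) = (a != 0) (+) (b != 0).
Proof. by case: a => [[|[|//]] a2]; case: b => [[|[|//]] b2]. Qed.

Definition clebsch_code (x : V) : code :=
  (x 0 i0 != 0, x 0 i1 != 0, x 0 i2 != 0, x 0 i3 != 0).

Definition bools := [:: false; true].
Definition clebsch_codes : seq code :=
  [seq (x, d) | x <- [seq (x, c) | x <- [seq (a, b) | a <- bools, b <- bools], c <- bools], d <- bools].

Definition code_add (x y : code) : code :=
  (x.1.1.1 (+) y.1.1.1, x.1.1.2 (+) y.1.1.2, x.1.2 (+) y.1.2, x.2 (+) y.2).
Definition clebsch_code_set : seq code :=
  [:: (true, false, false, false); (false, true, false, false);
      (false, false, true, false); (false, false, false, true); (true, true, true, true)].
Definition clebsch_code_adj (x y : code) : bool := code_add y x \in clebsch_code_set.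

Lemma clebsch_code_inj : injective clebsch_code.
Proof.
move=> x y [e0 e1 e2 e3]; apply/rowP; apply: ord4P;
  by rewrite [LHS]Z2P [RHS]Z2P ?e0 ?e1 ?e2 ?e3.
Qed.

Lemma clebsch_code_in x : clebsch_code x \in clebsch_codes.
Proof. by rewrite /clebsch_code; do 4 case: (_ != 0). Qed.

Lemma clebsch_set_code (d : V) : (d \in clebsch16_set) = (clebsch_code d \in clebsch_code_set).
Proof.
have S : \sum_(i < 4) delta_mx 0 i = const_mx 1 :> V.
  by apply/rowP; apply: ord4P; rewrite summxE !big_ord_recr big_ord0 /= !mxE; apply: val_inj.
rewrite !inE S; apply/orP/idP => [[/imsetP[i _ ->]|/eqP->]|].
- by move: i; apply: ord4P; rewrite /clebsch_code !mxE.
- by rewrite /clebsch_code !mxE.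
have inj w : clebsch_code d = clebsch_code w -> d = w by apply: clebsch_code_inj.
move=> /or4P[/eqP e|/eqP e|/eqP e|/orP[/eqP e|/eqP e]].
- by left; apply/imsetP; exists i0 => //; apply: inj; rewrite e /clebsch_code !mxE.
- by left; apply/imsetP; exists i1 => //; apply: inj; rewrite e /clebsch_code !mxE.
- by left; apply/imsetP; exists i2 => //; apply: inj; rewrite e /clebsch_code !mxE.
- by left; apply/imsetP; exists i3 => //; apply: inj; rewrite e /clebsch_code !mxE.
- by right; apply/eqP; apply: inj; rewrite e /clebsch_code !mxE.
Qed.

Lemma clebsch_adjE (x y : clebsch16) :
  adj x y = clebsch_code_adj (clebsch_code x) (clebsch_code y).
Proof.
rewrite [LHS]clebsch_set_code /clebsch_code_adj.
have -> : clebsch_code ((y : V) - x) = code_add (clebsch_code y) (clebsch_code x).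
  by rewrite /clebsch_code !mxE !Z2B.
by [].
Qed.

Lemma card_clebsch : #|clebsch16| = 16.
Proof. by rewrite card_mx card_ord. Qed.

Definition clebsch_check : bool :=
  all (fun x => (count (clebsch_code_adj x) clebsch_codes == 5%N) && all (fun y =>
    if x == y then true else
    count (fun w => clebsch_code_adj x w && clebsch_code_adj y w) clebsch_codes
      == if clebsch_code_adj x y then 0%N else 2%N) clebsch_codes) clebsch_codes.

Lemma clebsch_srg : strongly_regular clebsch16 16 5 0 2.
Proof.
have check : clebsch_check by vm_compute.
have count_set Q : #|[set v : clebsch16 | Q (clebsch_code v)]| = count Q clebsch_codes.
  apply: card_count => //; [exact: clebsch_code_inj|exact: clebsch_code_in|].
  by rewrite card_clebsch.
have cn (x y : clebsch16) : x != y ->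
    #|common_neighbours x y| = if adj x y then 0%N else 2%N.
  move=> xy; have /andP[_ /allP/(_ _ (clebsch_code_in y))] := allP check _ (clebsch_code_in x).
  rewrite (inj_eq clebsch_code_inj) (negPf xy) -clebsch_adjE => /eqP <-.
  by rewrite -count_set; apply: eq_card => w; rewrite !inE !clebsch_adjE.
split=> [|x|x y axy|x y xy nxy].
- exact: card_clebsch.
- have /andP[/eqP <- _] := allP check _ (clebsch_code_in x).
  by rewrite -count_set; apply: eq_card => w; rewrite !inE clebsch_adjE.
- by rewrite cn ?axy //; apply: contraTneq axy => ->; rewrite adj_irrefl.
- by rewrite cn // (negPf nxy).
Qed.

End Clebsch.

(** * The Higman-Sims graph *)

Lemma setD1_ex (T : finType) (A : {set T}) z :
  (1 < #|A|)%N -> exists c, c \in A :\ z.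
Proof.
move=> A1; apply/set0Pn; rewrite -card_gt0.
by have := cardsD1 z A; case: (z \in A) => /= E; move: A1; rewrite E ?add0n // => /ltnW.
Qed.

Section HigmanSims.

Local Open Scope nat_scope.

Variable G : sgraph.
Hypothesis srg : is_higman_sims G.
Implicit Types (x y z c f g h u v w : G) (F : {set G}).

Definition indep x y := (x != y) && ~~ adj x y.

Lemma indepC x y : indep x y = indep y x.
Proof. by rewrite /indep eq_sym adj_sym. Qed.

Lemma hs_triangle x y z : adj x y -> adj x z -> adj y z = false.
Proof. by move=> xy xz; apply/negbTE; apply: (triangle_free srg xy xz). Qed.

Lemma indep_common c x y : x != y -> adj c x -> adj c y -> indep x y.
Proof. by move=> xy cx cy; rewrite /indep xy (hs_triangle cx cy). Qed.

Lemma hs_deg x : #|[set y | adj x y]| = 22.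
Proof. by have [_ -> _ _] := srg. Qed.

Lemma hs_cn2 x y : indep x y -> #|common_neighbours x y| = 6.
Proof. by have [_ _ _ nadj] := srg; move=> /andP[xy nxy]; rewrite nadj. Qed.

Lemma hs_cn3 x y z : indep x y -> indep y z -> indep x z -> triple_count x y z = 2.
Proof.
move=> /andP[xy nxy] /andP[yz nyz] /andP[xz nxz].
have var0 : (6 * (22 + 6.-1 * 6) + 2 ^ 2 * (100 + 6 - 2 - 2 * 22)
  = 2 * 6 ^ 2 + 2 * 2 * (6 * 22 - 2 * 6))%N by [].
by apply: (triple_count_const srg _ var0); rewrite // eq_sym.
Qed.

(** For a common neighbour [c] this yields the second one; for an arbitrary [c] it yields some
    common neighbour different from [c]. *)
Lemma other_common x y z c : indep x y -> indep y z -> indep x z ->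
  exists c', [/\ c' != c, adj c' x, adj c' y & adj c' z].
Proof.
move=> xy yz xz; have := hs_cn3 xy yz xz; rewrite /triple_count.
set T := [set _ | _] => T2.
have : (0 < #|T :\ c|)%N by have := cardsD1 c T; rewrite T2; case: (c \in T) => /=; lia.
case/card_gt0P => c'; rewrite !inE => /andP[c'c /and3P[xc yc zc]].
by exists c'; rewrite ![adj c' _]adj_sym.
Qed.

Lemma only_common x y z c1 c2 c : indep x y -> indep y z -> indep x z -> c1 != c2 ->
  [/\ adj c1 x, adj c1 y & adj c1 z] -> [/\ adj c2 x, adj c2 y & adj c2 z] ->
  adj c x -> adj c y -> adj c z -> c = c1 \/ c = c2.
Proof.
move=> xy yz xz c12 [a1 b1 d1] [a2 b2 d2] a b d.
have := hs_cn3 xy yz xz; rewrite /triple_count.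
set T := [set _ | _] => T2.
have sub : [set c1; c2] \subset T.
  by apply/subsetP => w; rewrite !inE => /orP[]/eqP->;
    rewrite (adj_sym x) (adj_sym y) (adj_sym z) ?a1 ?b1 ?d1 ?a2 ?b2 ?d2.
have E : [set c1; c2] = T by apply/eqP; rewrite eqEcard sub cards2 c12 T2.
have : c \in T by rewrite inE (adj_sym x) (adj_sym y) (adj_sym z) a b d.
by rewrite -E !inE => /orP[]/eqP; [left|right].
Qed.

(* F is a union of pairs of vertices with the same trace; twin exchanges the
   vertices of a pair, and tau does the same outside F. *)
Section Involution.

Variable F : {set G}.
Definition trace v : {set G} := [set f in F | adj v f].

Hypothesis F_twin : forall f, f \in F ->
  exists g, [/\ g \in F, g != f, trace g = trace f & #|trace f| = 6].

Lemma in_trace v f : (f \in trace v) = (f \in F) && adj v f.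
Proof. by rewrite inE. Qed.

(** The common trace has six elements, as many as two non-adjacent vertices have common neighbours.
    Hence every common neighbour of twins lies in [F], a fact used throughout. *)
Lemma twin_cn f g : f \in F -> g \in F -> g != f -> trace g = trace f ->
  common_neighbours f g = trace f /\ indep f g.
Proof.
move=> fF gF gf tr; have [_ [_ _ _ t6]] := F_twin fF.
have fg : indep f g.
  rewrite /indep eq_sym gf /=; apply/negP => afg.
  by have := in_trace f g; rewrite -tr in_trace gF afg adj_irrefl.
split=> //; apply/esym/eqP; rewrite eqEcard hs_cn2 // t6 leqnn andbT.
apply/subsetP => w wf; have wg : w \in trace g by rewrite tr.
by move: wf wg; rewrite !in_trace !inE => /andP[_ ->] /andP[_ ->].
Qed.

Definition twin f : G := odflt f [pick g in F | (g != f) && (trace g == trace f)].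

Lemma twinP f : f \in F ->
  [/\ twin f \in F, twin f != f, trace (twin f) = trace f,
      common_neighbours f (twin f) = trace f & indep f (twin f)].
Proof.
move=> fF; rewrite /twin; case: pickP => [g /and3P[gF gf /eqP tr]|none].
  by have [cn ind] := twin_cn fF gF gf tr; split.
have [g [gF gf tr _]] := F_twin fF.
by have := none g; rewrite gF gf tr eqxx.
Qed.

(** Three distinct vertices with one trace would be pairwise non-adjacent with six common neighbours
    instead of two. *)
Lemma twin_uniq f g g' : f \in F -> g \in F -> g' \in F -> g != f -> g' != f ->
  trace g = trace f -> trace g' = trace f -> g = g'.
Proof.
move=> fF gF g'F gf g'f tr tr'; apply/eqP/idPn => gg'.
have [cn fg] := twin_cn fF gF gf tr; have [cn' fg'] := twin_cn fF g'F g'f tr'.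
have ind : indep g g'.
  by have [] := twin_cn gF g'F _ _; rewrite 1?eq_sym ?tr.
have := hs_cn3 fg ind fg'; rewrite /triple_count => T2.
have sub : trace f \subset [set w | [&& adj f w, adj g w & adj g' w]].
  apply/subsetP => w wf; have := wf; have := wf.
  by rewrite -{1}cn -{1}cn' !inE => /andP[-> ->] /andP[_ ->].
by have := subset_leq_card sub; have [_ [_ _ _ ->]] := F_twin fF; rewrite T2.
Qed.

Lemma twinK f : f \in F -> twin (twin f) = f.
Proof.
move=> fF; have [sF sf tr _ _] := twinP fF; have [ssF ssf tr' _ _] := twinP sF.
by apply: (twin_uniq sF ssF fF ssf); rewrite // eq_sym.
Qed.

Lemma adj_twin f g : f \in F -> g \in F -> adj f (twin g) = adj f g.
Proof.
move=> fF gF; have [sF _ tr _ _] := twinP gF.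
have := in_trace (twin g) f; rewrite tr in_trace fF /=.
by rewrite ![adj f _]adj_sym => ->.
Qed.

(** * The neighbours in F of a vertex outside F *)

Section Outside.

Variables (u f : G).
Hypotheses (uF : u \notin F) (fu : f \in trace u).

Let fF : f \in F. Proof. by move: fu; rewrite in_trace => /andP[]. Qed.
Let uf : adj u f. Proof. by move: fu; rewrite in_trace => /andP[]. Qed.

Lemma nadj_twin : adj u (twin f) = false.
Proof.
apply/negP => usf; have [sF _ _ cn _] := twinP fF.
have : u \in common_neighbours f (twin f) by rewrite inE ![adj _ u]adj_sym uf usf.
by rewrite cn in_trace (negPf uF).
Qed.

Lemma trace_indep g : g \in trace u -> g != f -> indep f g.
Proof.
rewrite in_trace => /andP[gF ug] gf.
by apply: (indep_common (c := u)); rewrite 1?eq_sym.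
Qed.

Lemma outside_indep h : h \in trace f -> indep u h.
Proof.
rewrite in_trace => /andP[hF fh]; apply: (indep_common (c := f)) => //.
  by apply: contraNneq uF => ->.
by rewrite adj_sym.
Qed.

(** [f] is one common neighbour of [u], [h] and [twin h]. The other one is adjacent to both twins
    and therefore lies in [F]. *)
Lemma trace_ex h : h \in trace f ->
  exists z, [/\ z \in trace u, z != f, adj z h & adj z (twin h)].
Proof.
move=> hf; have := hf; rewrite in_trace => /andP[hF fh].
have [shF shh tr cn ind] := twinP hF.
have shf : twin h \in trace f by rewrite in_trace shF adj_twin.
have [z [zf zu zh zsh]] := other_common f (outside_indep hf) ind (outside_indep shf).
have zF : z \in F.
  have : z \in common_neighbours h (twin h) by rewrite inE ![adj _ z]adj_sym zh zsh.
  by rewrite cn in_trace => /andP[].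
by exists z; split; rewrite // in_trace zF adj_sym.
Qed.

(** Both [z] and [z'], besides [f], are common neighbours of [u], [h] and [twin h], and there are
    only two of these. *)
Lemma trace_uniq h z z' : h \in trace f -> z \in trace u -> z' \in trace u ->
  z != f -> z' != f -> adj z h -> adj z' h -> z = z'.
Proof.
move=> hf; rewrite !in_trace => /andP[zF uz] /andP[z'F uz'] zf z'f zh z'h.
have := hf; rewrite in_trace => /andP[hF fh].
have [shF shh tr cn ind] := twinP hF.
have shf : twin h \in trace f by rewrite in_trace shF adj_twin.
have fcom : [/\ adj f u, adj f h & adj f (twin h)].
  by rewrite adj_sym uf fh adj_twin.
have zcom : [/\ adj z u, adj z h & adj z (twin h)] by rewrite adj_sym uz zh adj_twin.
have fz : f != z by rewrite eq_sym.
have [] := only_common (outside_indep hf) ind (outside_indep shf) fz fcom zcom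
  (c := z') _ z'h _ => //; rewrite ?adj_twin // 1?adj_sym //.
by move=> z'E; rewrite z'E eqxx in z'f.
Qed.

Lemma trace_pair g : g \in trace u -> g != f -> indep (twin f) g.
Proof.
move=> gu gf; have := gu; rewrite in_trace => /andP[gF ug].
have /andP[_ fg] := trace_indep gu gf.
apply/andP; split; first by apply/eqP => sg; rewrite -sg nadj_twin in ug.
by rewrite adj_sym adj_twin // adj_sym.
Qed.

(** The intersection consists of the common neighbours of [f], [twin f] and [g], which are pairwise
    non-adjacent. *)
Lemma trace_hits g : g \in trace u -> g != f -> #|trace g :&: trace f| = 2.
Proof.
move=> gu gf; have [sF sf tr cn ind] := twinP fF.
rewrite -(hs_cn3 ind (trace_pair gu gf) (trace_indep gu gf)).
have := gu; rewrite in_trace => /andP[gF ug].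
apply: eq_card => w; rewrite !inE; have : (w \in trace f) = (adj f w && adj (twin f) w).
  by rewrite -cn inE.
by rewrite in_trace [in X in _ -> _ = X]andbA => <-; case: (w \in F); rewrite //= ?andbF // andbC.
Qed.

(** Each of the six elements of [trace f] is adjacent to exactly one element of [trace u] other than
    [f], and each such element is adjacent to two of the six. So there are three of them besides
    [f]. *)
Lemma card_trace : #|trace u| = 4.
Proof.
have [_ [_ _ _ t6]] := F_twin fF.
suff : (\sum_(g in trace u :\ f) #|trace g :&: trace f| = 6)%N.
  rewrite (eq_bigr (fun=> 2%N)) => [|g]; last first.
    by rewrite !inE -in_trace => /andP[gf gu]; apply: trace_hits.
  by rewrite sum_nat_const; have := cardsD1 f (trace u); rewrite fu; lia.
rewrite -t6 -sum1_card.
transitivity (\sum_(g in trace u :\ f) \sum_(h in trace f) adj g h)%N.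
  apply: eq_bigr => g; rewrite inE in_trace => /and3P[_ gF _].
  rewrite -sum1_card big_mkcond [RHS]big_mkcond; apply: eq_bigr => h _.
  rewrite in_setI !in_trace.
  by case: (h \in F) => //=; rewrite andbC; case: (adj f h) => //=; case: (adj g h).
rewrite exchange_big; apply: eq_bigr => h hf /=.
have [z [zu zf zh zsh]] := trace_ex hf.
rewrite (bigD1 z) /=; last by rewrite in_setD1 zf zu.
rewrite zh big1 // => g /andP[]; rewrite in_setD1 => /andP[gf gu] gz.
case gh: (adj g h) => //; move/eqP: gz; case.
exact: (trace_uniq hf gu zu gf zf gh zh).
Qed.

End Outside.

(** The partner is the second common neighbour of three elements [f], [z1], [z2] of [trace u]. The
    work lies in its adjacency to the fourth element [z]. *)
Lemma outside_twin u f : u \notin F -> f \in trace u -> exists u',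
  [/\ u' \notin F, u' != u & trace u' = trace u].
Proof.
move=> uF fu; have := fu; rewrite in_trace => /andP[fF uf].
have card3 : #|trace u :\ f| = 3.
  by have := cardsD1 f (trace u); rewrite fu (card_trace uF fu); lia.
have [z1 z1u] : exists z1, z1 \in trace u :\ f.
  by apply/set0Pn; rewrite -card_gt0 card3.
have card2 : #|(trace u :\ f) :\ z1| = 2.
  by have := cardsD1 z1 (trace u :\ f); rewrite z1u card3; lia.
have [z2 z2u] : exists z2, z2 \in (trace u :\ f) :\ z1.
  by apply/set0Pn; rewrite -card_gt0 card2.
have card1 : #|((trace u :\ f) :\ z1) :\ z2| = 1.
  by have := cardsD1 z2 ((trace u :\ f) :\ z1); rewrite z2u card2; lia.
move: z1u z2u; rewrite !in_setD1 => /andP[z1f z1u] /and3P[z21 z2f z2u].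
have := z1u; rewrite in_trace => /andP[z1F uz1].
have := z2u; rewrite in_trace => /andP[z2F uz2].
have z12 : indep z1 z2 by apply: (indep_common (c := u)); rewrite 1?eq_sym.
have [u' [u'u u'f u'1 u'2]] := other_common u (trace_indep fu z1u z1f) z12 (trace_indep fu z2u z2f).
have u'F : u' \notin F.
  apply/negP => u'F; have hf : u' \in trace f by rewrite in_trace u'F adj_sym.
  have := trace_uniq uF fu hf z1u z2u z1f z2f _ _; rewrite ![adj _ u']adj_sym => /(_ u'1 u'2) e.
  by rewrite e eqxx in z21.
have uu' : indep u u' by apply: (indep_common (c := f)); rewrite 1?eq_sym // adj_sym.
exists u'; split=> //.
have fu' : f \in trace u' by rewrite in_trace fF.
have outh h : h \in trace f -> indep u' h.
  rewrite in_trace => /andP[hF fh]; apply: (indep_common (c := f)) => //.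
    by apply: contraNneq u'F => ->.
  by rewrite adj_sym.
suff sub : trace u \subset trace u'.
  apply/esym/eqP; rewrite eqEcard sub (card_trace uF fu).
  by rewrite (card_trace u'F fu').
apply/subsetP => z zu; have := zu; rewrite in_trace => /andP[zF uz].
have [->//|zf] := eqVneq z f.
have [->|zz1] := eqVneq z z1; first by rewrite in_trace z1F.
have [->|zz2] := eqVneq z z2; first by rewrite in_trace z2F.
have [h] : exists h, h \in trace z :&: trace f.
  by apply/set0Pn; rewrite -card_gt0 (trace_hits uF fu).
rewrite inE => /andP[hz hf]; have := hz; rewrite in_trace => /andP[hF zh].
(* [f] and [w] are the common neighbours of [u], [u'] and [h]; it has to be shown that [w] is
   [z]. *)
have [w [wf wu wu' wh]] := other_common f uu' (outh _ hf) (outside_indep uF fu hf).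
have [sF sf tr cn ind] := twinP fF.
have fw : indep f w by apply: (indep_common (c := u)); rewrite 1?eq_sym // adj_sym.
have fh : adj f h by move: hf; rewrite in_trace => /andP[].
have sfw : indep (twin f) w.
  apply: (indep_common (c := h)); rewrite 1?adj_sym //.
    by apply: contraTneq wu => <-; rewrite adj_sym (nadj_twin uF fu).
  by rewrite adj_sym adj_twin // adj_sym.
have [h' [h'h h'f h'sf h'w]] := other_common h ind sfw fw.
have h'tf : h' \in trace f by rewrite -cn inE ![adj _ h']adj_sym h'f h'sf.
have uw : adj u w by rewrite adj_sym.
have [shF shh _ cnh indh] := twinP hF.
(* If [h'] is the twin of [h], then [w] is adjacent to both twins, so it lies in [F] and
   [trace_uniq] identifies it with [z]. The other case is refuted. *)
have [h'E|h'sh] := eqVneq h' (twin h).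
  have wF : w \in F.
    have : w \in common_neighbours h (twin h) by rewrite inE -h'E ![adj _ w]adj_sym wh adj_sym.
    by rewrite cnh in_trace => /andP[].
  have wtu : w \in trace u by rewrite in_trace wF.
  by rewrite -(trace_uniq uF fu hf wtu zu wf zf wh zh) in_trace wF adj_sym.
have [z' [z'u z'f z'h' _]] := trace_ex uF fu h'tf.
have z'F : z' \in F by move: z'u; rewrite in_trace => /andP[].
have uz' : adj u z' by move: z'u; rewrite in_trace => /andP[].
(* Otherwise [h], [twin h] and [h'] would be three common neighbours of [f], [twin f] and [z]. *)
have z'z : z' != z.
  apply/eqP => z'E; rewrite z'E in z'h'.
  have hcom : [/\ adj h f, adj h (twin f) & adj h z].
    by rewrite (adj_twin hF fF) adj_sym fh adj_sym.
  have shcom : [/\ adj (twin h) f, adj (twin h) (twin f) & adj (twin h) z].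
    by rewrite (adj_twin shF fF) ![adj (twin h) _]adj_sym (adj_twin fF hF) (adj_twin zF hF).
  have hsh : h != twin h by rewrite eq_sym.
  have h'z : adj h' z by rewrite adj_sym.
  have [h'E|h'E] := only_common ind (trace_pair uF fu zu zf) (trace_indep fu zu zf) hsh hcom shcom
    h'f h'sf h'z; first by rewrite h'E eqxx in h'h.
  by rewrite h'E eqxx in h'sh.
have u'z' : adj z' u'.
  have [->|z'z1] := eqVneq z' z1; first by rewrite adj_sym.
  have [->|z'z2] := eqVneq z' z2; first by rewrite adj_sym.
  have /eqP/cards1P[y0 E] := card1.
  have : z' \in (trace u :\ f) :\ z1 :\ z2 by rewrite !in_setD1 z'z2 z'z1 z'f.
  have : z \in (trace u :\ f) :\ z1 :\ z2 by rewrite !in_setD1 zz2 zz1 zf.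
  by rewrite E !inE => /eqP zE /eqP z'E; rewrite zE z'E eqxx in z'z.
have fcom : [/\ adj f u, adj f u' & adj f h'] by rewrite ![adj f _]adj_sym.
have zcom : [/\ adj z' u, adj z' u' & adj z' h'] by rewrite adj_sym.
have fz' : f != z' by rewrite eq_sym.
(* [f] and [z'] already exhaust the common neighbours of [u], [u'] and [h'], yet [w] is a further
   one: [w = z'] would make both [z] and [z'] adjacent to [h]. *)
have [wE|wE] := only_common uu' (outh _ h'tf) (outside_indep uF fu h'tf) fz' fcom zcom wu wu' (etrans (adj_sym _ _) h'w).
  by rewrite wE eqxx in wf.
rewrite wE in wh; have zE := trace_uniq uF fu hf z'u zu z'f zf wh zh.
by rewrite zE eqxx in z'z.
Qed.

Variable a : G.
Hypothesis aF : a \in F.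

(** If [u] is adjacent neither to [a] nor to its twin, the three have a common neighbour, which lies
    in [F] because it is adjacent to both twins. *)
Lemma trace_neq0 u : u \notin F -> exists f, f \in trace u.
Proof.
move=> uF; have [sF _ _ cn ind] := twinP aF.
have [ua|nua] := boolP (adj u a); first by exists a; rewrite in_trace aF.
have [us|nus] := boolP (adj u (twin a)); first by exists (twin a); rewrite in_trace sF.
have au : indep a u.
  by rewrite /indep adj_sym nua andbT; apply: contraNneq uF => <-.
have su : indep (twin a) u.
  by rewrite /indep adj_sym nus andbT; apply: contraNneq uF => <-.
have [c [_ ca cs cu]] := other_common a ind su au.
exists c; rewrite in_trace adj_sym cu andbT.
have : c \in common_neighbours a (twin a) by rewrite inE ![adj _ c]adj_sym ca cs.
by rewrite cn in_trace => /andP[].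
Qed.

Lemma trace_three u f : u \notin F -> f \in trace u ->
  exists z1 z2, [/\ z1 \in trace u, z2 \in trace u, z1 != f, z2 != f & z1 != z2].
Proof.
move=> uF fu; have c4 := card_trace uF fu.
have c3 : #|trace u :\ f| = 3 by have := cardsD1 f (trace u); rewrite fu c4; lia.
have [z1 z1u] : exists z1, z1 \in trace u :\ f.
  by apply/set0Pn; rewrite -card_gt0 c3.
have c2 : #|(trace u :\ f) :\ z1| = 2.
  by have := cardsD1 z1 (trace u :\ f); rewrite z1u c3; lia.
have [z2 z2u] : exists z2, z2 \in (trace u :\ f) :\ z1.
  by apply/set0Pn; rewrite -card_gt0 c2.
move: z1u z2u; rewrite !in_setD1 => /andP[z1f z1u] /and3P[z21 z2f z2u].
by exists z1, z2; split; rewrite // eq_sym.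
Qed.

(** Three elements of the trace have only two common neighbours, and [u] is one of them. *)
Lemma outside_twin_uniq u v w : u \notin F -> v != u -> trace v = trace u ->
  w != u -> trace w = trace u -> v = w.
Proof.
move=> uF vu tv wu tw; have [f fu] := trace_neq0 uF.
have [z1 [z2 [z1u z2u z1f z2f z12]]] := trace_three uF fu.
have com x : trace x = trace u -> [/\ adj x f, adj x z1 & adj x z2].
  move=> tx; move: fu z1u z2u; rewrite -tx !in_trace.
  by move=> /andP[_ ->] /andP[_ ->] /andP[_ ->].
have ind : indep z1 z2.
  have [_ u1 u2] := com u erefl.
  by apply: (indep_common (c := u)).
have uv : u != v by rewrite eq_sym.
have [wf w1 w2] := com w tw.
have [] := only_common (trace_indep fu z1u z1f) ind (trace_indep fu z2u z2f) uv
  (com u erefl) (com v tv) wf w1 w2; last by [].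
by move=> wE; rewrite wE eqxx in wu.
Qed.

Definition tau u : G :=
  if u \in F then u else odflt u [pick v | [&& v \notin F, v != u & trace v == trace u]].

Lemma tau_in u : u \in F -> tau u = u.
Proof. by rewrite /tau => ->. Qed.

Lemma tauP u : u \notin F -> [/\ tau u \notin F, tau u != u & trace (tau u) = trace u].
Proof.
move=> uF; rewrite /tau (negPf uF); case: pickP => [v /and3P[vF vu /eqP]|none] //.
have [f fu] := trace_neq0 uF; have [v [vF vu tv]] := outside_twin uF fu.
by have := none v; rewrite vF vu tv eqxx.
Qed.

Lemma tau_uniq u v : u \notin F -> v != u -> trace v = trace u -> v = tau u.
Proof.
move=> uF vu tv; have [_ tu tt] := tauP uF.
exact: (outside_twin_uniq uF vu tv tu tt).
Qed.

Lemma tauK : involutive tau.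
Proof.
move=> u; have [uF|uF] := boolP (u \in F); first by rewrite !tau_in.
have [tF tu tt] := tauP uF; apply/esym/tau_uniq => //.
by rewrite eq_sym.
Qed.

Lemma tau_indep u : u \notin F -> indep u (tau u).
Proof.
move=> uF; have [tF tu tt] := tauP uF; have [f fu] := trace_neq0 uF.
have := fu; rewrite -tt !in_trace => /andP[_ tf].
have := fu; rewrite in_trace => /andP[_ uf].
by apply: (indep_common (c := f)); rewrite 1?eq_sym // adj_sym.
Qed.

(** Four of the six common neighbours of [u] and [tau u] form [trace u]. For [f] in it, the two
    common neighbours of [u], [tau u] and [twin f] avoid [trace u], since a neighbour of [twin f] in
    [F] is one of [f] and would close a triangle. So they are the other two of the six, and [q] is
    among them. *)
Lemma trace_twin_common u q : u \notin F -> q \notin F -> adj q u -> adj q (tau u) ->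
  trace q = twin @: trace u.
Proof.
move=> uF qF qu qt; have [tF tu tt] := tauP uF.
have [f0 f0u] := trace_neq0 uF; have c4 := card_trace uF f0u.
have [g0 g0q] := trace_neq0 qF; have c4q := card_trace qF g0q.
have cn6 := hs_cn2 (tau_indep uF).
have sub : trace u \subset common_neighbours u (tau u).
  apply/subsetP => f fu; have := fu; rewrite -tt !in_trace inE => /andP[_ ->].
  by move: fu; rewrite in_trace => /andP[_ ->].
have c2 : #|common_neighbours u (tau u) :\: trace u| = 2.
  by rewrite cardsDS // cn6 c4.
apply/esym/eqP; rewrite eqEcard card_in_imset; last first.
  move=> f g; rewrite !in_trace => /andP[fF _] /andP[gF _] e.
  by rewrite -(twinK fF) e twinK.
rewrite c4 c4q leqnn andbT; apply/subsetP => _ /imsetP[f fu ->].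
have := fu; rewrite in_trace => /andP[fF uf].
have [sF sf tr cn ind] := twinP fF.
rewrite in_trace sF /=.
have us : indep u (twin f).
  rewrite /indep (nadj_twin uF fu) andbT.
  by apply: contraNneq uF => ->.
have ts : indep (tau u) (twin f).
  have ft : f \in trace (tau u) by rewrite tt.
  rewrite /indep (nadj_twin tF ft) andbT.
  by apply: contraNneq tF => ->.
have := hs_cn3 (tau_indep uF) ts us; rewrite /triple_count.
set T := [set _ | _] => T2.
have subT : T \subset common_neighbours u (tau u) :\: trace u.
  apply/subsetP => w; rewrite !inE => /and3P[uw tw sw]; rewrite uw tw !andbT.
  apply/negP => wF; rewrite adj_sym (adj_twin wF fF) in sw.
  by have := hs_triangle uw uf; rewrite sw.
have E : T = common_neighbours u (tau u) :\: trace u.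
  by apply/eqP; rewrite eqEcard subT c2 T2.
have : q \in T by rewrite E in_setD in_trace (negPf qF) inE ![adj _ q]adj_sym qu qt.
by rewrite inE [adj q _]adj_sym => /and3P[].
Qed.

Lemma imset_twinK u : twin @: (twin @: trace u) = trace u.
Proof.
apply/setP => g; apply/imsetP/idP => [[_ /imsetP[f fu ->] ->]|gu].
  by rewrite twinK //; move: fu; rewrite in_trace => /andP[].
have gF : g \in F by move: gu; rewrite in_trace => /andP[].
by exists (twin g); rewrite ?twinK //; apply: imset_f.
Qed.

(** The two common neighbours of [u] and [tau u] outside [F] have the same trace by
    [trace_twin_common], so [tau] exchanges them. *)
Lemma other_common_tau u q : u \notin F -> q \notin F -> adj q u -> adj q (tau u) ->
  adj (tau q) u /\ adj (tau q) (tau u).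
Proof.
move=> uF qF qu qt; have [tF tu tt] := tauP uF.
have [f0 f0u] := trace_neq0 uF; have c4 := card_trace uF f0u.
have cn6 := hs_cn2 (tau_indep uF).
have sub : trace u \subset common_neighbours u (tau u).
  apply/subsetP => f fu; have := fu; rewrite -tt !in_trace inE => /andP[_ ->].
  by move: fu; rewrite in_trace => /andP[_ ->].
have c2 : #|common_neighbours u (tau u) :\: trace u| = 2.
  by rewrite cardsDS // cn6 c4.
have qD : q \in common_neighbours u (tau u) :\: trace u.
  by rewrite in_setD in_trace (negPf qF) inE ![adj _ q]adj_sym qu qt.
have [|q2 q2D] := @setD1_ex _ (common_neighbours u (tau u) :\: trace u) q; first by rewrite c2.
move: q2D; rewrite in_setD1 in_setD in_trace inE => /andP[q2q /andP[q2F /andP[uq2 tq2]]].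
rewrite uq2 andbT in q2F.
have q2u : adj q2 u by rewrite adj_sym.
have q2t : adj q2 (tau u) by rewrite adj_sym.
have e : trace q2 = trace q.
  by rewrite (trace_twin_common uF q2F q2u q2t) (trace_twin_common uF qF qu qt).
by rewrite -(tau_uniq qF q2q e).
Qed.

(** Otherwise [u], [v] and [tau v] have two common neighbours, both outside [F] by disjointness and
    with trace [twin @: trace v], hence exchanged by [tau]. Then [u] is a common neighbour of them,
    and applying [trace_twin_common] once more gives [trace u = trace v]. *)
Lemma tau_adj_or u v : u \notin F -> v \notin F -> [disjoint trace u & trace v] ->
  adj u v || adj u (tau v).
Proof.
move=> uF vF dis; apply/idPn; rewrite negb_or => /andP[nuv nut].
have [tF tv tt] := tauP vF.
have [f fu] := trace_neq0 uF.
have neq : trace u <> trace v.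
  by move=> e; have := disjointFr dis fu; rewrite -e fu.
have uv : indep u v.
  by rewrite /indep nuv andbT; apply/eqP => e; apply: neq; rewrite e.
have ut : indep u (tau v).
  by rewrite /indep nut andbT; apply/eqP => e; apply: neq; rewrite e tt.
have [r [_ ru rv rt]] := other_common a uv (tau_indep vF) ut.
have rF : r \notin F.
  apply/negP => rF; have r1 : r \in trace u by rewrite in_trace rF adj_sym.
  by have := disjointFr dis r1; rewrite in_trace rF adj_sym rv.
have [r2 [r2r r2u r2v r2t]] := other_common r uv (tau_indep vF) ut.
have r2F : r2 \notin F.
  apply/negP => r2F; have r1 : r2 \in trace u by rewrite in_trace r2F adj_sym.
  by have := disjointFr dis r1; rewrite in_trace r2F adj_sym r2v.
have e : trace r2 = trace r.
  by rewrite (trace_twin_common vF r2F r2v r2t) (trace_twin_common vF rF rv rt).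
have r2E := tau_uniq rF r2r e.
apply: neq; rewrite -(imset_twinK v) -(trace_twin_common vF rF rv rt).
by apply: (trace_twin_common rF uF); rewrite 1?adj_sym // -r2E.
Qed.

(** Outside [F], if [v] is adjacent to [tau u] as well, [other_common_tau] applies. If not, the
    traces of [tau u] and [v] are disjoint for want of triangles, and [tau_adj_or] leaves only
    [tau v]. *)
Lemma tau_homo u v : adj u v -> adj (tau u) (tau v).
Proof.
have out x y : x \in F -> y \notin F -> adj x y = adj x (tau y).
  move=> xF yF; have [_ _ ty] := tauP yF.
  have := in_trace (tau y) x; rewrite ty in_trace xF /=.
  by rewrite ![adj _ x]adj_sym.
move=> uv; have [uF|uF] := boolP (u \in F); have [vF|vF] := boolP (v \in F).
- by rewrite !tau_in.
- by rewrite (tau_in uF) -out.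
- by rewrite (tau_in vF) adj_sym -out // adj_sym.
have [tF tu tt] := tauP uF.
have [tuv|ntuv] := boolP (adj (tau u) v).
  have vu : adj v u by rewrite adj_sym.
  have vt : adj v (tau u) by rewrite adj_sym.
  by have [_] := other_common_tau uF vF vu vt; rewrite adj_sym.
have dis : [disjoint trace (tau u) & trace v].
  rewrite tt; apply/pred0P => f /=; rewrite !in_trace; apply/negP.
  by move=> /andP[/andP[_ uf] /andP[_ vf]]; have := hs_triangle uv uf; rewrite vf.
by have := tau_adj_or tF vF dis; rewrite (negPf ntuv).
Qed.

Lemma tau_adj u v : adj (tau u) (tau v) = adj u v.
Proof. by apply/idP/idP => /tau_homo; rewrite ?tauK. Qed.

End Involution.

Definition hexad (a b h0 h1 h2 h3 h4 h5 : G) : Prop :=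
  [/\ indep a b, uniq [:: h0; h1; h2; h3; h4; h5]
    & forall h, (h \in common_neighbours a b) = (h \in [:: h0; h1; h2; h3; h4; h5])].

Definition frame (a b h0 h1 h2 h3 h4 h5 : G) : {set G} :=
  common_neighbours a b :|: common_neighbours h0 h1
    :|: common_neighbours h2 h3 :|: common_neighbours h4 h5.

Lemma in_frame (a b h0 h1 h2 h3 h4 h5 w : G) :
  (w \in frame a b h0 h1 h2 h3 h4 h5)
    = [|| adj a w && adj b w, adj h0 w && adj h1 w, adj h2 w && adj h3 w
        | adj h4 w && adj h5 w].
Proof. by rewrite !inE !orbA. Qed.

Lemma cnC x y : common_neighbours x y = common_neighbours y x.
Proof. by apply/setP => w; rewrite !inE andbC. Qed.

Lemma hexad_perm (a b h0 h1 h2 h3 h4 h5 k0 k1 k2 k3 k4 k5 : G) :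
  perm_eq [:: h0; h1; h2; h3; h4; h5] [:: k0; k1; k2; k3; k4; k5] ->
  hexad a b h0 h1 h2 h3 h4 h5 -> hexad a b k0 k1 k2 k3 k4 k5.
Proof.
move=> hk [ab un inH]; split=> // [|h]; first by rewrite -(perm_uniq hk).
by rewrite inH (perm_mem hk).
Qed.

Lemma hexad_swap (a b h0 h1 h2 h3 h4 h5 : G) :
  hexad a b h0 h1 h2 h3 h4 h5 -> hexad a b h1 h0 h2 h3 h4 h5.
Proof. by apply: hexad_perm; rewrite (perm_catCA [:: h0] [:: h1]). Qed.

Lemma hexad_rot (a b h0 h1 h2 h3 h4 h5 : G) :
  hexad a b h0 h1 h2 h3 h4 h5 -> hexad a b h2 h3 h4 h5 h0 h1.
Proof. by apply: hexad_perm; rewrite (perm_catC [:: h0; h1]). Qed.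

Lemma hexad_swap_pairs (a b h0 h1 h2 h3 h4 h5 : G) :
  hexad a b h0 h1 h2 h3 h4 h5 -> hexad a b h0 h1 h4 h5 h2 h3.
Proof.
by apply: hexad_perm; rewrite (perm_cat2l [:: h0; h1]) (perm_catC [:: h2; h3]).
Qed.

Lemma hexad_sym (a b h0 h1 h2 h3 h4 h5 : G) :
  hexad a b h0 h1 h2 h3 h4 h5 -> hexad b a h0 h1 h2 h3 h4 h5.
Proof.
by move=> [ab un inH]; split=> [||h]; rewrite // 1?indepC // cnC.
Qed.

Lemma frame_swap (a b h0 h1 h2 h3 h4 h5 : G) :
  frame a b h1 h0 h2 h3 h4 h5 = frame a b h0 h1 h2 h3 h4 h5.
Proof. by rewrite /frame (cnC h1). Qed.

Lemma frame_rot (a b h0 h1 h2 h3 h4 h5 : G) :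
  frame a b h2 h3 h4 h5 h0 h1 = frame a b h0 h1 h2 h3 h4 h5.
Proof.
rewrite /frame -!setUA; congr (_ :|: _).
by rewrite setUA setUC.
Qed.

Lemma frame_sym (a b h0 h1 h2 h3 h4 h5 : G) :
  frame b a h0 h1 h2 h3 h4 h5 = frame a b h0 h1 h2 h3 h4 h5.
Proof. by rewrite /frame (cnC b). Qed.

(** * Twins in the frame of a hexad *)

Section Hexad.

Variables a b h0 h1 h2 h3 h4 h5 : G.
Hypothesis hex : hexad a b h0 h1 h2 h3 h4 h5.
Local Notation H := [:: h0; h1; h2; h3; h4; h5].
Local Notation F := (frame a b h0 h1 h2 h3 h4 h5).

Let ab : indep a b. Proof. by case: hex. Qed.

Lemma hex_in h : h \in H -> adj a h /\ adj b h.
Proof. by case: hex => _ _ inH; rewrite -inH inE => /andP[]. Qed.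

Lemma hex_nth i j : i < 6 -> j < 6 -> i != j -> nth h0 H i != nth h0 H j.
Proof. by move=> i6 j6 ij; case: hex => _ un _; rewrite nth_uniq. Qed.

Lemma hex_indep x y : x \in H -> y \in H -> x != y -> indep x y.
Proof.
by move=> /hex_in[ax _] /hex_in[ay _] xy; apply: (indep_common (c := a)).
Qed.

Lemma hex_far h z : h \in H -> adj z h -> z != a -> indep a z.
Proof.
move=> /hex_in[ah _] zh za; apply: (indep_common (c := h)); rewrite 1?eq_sym //.
  by rewrite adj_sym.
by rewrite adj_sym.
Qed.

Lemma hex_far' h z : h \in H -> adj z h -> z != b -> indep b z.
Proof.
move=> /hex_in[_ bh] zh zb; apply: (indep_common (c := h)); rewrite 1?eq_sym //.
  by rewrite adj_sym.
by rewrite adj_sym.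
Qed.

(** Neighbours of [z] in the hexad are common neighbours of [a], [b] and [z]. So a vertex far from
    [a] and [b] determines a pair in the hexad. *)
Lemma hex_two z x y h : z != a -> z != b -> x \in H -> y \in H -> x != y ->
  adj z x -> adj z y -> h \in H -> adj z h -> h = x \/ h = y.
Proof.
move=> za zb xH yH xy zx zy hH zh.
have com k : k \in H -> adj z k -> [/\ adj k a, adj k b & adj k z].
  by move=> /hex_in[ak bk] zk; rewrite ![adj k _]adj_sym.
have [ha hb hz] := com h hH zh.
exact: (only_common ab (hex_far' xH zx zb) (hex_far xH zx za) xy (com x xH zx) (com y yH zy)).
Qed.

Lemma hex_two_ex z : indep a z -> indep b z ->
  exists x y, [/\ x \in H, y \in H, x != y, adj z x & adj z y].
Proof.
move=> az bz; have [_ _ inH] := hex.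
have [x [_ xa xb xz]] := other_common a ab bz az.
have [y [yx ya yb yz]] := other_common x ab bz az.
exists x, y; rewrite -!inH !inE eq_sym yx ![adj z _]adj_sym xz yz.
by rewrite ![adj a _]adj_sym ![adj b _]adj_sym xa xb ya yb.
Qed.

Let H0 : h0 \in H. Proof. by rewrite !inE eqxx. Qed.
Let H1 : h1 \in H. Proof. by rewrite !inE eqxx orbT. Qed.
Let H2 : h2 \in H. Proof. by rewrite !inE eqxx !orbT. Qed.
Let H3 : h3 \in H. Proof. by rewrite !inE eqxx !orbT. Qed.
Let H4 : h4 \in H. Proof. by rewrite !inE eqxx !orbT. Qed.
Let H5 : h5 \in H. Proof. by rewrite !inE eqxx !orbT. Qed.
Let h01 : h0 != h1. Proof. exact: (@hex_nth 0 1). Qed.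
Let h23 : h2 != h3. Proof. exact: (@hex_nth 2 3). Qed.
Let h45 : h4 != h5. Proof. exact: (@hex_nth 4 5). Qed.

Lemma trace_frame_pole : trace F a = common_neighbours a b.
Proof.
apply/setP => w; rewrite in_trace in_frame [RHS]inE; case aw: (adj a w); rewrite ?andbF //= andbT.
have no h : h \in H -> adj h w = false.
  by move=> /hex_in[ah _]; apply: (hs_triangle ah aw).
by rewrite (no h0) // (no h2) // (no h4) //= !orbF.
Qed.

(** A neighbour of [h0] adjacent to another of the chosen pairs would have three neighbours in the
    hexad. *)
Lemma trace_frame_hex : trace F h0 = common_neighbours h0 h1.
Proof.
apply/setP => w; rewrite in_trace in_frame [RHS]inE; case hw: (adj h0 w); rewrite ?andbF //= andbT.
have [a0 b0] := hex_in H0; have [a1 b1] := hex_in H1.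
have aw : adj a w = false.
  by apply/negbTE/negP => aw; have := hs_triangle a0 aw; rewrite hw.
rewrite aw /=; case h1w: (adj h1 w) => //=.
have nw x y : x \in H -> y \in H -> x != y -> h0 != x -> h0 != y -> adj x w && adj y w = false.
  move=> xH yH xy x0 y0; apply/negbTE/negP => /andP[xw yw].
  have wa : w != a by apply: contraFneq h1w => ->; rewrite adj_sym.
  have wb : w != b by apply: contraFneq h1w => ->; rewrite adj_sym.
  have [] := hex_two wa wb xH yH xy (etrans (adj_sym _ _) xw) (etrans (adj_sym _ _) yw) H0
    (etrans (adj_sym _ _) hw) => e; [move: x0|move: y0]; by rewrite e eqxx.
rewrite !nw //; [exact: (@hex_nth 0 4)|exact: (@hex_nth 0 5)
  |exact: (@hex_nth 0 2)|exact: (@hex_nth 0 3)].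
Qed.

Let pair23 w : adj w h2 -> adj w h3 -> w != a -> w != b -> forall h, h \in H -> adj w h ->
  h = h2 \/ h = h3.
Proof. by move=> w2 w3 wa wb h hH wh; apply: (hex_two wa wb H2 H3 h23 w2 w3 hH wh). Qed.

Let pair45 w : adj w h4 -> adj w h5 -> w != a -> w != b -> forall h, h \in H -> adj w h ->
  h = h4 \/ h = h5.
Proof. by move=> w2 w3 wa wb h hH wh; apply: (hex_two wa wb H4 H5 h45 w2 w3 hH wh). Qed.

(* Of the six common neighbours of w and w', two are adjacent to a and two to b.
   The other two are adjacent to h0 and h1, hence they are the two common
   neighbours of w, h0 and h1, namely z and z'. *)
Lemma frame_exchange z z' w w' :
    adj z h0 -> adj z h1 -> adj z' h0 -> adj z' h1 -> z' != z ->
    adj w h2 -> adj w h3 -> w != a -> w != b ->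
    adj w' h4 -> adj w' h5 -> w' != a -> w' != b ->
    adj w z -> adj w z' -> adj w' z -> adj w' z'.
Proof.
move=> z0 z1 z'0 z'1 z'z w2 w3 wa wb w'4 w'5 w'a w'b wz wz' w'z.
have ww' : indep w w'.
  apply: (indep_common (c := z)); rewrite 1?adj_sym //.
  apply/eqP => e; rewrite -e in w'4.
  have [e'|e'] := pair23 w2 w3 wa wb H4 w'4.
    by have := @hex_nth 4 2 isT isT isT; rewrite /= e' eqxx.
  by have := @hex_nth 4 3 isT isT isT; rewrite /= e' eqxx.
have aw := hex_far H2 w2 wa; have aw' := hex_far H4 w'4 w'a.
have bw := hex_far' H2 w2 wb; have bw' := hex_far' H4 w'4 w'b.
pose S := common_neighbours w w'.
have S6 : #|S| = 6 by apply: hs_cn2.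
have Sa : #|S :&: [set c | adj a c]| = 2.
  rewrite -(hs_cn3 aw ww' aw'); apply: eq_card => c.
  by rewrite !inE andbC.
have Sb : #|S :&: [set c | adj b c]| = 2.
  rewrite -(hs_cn3 bw ww' bw'); apply: eq_card => c.
  by rewrite !inE andbC.
have Sab : (S :&: [set c | adj a c]) :&: (S :&: [set c | adj b c]) = set0.
  apply/setP => c; rewrite !inE; apply/negP => /andP[/andP[/andP[wc w'c] ac] /andP[_ bc]].
  have cH : c \in H by case: hex => _ _ <-; rewrite inE ac bc.
  have [e|e] := pair23 w2 w3 wa wb cH wc; have [e'|e'] := pair45 w'4 w'5 w'a w'b cH w'c.
  - by have := @hex_nth 2 4 isT isT isT; rewrite /= -e -e' eqxx.
  - by have := @hex_nth 2 5 isT isT isT; rewrite /= -e -e' eqxx.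
  - by have := @hex_nth 3 4 isT isT isT; rewrite /= -e -e' eqxx.
  - by have := @hex_nth 3 5 isT isT isT; rewrite /= -e -e' eqxx.
have S2 : #|S :\: ((S :&: [set c | adj a c]) :|: (S :&: [set c | adj b c]))| = 2.
  by rewrite cardsDS ?subUset ?subsetIl // S6 cardsU Sa Sb Sab cards0.
have nza : adj a z = false.
  by have [a0 _] := hex_in H0; rewrite (hs_triangle (x := h0)) // adj_sym.
have nzb : adj b z = false.
  by have [_ b0] := hex_in H0; rewrite (hs_triangle (x := h0)) // adj_sym.
have zS : z \in S :\: ((S :&: [set c | adj a c]) :|: (S :&: [set c | adj b c])).
  by rewrite !inE nza nzb wz w'z.
have [|c] := @setD1_ex _ (S :\: ((S :&: [set c | adj a c]) :|: (S :&: [set c | adj b c]))) z.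
  by rewrite S2.
rewrite !inE negb_or => /and3P[cz /andP[ca cb] /andP[wc w'c]].
rewrite wc w'c /= in ca cb.
have ac : indep a c.
  rewrite /indep ca andbT; apply/eqP => e.
  by move: aw => /andP[_]; rewrite e adj_sym wc.
have bc : indep b c.
  rewrite /indep cb andbT; apply/eqP => e.
  by move: bw => /andP[_]; rewrite e adj_sym wc.
have c01 x : x \in H -> adj c x -> x = h0 \/ x = h1.
  move=> xH cx.
  have n2 : adj c h2 = false by apply: (hs_triangle wc w2).
  have n3 : adj c h3 = false by apply: (hs_triangle wc w3).
  have n4 : adj c h4 = false by apply: (hs_triangle w'c w'4).
  have n5 : adj c h5 = false by apply: (hs_triangle w'c w'5).
  by move: xH; rewrite !inE => /or4P[/eqP->|/eqP->|/eqP e|/or3P[]/eqP e];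
    [left|right|rewrite e n2 in cx|rewrite e n3 in cx|rewrite e n4 in cx|rewrite e n5 in cx].
have [x [y [xH yH xy cx cy]]] := hex_two_ex ac bc.
have [c0 c1] : adj c h0 /\ adj c h1.
  have [ex|ex] := c01 x xH cx; have [ey|ey] := c01 y yH cy; subst x y => //.
  - by rewrite eqxx in xy.
  - by rewrite eqxx in xy.
have ind0 : indep w h0.
  apply: (indep_common (c := z)); rewrite 1?adj_sym //.
    apply/eqP => e; have [_ bh] := hex_in H0; move: bw => /andP[_].
    by rewrite e bh.
  by rewrite adj_sym.
have ind1 : indep w h1.
  apply: (indep_common (c := z)); rewrite 1?adj_sym //.
    apply/eqP => e; have [_ bh] := hex_in H1; move: bw => /andP[_].
    by rewrite e bh.
  by rewrite adj_sym.
have zz' : z != z' by rewrite eq_sym.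
have [e|e] := only_common ind0 (hex_indep H0 H1 h01) ind1 zz'
  (And3 (etrans (adj_sym _ _) wz) z0 z1) (And3 (etrans (adj_sym _ _) wz') z'0 z'1)
  (etrans (adj_sym _ _) wc) c0 c1.
  by rewrite e eqxx in cz.
by rewrite -e.
Qed.

End Hexad.

Section HexadPair.

Variables a b h0 h1 h2 h3 h4 h5 : G.
Hypothesis hex : hexad a b h0 h1 h2 h3 h4 h5.
Local Notation H := [:: h0; h1; h2; h3; h4; h5].
Local Notation F := (frame a b h0 h1 h2 h3 h4 h5).

Let H0 : h0 \in H. Proof. by rewrite !inE eqxx. Qed.
Let H1 : h1 \in H. Proof. by rewrite !inE eqxx orbT. Qed.
Let H2 : h2 \in H. Proof. by rewrite !inE eqxx !orbT. Qed.
Let H3 : h3 \in H. Proof. by rewrite !inE eqxx !orbT. Qed.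
Let H4 : h4 \in H. Proof. by rewrite !inE eqxx !orbT. Qed.
Let H5 : h5 \in H. Proof. by rewrite !inE eqxx !orbT. Qed.
Let h01 : h0 != h1. Proof. exact: (hex_nth (i := 0) (j := 1) hex). Qed.
Let h23 : h2 != h3. Proof. exact: (hex_nth (i := 2) (j := 3) hex). Qed.
Let h45 : h4 != h5. Proof. exact: (hex_nth (i := 4) (j := 5) hex). Qed.

Lemma hex_linked_neq z w h k : h \in H -> adj z h -> z != a -> z != b ->
  k \in H -> adj w k -> adj z w -> w != a /\ w != b.
Proof.
move=> hH zh za zb kH wk zw.
have /andP[_ az] := hex_far hex hH zh za.
have /andP[_ bz] := hex_far' hex hH zh zb.
by split; [apply: contraNneq az => <-|apply: contraNneq bz => <-]; rewrite adj_sym.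
Qed.

Lemma hex_link z h k l : h \in H -> adj z h -> z != a -> z != b ->
    k \in H -> l \in H -> k != l -> adj z k = false -> adj z l = false ->
  exists w, [/\ adj w z, adj w k, adj w l, w != a & w != b].
Proof.
move=> hH zh za zb kH lH kl zk zl.
have ind m : m \in H -> adj z m = false -> indep z m.
  move=> mH zm; rewrite /indep zm andbT; apply: contraNneq (_ : ~~ adj a z) => [->|].
    by have [] := hex_in hex mH.
  by have /andP[] := hex_far hex hH zh za.
have [w [wa wz wk wl]] :=
  other_common a (ind _ kH zk) (hex_indep hex kH lH kl) (ind _ lH zl).
have zw : adj z w by rewrite adj_sym.
by exists w; have [] := hex_linked_neq hH zh za zb kH wk zw.
Qed.

Section Pole.

Variable z : G.
Hypotheses (z0 : adj z h0) (z1 : adj z h1) (za : z != a) (zb : z != b).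

Lemma pole_far h : h \in [:: h2; h3; h4; h5] -> adj z h = false.
Proof.
move=> hH; apply/negP => zh.
have hH' : h \in H by rewrite [h \in H]inE [h \in _ :: [:: h2; h3; h4; h5]]inE hH !orbT.
have hn : h \notin [:: h0; h1].
  case: hex => _ un _; apply: contraL hH; move: un; rewrite (cat_uniq [:: h0; h1]).
  move=> /and3P[_ no _] h01'; apply: contra no => hH; apply/hasP; by exists h.
by have [e|e] := hex_two hex za zb H0 H1 h01 z0 z1 hH' zh;
  rewrite e !inE eqxx ?orbT in hn.
Qed.

(** A neighbour of [z] in the frame is [h0], [h1], or a vertex over the second or third pair; the
    last two cases are handled by [frame_exchange]. *)
Lemma pole_sub z' w : adj z' h0 -> adj z' h1 -> z' != z ->
    adj w h2 -> adj w h3 -> w != a -> w != b -> adj w z -> adj w z' ->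
  trace F z \subset trace F z'.
Proof.
move=> z'0 z'1 z'z w2 w3 wa wb wz wz'.
apply/subsetP => g; rewrite !in_trace => /andP[gF zg]; rewrite gF /=.
move: gF; rewrite in_frame => /or4P[/andP[ag bg]|/andP[g0 _]|/andP[g2 g3]|/andP[g4 g5]].
- have gH : g \in H by case: hex => _ _ <-; rewrite inE ag bg.
  by have [->|->] := hex_two hex za zb H0 H1 h01 z0 z1 gH zg.
- have h0z : adj h0 z by rewrite adj_sym.
  by have := hs_triangle h0z g0; rewrite zg.
(* [frame_exchange] passes between different pairs, while [g] lies over the same pair as [w]. A
   detour through a vertex [w'] over the third pair is needed. *)
- have [||w' [w'z w'4 w'5 w'a w'b]] := hex_link H0 z0 za zb H4 H5 h45.
  + by apply: pole_far; rewrite !inE eqxx !orbT.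
  + by apply: pole_far; rewrite !inE eqxx !orbT.
  have w'z' := frame_exchange hex z0 z1 z'0 z'1 z'z w2 w3 wa wb w'4 w'5 w'a w'b wz wz' w'z.
  have [ga gb] := hex_linked_neq H0 z0 za zb H2 (etrans (adj_sym _ _) g2) zg.
  rewrite adj_sym; rewrite ![adj _ g]adj_sym in g2 g3; rewrite adj_sym in zg.
  exact: (frame_exchange (hexad_swap_pairs hex) z0 z1 z'0 z'1 z'z
    w'4 w'5 w'a w'b g2 g3 ga gb w'z w'z' zg).
have [ga gb] := hex_linked_neq H0 z0 za zb H4 (etrans (adj_sym _ _) g4) zg.
rewrite adj_sym; rewrite ![adj _ g]adj_sym in g4 g5; rewrite adj_sym in zg.
exact: (frame_exchange hex z0 z1 z'0 z'1 z'z w2 w3 wa wb g4 g5 ga gb wz wz' zg).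
Qed.

(** The six are [h0] and [h1], the two common neighbours of [z], [h2], [h3], and the two of [z],
    [h4], [h5]. *)
Lemma card_trace_pole : #|trace F z| = 6.
Proof.
have ind h : h \in [:: h2; h3; h4; h5] -> indep h z.
  move=> hH; rewrite /indep adj_sym pole_far // andbT.
  have hH' : h \in H by rewrite [h \in H]inE [h \in _ :: [:: h2; h3; h4; h5]]inE hH !orbT.
  have [ah _] := hex_in hex hH'.
  have /andP[_ az] := hex_far hex H0 z0 za.
  by apply: contraNneq az => <-.
have -> : trace F z = [set h0; h1]
    :|: [set w | [&& adj h2 w, adj h3 w & adj z w]]
    :|: [set w | [&& adj h4 w, adj h5 w & adj z w]].
  apply/setP => w; rewrite in_trace in_frame !inE.
  case zw: (adj z w); rewrite ?andbF ?andbT.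
    have h0z : adj h0 z by rewrite adj_sym.
    case h0w: (adj h0 w) => /=; first by have := hs_triangle h0z h0w; rewrite zw.
    rewrite -!orbA; have -> : adj a w && adj b w = (w == h0) || (w == h1); last first.
      by rewrite -!orbA.
    apply/idP/idP => [/andP[aw bw]|/orP[]/eqP->]; last first.
    - by have [-> ->] := hex_in hex H1.
    - by have [-> ->] := hex_in hex H0.
    have wH : w \in H by case: hex => _ _ <-; rewrite inE aw bw.
    by have [->|->] := hex_two hex za zb H0 H1 h01 z0 z1 wH zw; rewrite eqxx ?orbT.
  by rewrite /= !orbF; apply/esym/negbTE/negP => /orP[]/eqP e; rewrite e ?z0 ?z1 in zw.
rewrite cardsU (cardsU [set h0; h1]) cards2 h01.
have i2 : h2 \in [:: h2; h3; h4; h5] by rewrite inE eqxx.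
have i3 : h3 \in [:: h2; h3; h4; h5] by rewrite !inE eqxx orbT.
have i4 : h4 \in [:: h2; h3; h4; h5] by rewrite !inE eqxx !orbT.
have i5 : h5 \in [:: h2; h3; h4; h5] by rewrite !inE eqxx !orbT.
have := hs_cn3 (hex_indep hex H2 H3 h23) (ind _ i3) (ind _ i2); rewrite /triple_count => ->.
have := hs_cn3 (hex_indep hex H4 H5 h45) (ind _ i5) (ind _ i4); rewrite /triple_count => ->.
have no h k : h \in H -> k \in H -> adj h k = false.
  by move=> /(hex_in hex)[ah _] /(hex_in hex)[ak _]; apply: (hs_triangle ah ak).
rewrite (_ : [set h0; h1] :&: _ = set0); last first.
  apply/setP => w; rewrite !inE; apply/negP => /andP[/orP[]/eqP-> /andP[]].
    by rewrite no.
  by rewrite no.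
rewrite cards0 (_ : (_ :|: _) :&: _ = set0) ?cards0 //.
apply/setP => w; rewrite !inE; apply/negP => /andP[/orP[/orP[]/eqP->|] /and3P[]].
- by rewrite no.
- by rewrite no.
move=> w2 w3 _ /and3P[w4 w5 zw].
have [wa wb] := hex_linked_neq H0 z0 za zb H2 (etrans (adj_sym _ _) w2) zw.
rewrite ![adj _ w]adj_sym in w2 w3 w4.
have := fun j => hex_nth (i := 4) (j := j) hex.
by have [e|e] := hex_two hex wa wb H2 H3 h23 w2 w3 H4 w4; [move/(_ 2)|move/(_ 3)];
  rewrite /= e eqxx => /(_ isT isT isT).
Qed.

End Pole.

Lemma pole_twin z : adj z h0 -> adj z h1 -> z != a -> z != b ->
  exists g, [/\ g \in F, g != z, trace F g = trace F z & #|trace F z| = 6].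
Proof.
move=> z0 z1 za zb.
have far := pole_far z0 z1 za zb.
have [||w [wz w2 w3 wa wb]] := hex_link H0 z0 za zb H2 H3 h23.
- by apply: far; rewrite inE eqxx.
- by apply: far; rewrite !inE eqxx !orbT.
have ind h : h \in H -> adj z h -> indep w h.
  move=> hH zh; apply: (indep_common (c := z)) => //; last by rewrite adj_sym.
  have /andP[_ aw] := hex_far hex H2 w2 wa.
  by have [ah _] := hex_in hex hH; apply: contraNneq aw => ->.
(* The twin is the second common neighbour of [h0], [h1] and a vertex [w] over the second pair
   adjacent to [z]. *)
have [z' [z'z z'w z'0 z'1]] := 
  other_common z (ind _ H0 z0) (hex_indep hex H0 H1 h01) (ind _ H1 z1).
have [z'a z'b] := hex_linked_neq H2 w2 wa wb H0 z'0 (etrans (adj_sym _ _) z'w).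
have wz' : adj w z' by rewrite adj_sym.
have zz' : z != z' by rewrite eq_sym.
exists z'; split=> //; last exact: card_trace_pole.
  by rewrite in_frame ![adj _ z']adj_sym z'0 z'1 orbT.
apply/eqP; rewrite eqEsubset (pole_sub z0 z1 za zb z'0 z'1 z'z w2 w3 wa wb wz wz') andbT.
exact: (pole_sub z'0 z'1 z'a z'b z0 z1 zz' w2 w3 wa wb wz' wz).
Qed.

End HexadPair.

Definition has_twin F f :=
  exists g, [/\ g \in F, g != f, trace F g = trace F f & #|trace F f| = 6].

Lemma hex_twin (a b h0 h1 h2 h3 h4 h5 : G) : hexad a b h0 h1 h2 h3 h4 h5 ->
  has_twin (frame a b h0 h1 h2 h3 h4 h5) h0.
Proof.
move=> hex; have ind := hex_nth (i := 0) (j := 1) hex isT isT isT.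
have H0 : h0 \in [:: h0; h1; h2; h3; h4; h5] by rewrite inE eqxx.
have H1 : h1 \in [:: h0; h1; h2; h3; h4; h5] by rewrite !inE eqxx orbT.
exists h1; rewrite (trace_frame_hex hex) (hs_cn2 (hex_indep hex H0 H1 ind)).
split; rewrite // 1?eq_sym //; first by rewrite in_frame; have [-> ->] := hex_in hex H1.
by rewrite -frame_swap (trace_frame_hex (hexad_swap hex)) cnC.
Qed.

Lemma pair_twin (a b h0 h1 h2 h3 h4 h5 z : G) : hexad a b h0 h1 h2 h3 h4 h5 ->
  adj h0 z -> adj h1 z -> has_twin (frame a b h0 h1 h2 h3 h4 h5) z.
Proof.
move=> hex; rewrite ![adj _ z]adj_sym => z0 z1.
have self (a' b' : G) : hexad a' b' h0 h1 h2 h3 h4 h5 ->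
    has_twin (frame a' b' h0 h1 h2 h3 h4 h5) a'.
  move=> hex'; have [ab _ _] := hex'; exists b'.
  rewrite (trace_frame_pole hex') (hs_cn2 ab); split=> //.
  - have [_ b0] := hex_in hex' (mem_head _ _).
    rewrite in_frame [adj h0 _]adj_sym b0 [adj h1 _]adj_sym; have [|_ ->] := hex_in hex' (h := h1).
      by rewrite !inE eqxx orbT.
    by rewrite orbT.
  - by move: ab; rewrite indepC => /andP[].
  by rewrite -frame_sym (trace_frame_pole (hexad_sym hex')) cnC.
have [->|za] := eqVneq z a; first exact: self.
have [->|zb] := eqVneq z b; first by rewrite -frame_sym; apply: self; apply: hexad_sym.
exact: (pole_twin hex z0 z1 za zb).
Qed.

Lemma frame_twin (a b h0 h1 h2 h3 h4 h5 f : G) : hexad a b h0 h1 h2 h3 h4 h5 ->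
  f \in frame a b h0 h1 h2 h3 h4 h5 -> has_twin (frame a b h0 h1 h2 h3 h4 h5) f.
Proof.
move=> hex; have hex2 := hexad_rot hex; have hex4 := hexad_rot hex2.
rewrite in_frame => /or4P[/andP[af bf]|/andP[]|/andP[]|/andP[]].
- have : f \in [:: h0; h1; h2; h3; h4; h5] by case: hex => _ _ <-; rewrite inE af bf.
  rewrite !inE => /or4P[/eqP->|/eqP->|/eqP->|/or3P[]/eqP->].
  + exact: hex_twin.
  + by rewrite -frame_swap; apply: hex_twin; apply: hexad_swap.
  + by rewrite -frame_rot; apply: hex_twin.
  + by rewrite -frame_rot -frame_swap; apply: hex_twin; apply: hexad_swap.
  + by rewrite -2!frame_rot; apply: hex_twin.
  + by rewrite -2!frame_rot -frame_swap; apply: hex_twin; apply: hexad_swap.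
- exact: pair_twin.
- by rewrite -frame_rot; apply: pair_twin.
- by rewrite -2!frame_rot; apply: pair_twin.
Qed.

(** A moved vertex [v] would share with [s v] all six common neighbours of [a] and [v], but three
    pairwise non-adjacent vertices have only two. *)
Lemma automorphism_id (s : G -> G) a : injective s -> {mono s : x y / adj x y} ->
  s a = a -> (forall x, adj a x -> s x = x) -> forall v, s v = v.
Proof.
move=> s_inj s_adj sa sN v; apply/eqP/idPn => sv.
have av : indep a v.
  rewrite /indep; apply/andP; split.
    by apply: contraNneq sv => <-; rewrite sa.
  by apply: contra sv => /sN->.
have asv : indep a (s v) by rewrite /indep -{1 2}sa s_adj (inj_eq s_inj).
have sub : common_neighbours a v \subset [set w | [&& adj a w, adj v w & adj (s v) w]].
  apply/subsetP => w; rewrite !inE => /andP[aw vw].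
  by rewrite aw vw -(sN w aw) s_adj.
have vsv : indep v (s v).
  have [w] : exists w, w \in common_neighbours a v.
    by apply/set0Pn; rewrite -card_gt0 (hs_cn2 av).
  move=> /(subsetP sub); rewrite inE => /and3P[_ vw svw].
  by apply: (indep_common (c := w)); rewrite 1?[adj w _]adj_sym // eq_sym.
have := subset_leq_card sub; rewrite (hs_cn2 av).
by have := hs_cn3 av vsv asv; rewrite /triple_count => ->.
Qed.

Lemma pole_frame (a b h0 h1 h2 h3 h4 h5 : G) : hexad a b h0 h1 h2 h3 h4 h5 ->
  a \in frame a b h0 h1 h2 h3 h4 h5.
Proof.
move=> hex; have [a0 _] := hex_in hex (mem_head _ _).
have [|a1 _] := hex_in hex (h := h1); first by rewrite !inE eqxx orbT.
by rewrite in_frame [adj h0 a]adj_sym a0 [adj h1 a]adj_sym a1 orbT.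
Qed.

(** The points [x], [s x], [t x], [s (t x)] exhaust [Q], and [t (s x)] cannot be any of the first
    three. *)
Lemma involutions_commute (T : finType) (s t : T -> T) (Q : {set T}) (x : T) :
    involutive s -> involutive t -> #|Q| = 4 ->
    (forall y : T, y \in Q -> s y \in Q /\ s y != y) ->
    (forall y : T, y \in Q -> t y \in Q /\ t y != y) ->
  x \in Q -> s x != t x -> s (t x) = t (s x).
Proof.
move=> sK tK Q4 sQ tQ xQ st.
have [sxQ sx] := sQ x xQ; have [txQ tx] := tQ x xQ.
have [stQ tst] := sQ _ txQ; have [tsQ sts] := tQ _ sxQ.
have xst : x != s (t x) by apply: contraNneq st => {1}->; rewrite sK.
have sst : s x != s (t x) by rewrite (inj_eq (can_inj sK)) eq_sym.
have un : uniq [:: x; s x; t x; s (t x)].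
  by rewrite /= !inE !negb_or xst sst st [x == s x]eq_sym sx [x == t x]eq_sym tx eq_sym tst.
have E : [set w in [:: x; s x; t x; s (t x)]] = Q.
  apply/eqP; rewrite eqEcard Q4 cardsE (card_uniqP un) andbT.
  by apply/subsetP => w; rewrite in_set !in_cons in_nil orbF => /or4P[]/eqP->.
move: tsQ; rewrite -E in_set !in_cons in_nil orbF => /or4P[]/eqP e //.
- by move: st; rewrite -{2}e tK eqxx.
- by rewrite e eqxx in sts.
- by move/(can_inj tK): e => e; rewrite e eqxx in sx.
Qed.

Lemma automorphisms_commute (s t : G -> G) a : involutive s -> involutive t ->
    {mono s : x y / adj x y} -> {mono t : x y / adj x y} -> s a = a -> t a = a ->
    (forall x, adj a x -> s (t x) = t (s x)) ->
  forall v, s (t v) = t (s v).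
Proof.
move=> sK tK s_adj t_adj sa ta st v.
suff /(_ v) e : forall v, t (s (t (s v))) = v.
  by have := congr1 (s \o t) e; rewrite /= tK sK.
apply: (@automorphism_id _ a).
- by apply: can_inj (_ : cancel _ (fun v => s (t (s (t v))))) => w; rewrite tK sK tK sK.
- by move=> u w; rewrite t_adj s_adj t_adj s_adj.
- by rewrite sa ta sa ta.
by move=> x ax; rewrite -(st x ax) sK tK.
Qed.

Section FrameTau.

Variables a b h0 h1 h2 h3 h4 h5 : G.
Hypothesis hex : hexad a b h0 h1 h2 h3 h4 h5.
Local Notation H := [:: h0; h1; h2; h3; h4; h5].
Local Notation F := (frame a b h0 h1 h2 h3 h4 h5).
Local Notation s := (tau F).

Let F_twin f (fF : f \in F) := frame_twin hex fF.
Let H0 : h0 \in H. Proof. exact: mem_head. Qed.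
Let H2 : h2 \in H. Proof. by rewrite !inE eqxx !orbT. Qed.
Let H4 : h4 \in H. Proof. by rewrite !inE eqxx !orbT. Qed.

Let aF := pole_frame hex.

Lemma hex_fixed h : h \in H -> s h = h.
Proof.
move=> hH; apply: tau_in; rewrite in_frame.
by have [-> ->] := hex_in hex hH.
Qed.

Lemma pole_fixed : s a = a.
Proof. exact: tau_in. Qed.

Lemma frame_tauK : involutive s.
Proof. exact: (tauK F_twin aF). Qed.

Lemma frame_tau_adj u v : adj (s u) (s v) = adj u v.
Proof. exact: (tau_adj F_twin aF). Qed.

Variable x : G.
Hypotheses (ax : adj a x) (bx : adj b x = false).

Lemma cone_outside : x \notin F.
Proof.
have no h : h \in H -> adj h x = false.
  by move=> /(hex_in hex)[ah _]; apply: (hs_triangle ah ax).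
by rewrite in_frame bx andbF (no h0) // (no h2) // (no h4).
Qed.

Lemma cone_tau_neq : s x != x.
Proof. by have [_] := tauP F_twin aF cone_outside. Qed.

Lemma cone_tau : adj a (s x) /\ adj b (s x) = false.
Proof.
have bF : b \in F by rewrite -frame_sym; apply: pole_frame (hexad_sym hex).
have := frame_tau_adj a x; have := frame_tau_adj b x.
by rewrite pole_fixed (tau_in bF) ax bx.
Qed.

Lemma frame_tau_common z : z \in F -> adj z (s x) = adj z x.
Proof. by move=> zF; have := frame_tau_adj z x; rewrite (tau_in zF). Qed.

End FrameTau.

(** [a] is one common neighbour of [x], [h] and [k]; the other one is wanted. *)
Lemma cone_link (a b h0 h1 h2 h3 h4 h5 h k x : G) : hexad a b h0 h1 h2 h3 h4 h5 ->
    h \in [:: h0; h1; h2; h3; h4; h5] -> k \in [:: h0; h1; h2; h3; h4; h5] -> h != k ->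
    adj a x -> adj b x = false ->
  exists z, [/\ z != a, z != b, adj z x, adj z h & adj z k].
Proof.
move=> hex hH kH hk ax bx; have [ah bh] := hex_in hex hH; have [ak bk] := hex_in hex kH.
have ind m : adj a m -> adj b m -> indep x m.
  move=> am bm; apply: (indep_common (c := a)) => //.
  by apply: contraTneq bm => <-; rewrite bx.
have [z [za zx zh zk]] :=
  other_common a (ind _ ah bh) (hex_indep hex hH kH hk) (ind _ ak bk).
exists z; split=> //.
by apply: contraTneq zx => ->; rewrite bx.
Qed.

(** * Two splittings with a common pair give commuting involutions *)

Section Klein.

Variables a b h0 h1 h2 h3 h4 h5 : G.
Hypothesis hex : hexad a b h0 h1 h2 h3 h4 h5.
Local Notation H := [:: h0; h1; h2; h3; h4; h5].
Local Notation s := (tau (frame a b h0 h1 h2 h3 h4 h5)).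
Local Notation t := (tau (frame a b h0 h2 h1 h3 h4 h5)).

Let hex' : hexad a b h0 h2 h1 h3 h4 h5.
Proof. by apply: hexad_perm hex; rewrite (perm_cat2l [:: h0]) (perm_catCA [:: h1] [:: h2]). Qed.

Let H0 : h0 \in H. Proof. exact: mem_head. Qed.
Let H1 : h1 \in H. Proof. by rewrite !inE eqxx orbT. Qed.
Let H2 : h2 \in H. Proof. by rewrite !inE eqxx !orbT. Qed.
Let H4 : h4 \in H. Proof. by rewrite !inE eqxx !orbT. Qed.
Let H5 : h5 \in H. Proof. by rewrite !inE eqxx !orbT. Qed.
Let h01 : h0 != h1. Proof. exact: (hex_nth (i := 0) (j := 1) hex). Qed.
Let h02 : h0 != h2. Proof. exact: (hex_nth (i := 0) (j := 2) hex). Qed.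
Let h12 : h1 != h2. Proof. exact: (hex_nth (i := 1) (j := 2) hex). Qed.
Let h45 : h4 != h5. Proof. exact: (hex_nth (i := 4) (j := 5) hex). Qed.

Section Cone.

Variable x : G.
Hypotheses (ax : adj a x) (bx : adj b x = false).

(** If the images agree in [y], then [a], a vertex [z] over h0, h1 fixed by [s], and a vertex [z']
    over h0, h2 fixed by [t] are all common neighbours of [x], [y] and [h0]. Two of them coincide,
    so [z = z'] has three neighbours in the hexad. *)
Lemma klein_neq : s x != t x.
Proof.
apply/eqP => st; set y := t x in st.
have [z [za zb zx z0 z1]] := cone_link hex H0 H1 h01 ax bx.
have [z' [z'a z'b z'x z'0 z'2]] := cone_link hex H0 H2 h02 ax bx.
have zy : adj z y.
  by rewrite -st frame_tau_common // in_frame ![adj _ z]adj_sym z0 z1 orbT.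
have z'y : adj z' y.
  by rewrite frame_tau_common // in_frame ![adj _ z']adj_sym z'0 z'2 orbT.
have yx : x != y by rewrite eq_sym (cone_tau_neq hex').
have [ay _] := cone_tau hex' ax bx; rewrite -/y in ay.
have [a0 b0] := hex_in hex H0.
have x0 : indep h0 x by apply: (indep_common (c := a)) => //; apply: contraTneq b0 => ->; rewrite bx.
have y0 : indep y h0.
  have [_ b'y] := cone_tau hex' ax bx; apply: (indep_common (c := a)) => //.
  by apply: contraTneq b0 => <-; rewrite b'y.
have xy : indep x y by apply: (indep_common (c := a)).
rewrite indepC in x0; rewrite eq_sym in za.
have [e|e] := only_common xy y0 x0 za (And3 ax ay a0) (And3 zx zy z0) z'x z'y z'0.
  by rewrite e eqxx in z'a.
rewrite e in z'2; rewrite eq_sym in za.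
have [e'|e'] := hex_two hex za zb H0 H1 h01 z0 z1 H2 z'2.
  by have := h02; rewrite -e' eqxx.
by have := h12; rewrite -e' eqxx.
Qed.

(** A vertex [z] over the shared pair h4, h5 and adjacent to [x] is fixed by both involutions. The
    common neighbours of [z] and [a] other than h4, h5 form a set of four elements on which both act
    without fixed points. *)
Lemma klein_coneC : s (t x) = t (s x).
Proof.
have [z [za zb zx z4 z5]] := cone_link hex H4 H5 h45 ax bx.
have zF : z \in frame a b h0 h1 h2 h3 h4 h5.
  by rewrite in_frame ![adj _ z]adj_sym z4 z5 !orbT.
have zF' : z \in frame a b h0 h2 h1 h3 h4 h5.
  by rewrite in_frame ![adj _ z]adj_sym z4 z5 !orbT.
pose Q : {set G} := [set y | [&& adj z y, adj a y & ~~ adj b y]].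
have Q4 : #|Q| = 4.
  have az : indep z a by rewrite indepC (hex_far hex H4 z4 za).
  have sub : [set h4; h5] \subset common_neighbours z a.
    have [a4 _] := hex_in hex H4; have [a5 _] := hex_in hex H5.
    by apply/subsetP => w; rewrite !inE => /orP[]/eqP->; rewrite ?z4 ?z5.
  have -> : Q = common_neighbours z a :\: [set h4; h5].
    apply/setP => w; rewrite !inE andbA [LHS]andbC; case: (boolP (adj z w && adj a w)); rewrite ?andbF //.
    move=> /andP[zw aw]; rewrite !andbT; congr (~~ _).
    apply/idP/orP => [bw|[]/eqP->]; [|by have [] := hex_in hex H4|by have [] := hex_in hex H5].
    have wH : w \in H by case: hex => _ _ <-; rewrite inE aw bw.
    by have [->|->] := hex_two hex za zb H4 H5 h45 z4 z5 wH zw; rewrite eqxx; [left|right].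
  by rewrite cardsDS // (hs_cn2 az) cards2 h45.
have sQ y : (s y \in Q) = (y \in Q).
  have bF : b \in frame a b h0 h1 h2 h3 h4 h5 by rewrite -frame_sym; apply: pole_frame (hexad_sym hex).
  by rewrite !inE !(frame_tau_common hex) // pole_frame.
have tQ y : (t y \in Q) = (y \in Q).
  have bF : b \in frame a b h0 h2 h1 h3 h4 h5 by rewrite -frame_sym; apply: pole_frame (hexad_sym hex').
  by rewrite !inE !(frame_tau_common hex') // pole_frame.
have xQ : x \in Q by rewrite inE zx ax bx.
apply: (involutions_commute (frame_tauK hex) (frame_tauK hex') Q4 _ _ xQ klein_neq) => y;
  rewrite inE => /and3P[zy ay /negbTE by'].
- by split; [rewrite sQ inE zy ay by'|apply: cone_tau_neq].
- by split; [rewrite tQ inE zy ay by'|apply: cone_tau_neq].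
Qed.

End Cone.

Lemma kleinC v : s (t v) = t (s v).
Proof.
apply: (automorphisms_commute (a := a) (frame_tauK hex) (frame_tauK hex')).
- exact: frame_tau_adj.
- exact: frame_tau_adj.
- exact: pole_fixed.
- exact: pole_fixed.
move=> x ax; case bx: (adj b x); last exact: klein_coneC.
have xH : x \in H by case: hex => _ _ <-; rewrite inE ax bx.
have xH' : x \in [:: h0; h2; h1; h3; h4; h5] by case: hex' => _ _ <-; rewrite inE ax bx.
by rewrite (hex_fixed hex' xH') (hex_fixed hex xH) (hex_fixed hex' xH').
Qed.

End Klein.

Lemma hexad_ex : exists a b h0 h1 h2 h3 h4 h5 x,
  [/\ hexad a b h0 h1 h2 h3 h4 h5, adj a x & adj b x = false].
Proof.
have [G100 _ _ _] := srg.
have [a _] : exists a : G, a \in [set: G] by apply/set0Pn; rewrite -card_gt0 cardsT G100.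
have [b] : exists b, b \in [set: G] :\: (a |: [set y | adj a y]).
  apply/set0Pn; rewrite -card_gt0 cardsDS ?subsetT // cardsT G100 cardsU1 (hs_deg).
  by case: (_ \notin _).
rewrite !inE negb_or andbT => /andP[ba nab].
have ab : indep a b by rewrite /indep eq_sym ba.
have [x] : exists x, x \in [set y | adj a y] :\: common_neighbours a b.
  apply/set0Pn; rewrite -card_gt0 cardsDS.
    by rewrite (hs_deg) (hs_cn2 ab).
  by apply/subsetP => w; rewrite !inE => /andP[].
rewrite !inE => /andP[nbx ax]; rewrite ax /= in nbx.
have := hs_cn2 ab; rewrite cardE.
case E: (enum _) => [|h0 [|h1 [|h2 [|h3 [|h4 [|h5 [|]]]]]]] // _.
exists a, b, h0, h1, h2, h3, h4, h5, x; split=> //; last exact: negbTE.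
split=> // [|h]; first by rewrite -E enum_uniq.
by rewrite -E mem_enum.
Qed.

Lemma hs_klein : exists s t : G -> G, exists v0,
  [/\ [/\ involutive s, involutive t & forall v, s (t v) = t (s v)],
      {mono s : x y / adj x y}, {mono t : x y / adj x y}
    & [/\ s v0 != v0, t v0 != v0 & s v0 != t v0]].
Proof.
have [a [b [h0 [h1 [h2 [h3 [h4 [h5 [x [hex ax bx]]]]]]]]]] := hexad_ex.
have hex' : hexad a b h0 h2 h1 h3 h4 h5.
  by apply: hexad_perm hex; rewrite (perm_cat2l [:: h0]) (perm_catCA [:: h1] [:: h2]).
exists (tau (frame a b h0 h1 h2 h3 h4 h5)), (tau (frame a b h0 h2 h1 h3 h4 h5)), x.
split=> [|u w|u w|].
- by split=> [||v]; [exact: frame_tauK|exact: frame_tauK|exact: kleinC].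
- exact: frame_tau_adj.
- exact: frame_tau_adj.
- by split; [apply: cone_tau_neq|apply: cone_tau_neq|apply: klein_neq].
Qed.

End HigmanSims.

Definition translation (Z : zmodType) (e x : Z) : Z := x + e.

Lemma translation_adj (Z : finZmodType) (S : {set Z}) (S_sym : forall d, (- d \in S) = (d \in S))
    (S_0 : 0 \notin S) (e x y : cayley S_sym S_0) :
  adj (translation (e : Z) x : cayley S_sym S_0) (translation (e : Z) y) = adj x y.
Proof. by rewrite /= /cayley_adj /= /translation opprD addrACA subrr addr0. Qed.

Lemma translationK (e : 'rV['Z_2]_4) : involutive (translation e).
Proof.
have two a : a + a = 0 :> 'Z_2 by case: a => [[|[|//]] ?]; apply: val_inj.
by move=> x; apply/rowP => j; rewrite !mxE -addrA two addr0.
Qed.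

Theorem theorem1 (R : realType) (G : sgraph)
    (hG : G = paley9 \/ G = clebsch16 \/ is_higman_sims G) :
  exists Gq : qgraph R,
    noncommutative Gq
    /\ connected_qgraph Gq
    /\ ((exists p, three_point_regular (qgraph_of R G) p) /\
        forall p, three_point_regular (qgraph_of R G) p -> three_point_regular Gq p)
    /\ same_spectrum (laplacian (qadj Gq)) (laplacian (qadj (qgraph_of R G)))
    /\ same_minpoly (qadj Gq) (qadj (qgraph_of R G))
    /\ qgraph_iso (qgraph_of R G) Gq.
Proof.
case: hG => [->|[->|srg]].
(* The point (1, 1) has four images, because 1 and -1 differ in Z_3. *)
- apply: (@klein_quantum_graph R paley9 (flip 0) (flip 1) (flipK 0) (flipK 1) flipC
    (flip_adj 0) (flip_adj 1) (const_mx 1)).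
  + by apply/eqP => /rowP/(_ 0); rewrite !mxE.
  + by apply/eqP => /rowP/(_ 1); rewrite !mxE.
  + by apply/eqP => /rowP/(_ 0); rewrite !mxE.
  + exact: srg_connected paley_srg _.
  + exact: paley_regular.
- apply: (@klein_quantum_graph R clebsch16 (translation (delta_mx 0 i0))
    (translation (delta_mx 0 i1)) (translationK _) (translationK _) _ _ _ 0).
  + by move=> x; rewrite /translation addrAC.
  + by move=> x y; apply: translation_adj.
  + by move=> x y; apply: translation_adj.
  + by apply/eqP => /rowP/(_ i0); rewrite !mxE.
  + by apply/eqP => /rowP/(_ i1); rewrite !mxE.
  + by apply/eqP => /rowP/(_ i0); rewrite !mxE.
  + exact: srg_connected clebsch_srg _.
  (* With q = 1 both sides of the variance equation are 20. *)
  + exact: (@triangle_free_regular R _ 16 5 2 1 clebsch_srg).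
have [s [t [v0 [[sK tK st] s_adj t_adj [s0 t0 st0]]]]] := hs_klein srg.
apply: (@klein_quantum_graph R G s t sK tK st s_adj t_adj v0 s0 t0 st0).
  exact: srg_connected srg _.
(* With q = 2 both sides of the variance equation are 552. *)
exact: (@triangle_free_regular R G 100 22 6 2 srg).
Qed.
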